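(* Let $A_\Gamma$ be an Artin group in the class $\mathcal{B}$, that is, such that for each free of infinity subset $Y\subset V(\Gamma)$ and for all parabolic subgroups $P_1,P_2$ of $A_Y$, the intersection $P_1\cap P_2$ is a parabolic subgroup of $A_Y$. (1) Let $\psi\colon L\to A_\Gamma$ be a (not necessarily continuous) group homomorphism from a locally compact Hausdorff group $L$ into $A_\Gamma$. If $L$ is almost connected, then $\psi(L)$ is contained in a complete parabolic subgroup of $A_\Gamma$. (2) If all complete standard parabolic subgroups of $A_\Gamma$ are $lcH$-slender, then $A_\Gamma$ is $lcH$-slender.
   Context: Let $\Gamma$ be a finite non-empty simplicial graph with vertex set $V(\Gamma)$, edge set $E(\Gamma)$ and an edge-labeling $m\colon E(\Gamma)\to\{2,3,4,\ldots\}$. The Artin group $A_\Gamma$ is the group with generating set $V(\Gamma)$ and relations $vwv\cdots = wvw\cdots$ (both sides alternating words with $m(\{v,w\})$ letters) for each $\{v,w\}\in E(\Gamma)$. For $X\subset V(\Gamma)$, $A_X$ denotes the subgroup of $A_\Gamma$ generated by $X$ (trivial if $X=\emptyset$); it is canonically isomorphic to the Artin group of the induced labeled subgraph $\langle X\rangle$ (van der Lek). A parabolic subgroup of $A_\Gamma$ is a conjugate $gA_Xg^{-1}$ with $g\in A_\Gamma$, $X\subset V(\Gamma)$; parabolic subgroups of $A_Y$ are the subgroups $gA_Xg^{-1}$ with $g\in A_Y$, $X\subset Y$. A subset $X\subset V(\Gamma)$ is free of infinity if $\{v,w\}\in E(\Gamma)$ for all distinct $v,w\in X$; in this case $A_X$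 is called a complete standard parabolic subgroup, and its conjugates are called complete parabolic subgroups. A locally compact Hausdorff group $L$ is almost connected if $L/L^\circ$ is compact, where $L^\circ$ is the connected component of the identity. A discrete group $G$ is $lcH$-slender if every group homomorphism from a locally compact Hausdorff group into $G$ (with the discrete topology) is continuous. *)

(* Defs.v *)
From HB Require Import structures.
From mathcomp Require Import all_boot.
From mathcomp Require Import all_classical topology.

Set Implicit Arguments.
Unset Strict Implicit.
Unset Printing Implicit Defensive.

Local Open Scope classical_set_scope.
Local Open Scope quotient_scope.
Local Open Scope group_scope.

(* A letter [(x, false)] stands for the generator [x] and [(x, true)] for its
   inverse; [R u v] means that [u = v] is a defining relation. *)
Definition word (X : Type) := seq (X * bool).

Section Presentation.
Context (X : choiceType) (R : word X -> word X -> Prop).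

Inductive pres_eq : word X -> word X -> Prop :=
| pres_eq_refl u : pres_eq u u
| pres_eq_sym u v : pres_eq u v -> pres_eq v u
| pres_eq_trans u v w : pres_eq u v -> pres_eq v w -> pres_eq u w
| pres_eq_cat u u' v v' :
    pres_eq u u' -> pres_eq v v' -> pres_eq (u ++ v) (u' ++ v')
| pres_eq_cancel x b : pres_eq [:: (x, b); (x, ~~ b)] [::]
| pres_eq_rel u v : R u v -> pres_eq u v.

Definition pres_eqb : rel (word X) := fun u v => `[< pres_eq u v >].

Lemma pres_eqb_refl : reflexive pres_eqb.
Proof. by move=> u; apply/asboolP; exact: pres_eq_refl. Qed.

Lemma pres_eqb_sym : symmetric pres_eqb.
Proof. by move=> u v; apply/asboolP/asboolP; exact: pres_eq_sym. Qed.

Lemma pres_eqb_trans : transitive pres_eqb.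
Proof.
by move=> v u w /asboolP uv /asboolP vw; apply/asboolP; exact: pres_eq_trans vw.
Qed.

Canonical pres_equiv := EquivRel pres_eqb pres_eqb_refl pres_eqb_sym pres_eqb_trans.

Definition pres_group : Type := {eq_quot pres_equiv}.

HB.instance Definition _ := Choice.on pres_group.
HB.instance Definition _ := Quotient.copy pres_group {eq_quot pres_equiv}.

Lemma pres_group_eqP u v :
  (\pi_pres_group u = \pi_pres_group v) <-> pres_eq u v.
Proof.
split=> [/(@eqmodP _ pres_equiv)/asboolP //|uv].
by apply/(@eqmodP _ pres_equiv); apply/asboolP.
Qed.

Definition word_inv (u : word X) : word X := rev [seq (a.1, ~~ a.2) | a <- u].

Lemma word_inv_cat u v : word_inv (u ++ v) = word_inv v ++ word_inv u.
Proof. by rewrite /word_inv map_cat rev_cat. Qed.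

Lemma word_invK : involutive word_inv.
Proof.
move=> u; rewrite /word_inv map_rev revK -map_comp -[RHS]map_id.
by apply: eq_map => -[x b] /=; rewrite negbK.
Qed.

Lemma pres_eq_catV u : pres_eq (u ++ word_inv u) [::].
Proof.
elim: u => [|[x b] u IHu]; first exact: pres_eq_refl.
have -> : ((x, b) :: u) ++ word_inv ((x, b) :: u)
    = [:: (x, b)] ++ (u ++ word_inv u) ++ [:: (x, ~~ b)].
  by rewrite /word_inv /= rev_cons -cats1 catA.
apply: pres_eq_trans (pres_eq_cancel x b).
apply: (@pres_eq_cat [:: (x, b)] [:: (x, b)]); first exact: pres_eq_refl.
apply: (@pres_eq_cat _ [::] _ [:: (x, ~~ b)]) => //; exact: pres_eq_refl.
Qed.

Lemma pres_eq_inv u v : pres_eq u v -> pres_eq (word_inv u) (word_inv v).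
Proof.
move=> uv.
have e1 : pres_eq (word_inv u) (word_inv u ++ (v ++ word_inv v)).
  rewrite -[X in pres_eq X _]cats0; apply: pres_eq_cat; first exact: pres_eq_refl.
  exact/pres_eq_sym/pres_eq_catV.
apply: (pres_eq_trans e1); rewrite catA -[X in pres_eq _ X]cat0s.
apply: pres_eq_cat; last exact: pres_eq_refl.
apply: (@pres_eq_trans _ (word_inv u ++ u)).
  by apply: pres_eq_cat; [exact: pres_eq_refl|exact: pres_eq_sym].
by rewrite -{2}(word_invK u); exact: pres_eq_catV.
Qed.

Definition pres_one : pres_group := \pi_pres_group [::].
Definition pres_mul (a b : pres_group) : pres_group :=
  \pi_pres_group (repr a ++ repr b).
Definition pres_inv (a : pres_group) : pres_group :=
  \pi_pres_group (word_inv (repr a)).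

Lemma pres_repr u : pres_eq (repr (\pi_pres_group u)) u.
Proof. by apply/pres_group_eqP; rewrite reprK. Qed.

Lemma pres_mulE u v :
  pres_mul (\pi_pres_group u) (\pi_pres_group v) = \pi_pres_group (u ++ v).
Proof. by apply/pres_group_eqP; apply: pres_eq_cat; exact: pres_repr. Qed.

Lemma pres_invE u : pres_inv (\pi_pres_group u) = \pi_pres_group (word_inv u).
Proof. by apply/pres_group_eqP; apply: pres_eq_inv; exact: pres_repr. Qed.

Lemma pres_mulA : associative pres_mul.
Proof.
elim/quotW=> u; elim/quotW=> v; elim/quotW=> w.
by rewrite (pres_mulE v w) (pres_mulE u v) (pres_mulE u) (pres_mulE _ w) catA.
Qed.

Lemma pres_mul1g : left_id pres_one pres_mul.
Proof. by elim/quotW=> u; rewrite (pres_mulE [::] u). Qed.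

Lemma pres_mulg1 : right_id pres_one pres_mul.
Proof. by elim/quotW=> u; rewrite (pres_mulE u [::]) cats0. Qed.

Lemma pres_mulgV : right_inverse pres_one pres_inv pres_mul.
Proof.
elim/quotW=> u; rewrite (pres_invE u) (pres_mulE u).
by apply/pres_group_eqP; exact: pres_eq_catV.
Qed.

Lemma pres_mulVg : left_inverse pres_one pres_inv pres_mul.
Proof.
elim/quotW=> u; rewrite (pres_invE u) (pres_mulE _ u); apply/pres_group_eqP.
by rewrite -{2}(word_invK u); exact: pres_eq_catV.
Qed.

HB.instance Definition _ := isGroup.Build pres_group
  pres_mulA pres_mul1g pres_mulg1 pres_mulVg pres_mulgV.

Definition pres_gen (x : X) : pres_group := \pi_pres_group [:: (x, false)].

End Presentation.

Section Subgroups.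
Context (G : groupType).

Definition generated (S : set G) : set G :=
  smallest [set H : set G | group_closed (mem H)] S.

Lemma generated_group_closed (S : set G) : group_closed (mem (generated S)).
Proof.
split; first by apply/mem_set => H [[H1 _] _]; exact: set_mem H1.
move=> x y /set_mem Sx /set_mem Sy; apply/mem_set => H HS.
by apply: set_mem; apply: HS.1.2; apply/mem_set; [exact: Sx|exact: Sy].
Qed.

Definition conj_set (g : G) (A : set G) : set G := [set g * a * g^-1 | a in A].

End Subgroups.

(* [label] is total on sets of vertices; only its values on edges matter. *)
Record artin_graph := ArtinGraph {
  vertex :> finType;
  edges : {set {set vertex}};
  label : {set vertex} -> nat;
  vertex_neq0 : 0 < #|vertex|;
  edges_card2 : forall e, e \in edges -> #|e| = 2;
  label_ge2 : forall e, e \in edges -> 2 <= label e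
}.

Section ArtinGroup.
Context (Gamma : artin_graph).
Implicit Types (X Y : {set Gamma}).

Definition alternating (v w : Gamma) (n : nat) : word Gamma :=
  mkseq (fun i => (if odd i then w else v, false)) n.

Definition artin_rel (u u' : word Gamma) : Prop :=
  exists v w : Gamma, [set v; w]%SET \in edges Gamma /\
    u = alternating v w (label [set v; w]%SET) /\
    u' = alternating w v (label [set v; w]%SET).

Definition artin_group := pres_group artin_rel.
HB.instance Definition _ := Group.on artin_group.

Definition artin_gen (v : Gamma) : artin_group := pres_gen artin_rel v.

Definition std_parabolic X : set artin_group :=
  generated (artin_gen @` [set` X]).

Definition std_parabolic_group X : Type :=
  {a : artin_group | a \in std_parabolic X}.
HB.instance Definition _ X := SubChoice.on (std_parabolic_group X).
HB.instance Definition _ X :=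
  SubChoice_isSubGroup.Build artin_group _ (std_parabolic_group X)
    (generated_group_closed (artin_gen @` [set` X])).

Definition parabolic_in Y (P : set artin_group) : Prop :=
  exists g X, [/\ std_parabolic Y g, X \subset Y &
                  P = conj_set g (std_parabolic X)].

Definition free_of_infinity X : Prop :=
  {in X &, forall v w, v != w -> [set v; w]%SET \in edges Gamma}.

Definition complete_parabolic (P : set artin_group) : Prop :=
  exists g X, free_of_infinity X /\ P = conj_set g (std_parabolic X).

Definition class_B : Prop :=
  forall Y, free_of_infinity Y ->
  forall P1 P2, parabolic_in Y P1 -> parabolic_in Y P2 ->
    parabolic_in Y (P1 `&` P2).

End ArtinGroup.

HB.structure Definition PreTopologicalGroup := {L of Topological L & Group L}.

HB.mixin Record PreTopologicalGroup_isTopologicalGroup L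
    of PreTopologicalGroup L := {
  mulg_continuous : continuous (fun p : L * L => p.1 * p.2);
  invg_continuous : continuous (fun x : L => x^-1)
}.

#[short(type="topologicalGroupType")]
HB.structure Definition TopologicalGroup :=
  {L of PreTopologicalGroup L & PreTopologicalGroup_isTopologicalGroup L}.

Section IdentityComponent.
Context (L : topologicalGroupType).

Definition id_component : set L := connected_component [set: L] 1.

Lemma mulgl_continuous (a : L) : continuous (fun x : L => a * x).
Proof.
move=> x; apply: (@continuous_comp _ _ _ (fun x : L => (a, x))
  (fun p : L * L => p.1 * p.2)); last exact: mulg_continuous.
by apply: cvg_pair => /=; [exact: cvg_cst|exact: cvg_id].
Qed.

Lemma id_component_group_closed : group_closed (mem id_component).
Proof.
have c1 : id_component 1 by exact: connected_component_refl.
have cC : connected id_component by exact: component_connected.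
have cI (f : L -> L) y : continuous f -> id_component y -> f y = 1 ->
    forall x, id_component x -> id_component (f x).
  move=> fc Cy fy x Cx.
  have cf : connected (f @` id_component).
    by apply: connected_continuous_connected => // z; exact/continuous_subspaceT.
  exists (f @` id_component); last by exists x.
  by split=> //; exists y.
have Vc x : id_component x -> id_component x^-1.
  by apply: (cI (fun x => x^-1) 1) => //; [exact: invg_continuous|exact: invg1].
split; first exact: mem_set.
move=> x y /set_mem Cx /set_mem Cy; apply/mem_set.
apply: (cI (fun z => x * z) x^-1); first exact: mulgl_continuous.
- exact: Vc.
- exact: mulgV.
- exact: Vc.
Qed.

(* The relation of lying in the same left coset of the identity component. *)
Definition id_component_rel : rel L := fun x y => x^-1 * y \in id_component.

Lemma id_component_rel_refl : reflexive id_component_rel.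
Proof. by move=> x; rewrite /id_component_rel mulVg; exact: id_component_group_closed.1. Qed.

Lemma id_component_rel_sym : symmetric id_component_rel.
Proof.
suff h x y : id_component_rel x y -> id_component_rel y x.
  by move=> x y; apply/idP/idP; exact: h.
rewrite /id_component_rel => xy.
by have := group_closedV id_component_group_closed xy; rewrite invgM invgK.
Qed.

Lemma id_component_rel_trans : transitive id_component_rel.
Proof.
rewrite /id_component_rel => y x z xy yz.
have := (group_closedM id_component_group_closed) _ _ xy yz.
by rewrite -mulgA (mulgA y) mulgV mul1g.
Qed.

Canonical id_component_equiv := EquivRel id_component_rel
  id_component_rel_refl id_component_rel_sym id_component_rel_trans.

Definition almost_connected : Prop :=
  compact [set: quotient_topology {eq_quot id_component_equiv}].

Definition locally_compact_hausdorff : Prop :=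
  locally_compact [set: L] /\ hausdorff_space L.

End IdentityComponent.

Definition lcH_slender (G : groupType) : Prop :=
  forall L : topologicalGroupType, locally_compact_hausdorff L ->
  forall f : UMagmaMorphism.type L G,
    continuous (f : L -> discrete_topology G).

(* Main.v *)
From HB Require Import structures.
From mathcomp Require Import all_boot all_order all_algebra.
From mathcomp Require Import Rstruct.
From mathcomp Require Import all_classical reals topology trigo.
From mathcomp Require Import zify ring lra.
Require Import Defs.

(** Let psi be a homomorphism from a locally compact Hausdorff group L to an
    Artin group A, and let L1 be the closure of its kernel.  As A is countable,
    L1 is open by Baire, and each coset of the kernel contained in L1 is dense
    in L1.  So elements of L1 with prescribed images can be taken as close to 1
    as desired, and compactness then solves every infinite system
    y_n = h_n * y_(n+1) ^ k_n inside M = psi(L1) ([solve_nested],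
    [image_power_solvable]).  It remains to see that a subgroup M of A with
    this property lies in a complete parabolic subgroup
    ([power_solvable_parabolic]).  For if L is almost connected, every element
    of L has a power in L1; and if the complete standard parabolic subgroups
    are slender, the restriction of psi to the open subgroup L1 is continuous.

    For non-adjacent c and d the group A is the amalgam of A_(V-c) and A_(V-d)
    over A_(V-c-d), and it acts on the corresponding tree.  The hypothesis on
    intersections, given for cliques only, propagates along geodesics of these
    trees: intersecting a complete parabolic subgroup with a parabolic one
    gives a complete parabolic subgroup ([complete_intersection]).  Chains of
    complete parabolic subgroups have bounded length, parabolic closures exist,
    and a subgroup whose elements are all elliptic on all these trees is
    contained in a complete parabolic subgroup ([elliptic_complete]).  The tool
    behind the facts about inclusions of parabolic subgroups
    ([parabolic_in_std], [std_parabolicI]) is a retraction of A onto A_Y, which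
    is read off from the action of the Coxeter group on its roots.

    To exclude hyperbolic elements, call an element pure if it acts trivially
    in the canonical linear representation.  On pure elements the retractions
    are homomorphisms, so for a pure subgroup H of A_S in which the systems
    above are solvable, induction on S puts the edge stabilizers of H into
    complete parabolic subgroups.  The chain condition makes the axes of
    elements of H rigid: an element of H which fixes, or reverses, a long
    segment of an axis does so with the whole axis ([axis_rigid], [axis_flip]).
    If h in H is hyperbolic, solve y_n = h^a * y_(n+1) ^ k_n with k_n even and
    large.  A fixed point of y_n would make h^(-a) reverse a long segment of
    the axis of y_(n+1), which is impossible for a hyperbolic isometry; so all
    y_n are hyperbolic, and their displacements decrease for ever
    ([solvable_elliptic]).

    Finally M is torsion modulo its pure elements ([power_pure]).  The linear
    representation is defined over the ring generated by 2 cos(pi/N), which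
    provides congruence subgroups of uniform exponent.  For w in M solve
    y_n = w ^ e_n * y_(n+1) ^ k_n for every sequence e of zeros and ones.
    There are uncountably many e and countably many y_0; two sequences with the
    same y_0 yield, modulo every power of 2, a congruence between an odd and an
    even power of an element of 2-power order, which is therefore trivial. *)

Set Implicit Arguments.
Unset Strict Implicit.
Unset Printing Implicit Defensive.

Local Open Scope classical_set_scope.
Local Open Scope group_scope.

(** * Words and subgroups *)

Section SubgroupTheory.
Local Open Scope quotient_scope.
Local Open Scope group_scope.
Context (G : groupType).
Implicit Types (H A B : set G) (g h x : G).

Definition subgroup H :=
  [/\ H 1, (forall x y, H x -> H y -> H (x * y)) & (forall x, H x -> H x^-1)].

Lemma subgroupX H x n : subgroup H -> H x -> H (x ^+ n).
Proof.
by move=> [H1 HM _] Hx; elim: n => [|n IHn]; rewrite ?expg0 // expgS; apply: HM.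
Qed.

Lemma group_closed_subgroup H : group_closed (mem H) -> subgroup H.
Proof.
move=> Hc; split; first exact: set_mem Hc.1.
- by move=> x y Hx Hy; apply/set_mem/(group_closedM Hc); apply/mem_set.
- by move=> x Hx; apply/set_mem/(group_closedV Hc); apply/mem_set.
Qed.

Lemma subgroup_group_closed H : subgroup H -> group_closed (mem H).
Proof.
move=> [H1 HM HV]; split; first exact/mem_set.
by move=> x y /set_mem Hx /set_mem Hy; apply/mem_set/HM => //; apply: HV.
Qed.

Lemma generated_subgroup (S : set G) : subgroup (generated S).
Proof. exact/group_closed_subgroup/generated_group_closed. Qed.

Lemma sub_generated (S : set G) : S `<=` generated S.
Proof. by move=> x Sx H [_]; apply. Qed.

Lemma generated_min (S H : set G) : subgroup H -> S `<=` H -> generated S `<=` H.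
Proof.
by move=> /subgroup_group_closed Hc SH x; apply; split.
Qed.

Lemma subgroupI A B : subgroup A -> subgroup B -> subgroup (A `&` B).
Proof.
move=> [A1 AM AV] [B1 BM BV]; split=> //.
- by move=> x y [] ? ? [] ? ?; split; [apply: AM|apply: BM].
- by move=> x [] ? ?; split; [apply: AV|apply: BV].
Qed.

Lemma conj_setE g A x : conj_set g A x <-> A (g^-1 * x * g).
Proof.
split=> [[a Aa <-]|Ax]; first by rewrite !mulgA mulVg mul1g mulgVK.
by exists (g^-1 * x * g) => //; rewrite !mulgA mulgV mul1g mulgK.
Qed.

Lemma conj_set1 A : conj_set 1 A = A.
Proof.
by apply/seteqP; split=> x; rewrite conj_setE invg1 mul1g mulg1.
Qed.

Lemma conj_setM g h A : conj_set (g * h) A = conj_set g (conj_set h A).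
Proof.
by apply/seteqP; split=> x; rewrite !conj_setE invgM !mulgA.
Qed.

Lemma conj_setK g A : conj_set g^-1 (conj_set g A) = A.
Proof. by rewrite -conj_setM mulVg conj_set1. Qed.

Lemma conj_setVK g A : conj_set g (conj_set g^-1 A) = A.
Proof. by rewrite -conj_setM mulgV conj_set1. Qed.

Lemma conj_setS g A B : A `<=` B -> conj_set g A `<=` conj_set g B.
Proof. by move=> AB x /conj_setE /AB Bx; apply/conj_setE. Qed.

Lemma conj_setI g A B : conj_set g (A `&` B) = conj_set g A `&` conj_set g B.
Proof.
apply/seteqP; split=> x; first by move=> /conj_setE [] ? ?; split; apply/conj_setE.
by move=> [] /conj_setE ? /conj_setE ?; apply/conj_setE.
Qed.

Lemma conj_subgroup g A : subgroup A -> subgroup (conj_set g A).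
Proof.
move=> [A1 AM AV]; split.
- by apply/conj_setE; rewrite mulg1 mulVg.
- move=> x y /conj_setE Ax /conj_setE Ay; apply/conj_setE.
  by have := AM _ _ Ax Ay; rewrite !mulgA mulgK.
- move=> x /conj_setE /AV Ax; apply/conj_setE.
  by move: Ax; rewrite !invgM invgK !mulgA.
Qed.

End SubgroupTheory.

Section WordActions.
Local Open Scope quotient_scope.
Local Open Scope group_scope.
Context (X : choiceType) (R : word X -> word X -> Prop) (T : Type).
Context (step : X * bool -> T -> T) (I : T -> Prop).

Definition lrun (u : word X) (p : T) := foldr step p u.
Definition rrun (u : word X) (p : T) := foldl (fun p a => step a p) p u.

Hypothesis stepI : forall a p, I p -> I (step a p).
Hypothesis stepK : forall x b p, I p -> step (x, ~~ b) (step (x, b) p) = p.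

Lemma lrun_cat u v p : lrun (u ++ v) p = lrun u (lrun v p).
Proof. by rewrite /lrun foldr_cat. Qed.

Lemma rrun_cat u v p : rrun (u ++ v) p = rrun v (rrun u p).
Proof. by rewrite /rrun foldl_cat. Qed.

Lemma lrunI u p : I p -> I (lrun u p).
Proof. by move=> Ip; elim: u => //= a u; apply: stepI. Qed.

Lemma rrunI u p : I p -> I (rrun u p).
Proof. by elim: u p => //= a u IHu p Ip; apply/IHu/stepI. Qed.

Lemma lrun_pres_eq :
  (forall u v p, R u v -> I p -> lrun u p = lrun v p) ->
  forall u v p, pres_eq R u v -> I p -> lrun u p = lrun v p.
Proof.
move=> runR u v p uv; elim: uv p => {u v} //.
- by move=> u v _ IH p Ip; rewrite IH.
- by move=> u v w _ IH1 _ IH2 p Ip; rewrite IH1 // IH2.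
- by move=> u u' v v' _ IH1 _ IH2 p Ip; rewrite !lrun_cat IH2 // IH1 //; apply: lrunI.
- by move=> x b p Ip /=; have := stepK x (~~ b) Ip; rewrite negbK.
- by move=> u v uv p Ip; apply: runR.
Qed.

(** Words act on states one letter at a time; on a set [I] where the letters x and
    x^-1 act by inverse maps, checking the defining relations is enough to get
    an action of the group.  Both the linear representation and the retraction
    are obtained in this way, and the trees with [lrun_pres_eq]. *)
Lemma rrun_pres_eq :
  (forall u v p, R u v -> I p -> rrun u p = rrun v p) ->
  forall u v p, pres_eq R u v -> I p -> rrun u p = rrun v p.
Proof.
move=> runR u v p uv; elim: uv p => {u v} //.
- by move=> u v _ IH p Ip; rewrite IH.
- by move=> u v w _ IH1 _ IH2 p Ip; rewrite IH1 // IH2.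
- by move=> u u' v v' _ IH1 _ IH2 p Ip; rewrite !rrun_cat IH1 // IH2 //; apply: rrunI.
- by move=> u v uv p Ip; apply: runR.
Qed.

End WordActions.

Section ArtinWords.
Local Open Scope quotient_scope.
Local Open Scope group_scope.
Context (Gamma : artin_graph).
Notation G := (artin_group Gamma).
Implicit Types (X Y : {set Gamma}) (u v : word Gamma) (g h : G).

Definition ev u : G := \pi_(pres_group (@artin_rel Gamma)) u.

Lemma ev_cat u v : ev (u ++ v) = ev u * ev v.
Proof. by symmetry; apply: pres_mulE. Qed.

Lemma ev_inv u : ev (word_inv u) = (ev u)^-1.
Proof. by symmetry; apply: pres_invE. Qed.

Lemma ev_nil : ev [::] = 1. Proof. by []. Qed.

Lemma ev_repr g : ev (repr g) = g. Proof. exact: reprK. Qed.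

Lemma ev_eqP u v : ev u = ev v <-> pres_eq (@artin_rel Gamma) u v.
Proof. exact: pres_group_eqP. Qed.

Lemma repr_ev u : pres_eq (@artin_rel Gamma) (repr (ev u)) u.
Proof. exact: pres_repr. Qed.

Definition letters_in X u := all (fun a => a.1 \in X) u.

Lemma letters_inV X u : letters_in X (word_inv u) = letters_in X u.
Proof. by rewrite /letters_in /word_inv all_rev all_map; apply: eq_all. Qed.

Lemma std_parabolicP X g :
  std_parabolic X g <-> exists2 u, letters_in X u & ev u = g.
Proof.
split=> [|[u uX <-]].
  pose H := [set g : G | exists2 u, letters_in X u & ev u = g].
  apply: (@generated_min _ _ H); last first.
    move=> _ [x xX <-]; exists [:: (x, false)] => //=.
    by rewrite andbT; exact: xX.
  split.
  - by exists [::].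
  - move=> _ _ [u uX <-] [v vX <-]; exists (u ++ v); last exact: ev_cat.
    by rewrite /letters_in all_cat; apply/andP.
  - by move=> _ [u uX <-]; exists (word_inv u); rewrite ?letters_inV// ev_inv.
have [P1 PM PV] := generated_subgroup (@artin_gen Gamma @` [set` X]).
elim: u uX => [|[x b] u IHu] /=; first by rewrite ev_nil.
move=> /andP[xX uX]; rewrite -cat1s ev_cat; apply: (PM); last exact: IHu.
have Px : std_parabolic X (artin_gen x).
  by apply: sub_generated; exists x.
by case: b; [rewrite -[[:: _]]/(word_inv [:: (x, false)]) ev_inv; apply: PV|].
Qed.

Lemma std_subgroup X : subgroup (@std_parabolic Gamma X).
Proof. exact: generated_subgroup. Qed.

Lemma std_sub X Y : X \subset Y -> @std_parabolic Gamma X `<=` std_parabolic Y.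
Proof.
move=> /fintype.subsetP XY g /std_parabolicP [u uX <-]; apply/std_parabolicP.
by exists u => //; apply: sub_all uX => a; apply: XY.
Qed.

Lemma std_setT g : std_parabolic [set: Gamma]%SET g.
Proof.
by apply/std_parabolicP; exists (repr g); rewrite ?ev_repr//; apply/allP => a; rewrite !inE.
Qed.

Lemma std_gen X x : x \in X -> std_parabolic X (artin_gen x).
Proof. by move=> xX; apply: sub_generated; exists x. Qed.

Definition code g : nat := pickle (repr g : seq (Gamma * bool)).

(** The codes witness that an Artin group is countable, which is all that
    Baire's theorem and Cantor's argument need. *)
Lemma code_inj : injective code.
Proof. by move=> g h /(pcan_inj pickleK) e; rewrite -(ev_repr g) e ev_repr. Qed.

End ArtinWords.

(** * Chebyshev values at 2 cos(pi/m) *)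

Section Chebyshev.
Import Order.TTheory GRing.Theory Num.Theory.
Local Open Scope ring_scope.
Notation R := Rdefinitions.R.
Implicit Types (c x : R) (k m : nat).

Fixpoint cheb2 c k : R * R :=
  if k is k'.+1 then let: (a, b) := cheb2 c k' in (b, c * b - a) else (0, 1).

(** With c = 2 cos x this is sin (k x) / sin x: the coordinates of the roots of a
    dihedral group, and the reason why they change sign only after m steps. *)
Definition cheb c k : R := (cheb2 c k).1.

Lemma cheb0 c : cheb c 0 = 0. Proof. by []. Qed.
Lemma cheb1 c : cheb c 1 = 1. Proof. by []. Qed.

Lemma chebSS c k : cheb c k.+2 = c * cheb c k.+1 - cheb c k.
Proof. by rewrite /cheb /=; case: (cheb2 c k). Qed.

Lemma cheb_sin x k : cheb (2 * cos x) k * sin x = sin (k%:R * x).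
Proof.
suff: cheb (2 * cos x) k * sin x = sin (k%:R * x) /\
      cheb (2 * cos x) k.+1 * sin x = sin (k.+1%:R * x) by case.
elim: k => [|k [IH1 IH2]]; first by rewrite cheb0 cheb1 !mul0r sin0 mul1r mul1r.
split=> //; rewrite chebSS mulrBl -mulrA IH2 IH1.
have -> : k.+2%:R * x = k.+1%:R * x + x by rewrite -[k.+2]addn1 natrD mulrDl mul1r.
have -> : k%:R * x = k.+1%:R * x - x by rewrite -[k.+1]addn1 natrD mulrDl mul1r addrK.
by rewrite !sinD sinN cosN; ring.
Qed.

(** The degenerate value c = 2 is the case of an infinite dihedral group, which
    is how pairs of non-adjacent vertices enter the linear representation. *)
Lemma cheb2_id k : cheb 2 k = k%:R.
Proof.
suff: cheb 2 k = k%:R /\ cheb 2 k.+1 = k.+1%:R by case.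
elim: k => [|k [IH1 IH2]]; first by rewrite cheb0 cheb1.
by split=> //; rewrite chebSS IH2 IH1 -[k.+2]addn1 -[k.+1]addn1 !natrD; ring.
Qed.

Definition ccos m : R := 2 * cos (pi / m%:R).

Lemma pi_div_itv m : (2 <= m)%N -> 0 < (pi : R) / m%:R < pi.
Proof.
move=> m2; have m0 : 0 < m%:R :> R by rewrite ltr0n; lia.
rewrite divr_gt0 ?pi_gt0//= ltr_pdivrMr// -[ltLHS]mulr1 ltr_pM2l ?pi_gt0//.
by rewrite ltr1n.
Qed.

Lemma cheb_ccos_gt0 m k : (0 < k < m)%N -> 0 < cheb (ccos m) k.
Proof.
move=> /andP[k0 km]; have m2 : (2 <= m)%N by lia.
have /andP[x0 xpi] := pi_div_itv m2.
have s0 : 0 < sin (pi / m%:R) :> R by apply: sin_gt0_pi; rewrite x0 xpi.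
rewrite -(pmulr_lgt0 _ s0) cheb_sin; apply: sin_gt0_pi.
have m0 : 0 < m%:R :> R by rewrite ltr0n; lia.
rewrite mulr_gt0 ?ltr0n//= mulrCA -[ltRHS]mulr1 ltr_pM2l ?pi_gt0//.
by rewrite ltr_pdivrMr// mul1r ltr_nat.
Qed.

Lemma cheb_ccos_m m : (2 <= m)%N -> cheb (ccos m) m = 0.
Proof.
move=> m2; have /andP[x0 xpi] := pi_div_itv m2.
have s0 : 0 < sin (pi / m%:R) :> R by apply: sin_gt0_pi; rewrite x0 xpi.
apply: (mulIf (lt0r_neq0 s0)); rewrite cheb_sin mul0r mulrC mulfVK ?sinpi//.
by rewrite pnatr_eq0; lia.
Qed.

Lemma ccos_inj m m' : (2 <= m)%N -> (2 <= m')%N -> ccos m = ccos m' -> m = m'.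
Proof.
wlog mm' : m m' / (m <= m')%N.
  by move=> H m2 m2' e; have [/H|/ltnW/H] := leqP m m'; [apply|move/(_ m2' m2 (esym e))->].
move=> m2 m2' e; apply/eqP; rewrite eqn_leq mm' leqNgt; apply/negP => lt.
have : 0 < cheb (ccos m') m by apply: cheb_ccos_gt0; lia.
by rewrite -e cheb_ccos_m// ltxx.
Qed.

Lemma ccos_neq2 m : (2 <= m)%N -> ccos m <> 2.
Proof.
move=> m2 e; have := cheb_ccos_m m2; rewrite e cheb2_id => /eqP.
by rewrite pnatr_eq0; lia.
Qed.

End Chebyshev.

(** * The canonical linear representation *)

Section Reflections.
Import Order.TTheory GRing.Theory Num.Theory.
Local Open Scope ring_scope.
Notation R := Rdefinitions.R.
Context (Gamma : artin_graph).
Notation V := (vertex Gamma).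
Implicit Types (s t x y : V) (u w : seq V).

Definition vec := {ffun V -> R^o}.
HB.instance Definition _ := GRing.Lmodule.on vec.
Implicit Types (v z : vec).

Definition joined s t := [set s; t]%SET \in edges Gamma.
Definition lab s t := label [set s; t]%SET.

Lemma joinedC s t : joined s t = joined t s.
Proof. by rewrite /joined finset.setUC. Qed.

Lemma labC s t : lab s t = lab t s.
Proof. by rewrite /lab finset.setUC. Qed.

Lemma joined_neq s t : joined s t -> s != t.
Proof.
by move=> /edges_card2 e; apply: contra_eq_neq e => ->; rewrite finset.setUid cards1.
Qed.

Lemma lab_ge2 s t : joined s t -> (2 <= lab s t)%N.
Proof. exact: label_ge2. Qed.

Definition cosine s t : R := if joined s t then ccos (lab s t) else 2.
Definition gram s t : R := if s == t then 2 else - cosine s t.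

Lemma cosineC s t : cosine s t = cosine t s.
Proof. by rewrite /cosine joinedC labC. Qed.

Lemma gramC s t : gram s t = gram t s.
Proof. by rewrite /gram eq_sym cosineC. Qed.

Lemma gramxx s : gram s s = 2. Proof. by rewrite /gram eqxx. Qed.

Lemma gramE s t : s != t -> gram s t = - cosine s t.
Proof. by rewrite /gram => /negbTE ->. Qed.

Definition sroot s : vec := [ffun x => (x == s)%:R].
(** The linear form paired with the simple root at s, so that [refl] is the
    reflection fixing its kernel and negating the root. *)
Definition form s v : R := \sum_t gram s t * v t.
Definition refl s v : vec := v - form s v *: sroot s.

Lemma sroot_neq0 s : sroot s != 0.
Proof. by apply/eqP => /ffunP/(_ s); rewrite !ffunE eqxx => /eqP; rewrite oner_eq0. Qed.

Lemma form_linear s k v z : form s (k *: v + z) = k * form s v + form s z.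
Proof.
rewrite /form mulr_sumr -big_split /=; apply: eq_bigr => t _.
by rewrite !ffunE /GRing.scale /=; ring.
Qed.
HB.instance Definition _ s := GRing.isLinear.Build R vec R^o *:%R (form s)
  (fun k v z => form_linear s k v z).

Lemma form_sroot s t : form s (sroot t) = gram s t.
Proof.
rewrite /form (bigD1 t)//= ffunE eqxx mulr1 big1 ?addr0// => x xt.
by rewrite ffunE (negbTE xt) mulr0.
Qed.

Lemma refl_linear s k v z : refl s (k *: v + z) = k *: refl s v + refl s z.
Proof.
rewrite /refl form_linear; apply/ffunP => x; rewrite !ffunE /GRing.scale /=; ring.
Qed.
HB.instance Definition _ s := GRing.isLinear.Build R vec vec *:%R (refl s)
  (fun k v z => refl_linear s k v z).

Lemma refl_sroot s t : refl s (sroot t) = sroot t - gram s t *: sroot s.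
Proof. by rewrite /refl form_sroot. Qed.

Lemma refl_self s : refl s (sroot s) = - sroot s.
Proof. by rewrite refl_sroot gramxx scaler_nat mulr2n opprD addrA subrr add0r. Qed.

Lemma form_refl s v : form s (refl s v) = - form s v.
Proof. by rewrite /refl linearB linearZ /= form_sroot gramxx /GRing.scale /=; ring. Qed.

Lemma reflK s : involutive (refl s).
Proof.
move=> v; rewrite {1}/refl form_refl /refl.
by rewrite scaleNr opprK subrK.
Qed.

(** Reading letters from the left makes this a right action; states of the
    retraction are processed in the same order. *)
Definition run u v : vec := foldl (fun v s => refl s v) v u.

Lemma run_cons s u v : run (s :: u) v = run u (refl s v). Proof. by []. Qed.
Lemma run_cat u w v : run (u ++ w) v = run w (run u v). Proof. exact: foldl_cat. Qed.
Lemma run_rcons u s v : run (rcons u s) v = refl s (run u v).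
Proof. by rewrite -cats1 run_cat. Qed.

Lemma run_linear u k v z : run u (k *: v + z) = k *: run u v + run u z.
Proof. by elim: u v z => //= s u IHu v z; rewrite linearP IHu. Qed.
HB.instance Definition _ u := GRing.isLinear.Build R vec vec *:%R (run u)
  (fun k v z => run_linear u k v z).

Lemma runK u v : run (rev u) (run u v) = v.
Proof. by elim: u v => //= s u IHu v; rewrite rev_cons run_rcons IHu reflK. Qed.

Lemma runVK u v : run u (run (rev u) v) = v.
Proof. by rewrite -{1}[u]revK runK. Qed.

Lemma run_inj u : injective (run u).
Proof. exact: can_inj (runK u). Qed.

Definition nonneg v := [forall x, 0 <= v x].
Lemma nonnegP v : reflect (forall x, 0 <= v x) (nonneg v).
Proof. exact: forallP. Qed.

Lemma nonneg_sroot s : nonneg (sroot s).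
Proof. by apply/nonnegP => x; rewrite ffunE ler0n. Qed.

Lemma nonneg_comb (p q : R) v z : 0 <= p -> 0 <= q -> nonneg v -> nonneg z ->
  nonneg (p *: v + q *: z).
Proof.
move=> p0 q0 /nonnegP v0 /nonnegP z0; apply/nonnegP => x.
by rewrite !ffunE addr_ge0// mulr_ge0.
Qed.

Lemma nonneg_anti v : nonneg v -> nonneg (- v) -> v = 0.
Proof.
move=> /nonnegP v0 /nonnegP nv0; apply/ffunP => x; rewrite ffunE.
by have := v0 x; have := nv0 x; rewrite !ffunE; lra.
Qed.

Definition bil v z : R := \sum_s v s * form s z.

Lemma bilC v z : bil v z = bil z v.
Proof.
rewrite /bil /form; under eq_bigr do rewrite mulr_sumr.
rewrite exchange_big /=; apply: eq_bigr => t _; rewrite mulr_sumr.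
by apply: eq_bigr => s _; rewrite gramC; ring.
Qed.

Lemma bil_linear v k z z' : bil v (k *: z + z') = k * bil v z + bil v z'.
Proof.
rewrite /bil mulr_sumr -big_split /=; apply: eq_bigr => s _.
by rewrite form_linear; ring.
Qed.
HB.instance Definition _ v := GRing.isLinear.Build R vec R^o *:%R (bil v)
  (fun k z z' => bil_linear v k z z').

Lemma bil_sroot s v : bil (sroot s) v = form s v.
Proof.
rewrite /bil (bigD1 s)//= ffunE eqxx mul1r big1 ?addr0// => x xs.
by rewrite ffunE (negbTE xs) mul0r.
Qed.

Lemma bil_refl s v z : bil (refl s v) (refl s z) = bil v z.
Proof.
rewrite {2}/refl linearB linearZ /= [bil _ z]bilC [bil _ (sroot s)]bilC bil_sroot form_refl.
rewrite /refl linearB linearZ /= [bil z v]bilC [bil z _]bilC bil_sroot.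
by rewrite /GRing.scale /=; ring.
Qed.

Lemma bil_run u v z : bil (run u v) (run u z) = bil v z.
Proof. by elim: u v z => //= s u IHu v z; rewrite IHu bil_refl. Qed.

Fixpoint alt s t k : seq V := if k is k'.+1 then s :: alt t s k' else [::].

Lemma size_alt s t k : size (alt s t k) = k.
Proof. by elim: k s t => //= k IHk s t; rewrite IHk. Qed.

Lemma altSr s t k : alt s t k.+1 = rcons (alt s t k) (if odd k then t else s).
Proof.
elim: k s t => // k IHk s t; rewrite -[alt s t k.+2]/(s :: alt t s k.+1) IHk /=.
by case: (odd k).
Qed.

Lemma alt_mem s t k : all (mem [:: s; t]) (alt s t k).
Proof.
elim: k s t => //= k IHk s t; rewrite !inE eqxx /=.
by apply: sub_all (IHk t s) => x; rewrite !inE orbC.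
Qed.

Lemma alternatingE s t k : map fst (alternating s t k) = alt s t k.
Proof.
rewrite /alternating; elim: k s t => //= k IHk s t; rewrite /mkseq /=; congr cons.
rewrite -(IHk t s) -[1%N]/(1 + 0)%N iotaDl -!map_comp; apply: eq_map => i /=.
by case: (odd i).
Qed.

Lemma altD s t i j : alt s t (i + j) =
  alt s t i ++ (if odd i then alt t s j else alt s t j).
Proof.
elim: i s t => //= i IHi s t; rewrite IHi; congr (_ :: (_ ++ _)).
by case: (odd i).
Qed.

(** Together with [osumS], the coefficients with which an alternating product
    of two reflections displaces a vector along the two roots. *)
Definition osum (c : R) b k : R := \sum_(i < k | odd i == b) cheb c i.
Definition osumS (c : R) b k : R := \sum_(i < k | odd i == b) cheb c i.+1.

Lemma osum_shift c b k : osum c b k.+1 = osumS c (~~ b) k.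
Proof.
rewrite /osum /osumS big_mkcond big_ord_recl /= cheb0 if_same add0r [RHS]big_mkcond /=.
by apply: eq_bigr => i _; rewrite /bump /= add1n /=; case: (odd i); case: b.
Qed.

Lemma osumS_shift c b k :
  osumS c b k.+1 = (~~ b)%:R + c * osumS c (~~ b) k - osum c (~~ b) k.
Proof.
rewrite /osum /osumS [LHS]big_mkcond big_ord_recl /= cheb1 mulr_sumr -addrA.
congr (_ + _); first by case: b.
rewrite -sumrB [RHS]big_mkcond /=; apply: eq_bigr => i _.
by rewrite /bump /= add1n /= chebSS; case: (odd i); case: b.
Qed.

(** Since all displacements stay in the plane of the two roots, alternating
    products obey the recursion of [cheb] whatever the rest of the form is. *)
Lemma run_alt s t k v : s != t ->
  run (alt s t k) v = v
   - (osumS (cosine s t) false k * form s v + osum (cosine s t) false k * form t v) *: sroot s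
   - (osumS (cosine s t) true k * form s v + osum (cosine s t) true k * form t v) *: sroot t.
Proof.
elim: k s t v => [|k IHk] s t v st.
  by rewrite /osum /osumS !big_ord0 !mul0r addr0 !scale0r !subr0.
rewrite /= IHk 1?eq_sym// (cosineC t s) {1 2}/refl form_refl.
have -> : form t (refl s v) = form t v + cosine s t * form s v.
  rewrite /refl linearB linearZ /= form_sroot gramE 1?eq_sym// (cosineC t s).
  by rewrite /GRing.scale /=; ring.
rewrite !osumS_shift !osum_shift /=.
apply/ffunP => x; rewrite !ffunE /GRing.scale /=; ring.
Qed.

(** The coefficients in [run_alt] become symmetric in s and t exactly when
    [cheb] vanishes at the length of the words. *)
Lemma run_braid s t v : joined s t ->
  run (alt s t (lab s t)) v = run (alt t s (lab s t)) v.
Proof.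
move=> stE; have st := joined_neq stE; have m2 := lab_ge2 stE.
have ts : t != s by rewrite eq_sym.
rewrite !run_alt// (cosineC t s) /cosine stE.
move: (lab s t) m2 => m m2; have pm := cheb_ccos_m m2.
have E b : osumS (ccos m) b m = osum (ccos m) (~~ b) m.
  rewrite -[in RHS](prednK (ltnW m2)) osum_shift negbK -(prednK (ltnW m2)).
  rewrite /osumS big_mkcond big_ord_recr /= (prednK (ltnW m2)) pm if_same addr0.
  by rewrite -big_mkcond.
by rewrite !E /=; apply/ffunP => x; rewrite !ffunE /GRing.scale /=; ring.
Qed.

Lemma run_alt_sroot s t k : s != t ->
  run (alt t s k) (sroot s) = if odd k
    then cheb (cosine s t) k *: sroot s + cheb (cosine s t) k.+1 *: sroot t
    else cheb (cosine s t) k.+1 *: sroot s + cheb (cosine s t) k *: sroot t.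
Proof.
move=> st; elim: k => [|k IHk]; first by rewrite /= cheb0 cheb1 scale1r scale0r addr0.
rewrite altSr run_rcons IHk /=; case: (odd k) => /=.
  rewrite linearD !linearZ /= refl_self refl_sroot gramE// chebSS.
  by apply/ffunP => x; rewrite !ffunE /GRing.scale /=; ring.
rewrite linearD !linearZ /= refl_self refl_sroot gramE 1?eq_sym// chebSS (cosineC t s).
by apply/ffunP => x; rewrite !ffunE /GRing.scale /=; ring.
Qed.

End Reflections.

(** * Positive roots *)

Section Positivity.
Import Order.TTheory GRing.Theory Num.Theory.
Local Open Scope ring_scope.
Notation R := Rdefinitions.R.
Context (Gamma : artin_graph).
Notation V := (vertex Gamma).
Notation sroot := (@sroot Gamma).
Implicit Types (s t x y : V) (u w : seq V) (v z : vec Gamma) (Y : {set V}).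

Definition sameact u w := forall v : vec Gamma, run u v = run w v.

Lemma sameact_sym u w : sameact u w -> sameact w u.
Proof. by move=> uw v; rewrite uw. Qed.
Lemma sameact_trans u w w1 : sameact u w -> sameact w w1 -> sameact u w1.
Proof. by move=> uw wx v; rewrite uw. Qed.
Lemma sameact_cat u u' w w' : sameact u u' -> sameact w w' -> sameact (u ++ w) (u' ++ w').
Proof. by move=> e e' v; rewrite !run_cat e e'. Qed.
Lemma sameact_cancel s u : sameact [:: s, s & u] u.
Proof. by move=> v; rewrite /= reflK. Qed.

Definition letters Y u := all (mem Y) u.

Lemma letters_cat Y u w : letters Y (u ++ w) = letters Y u && letters Y w.
Proof. exact: all_cat. Qed.
Lemma letters_rcons Y u s : letters Y (rcons u s) = (s \in Y) && letters Y u.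
Proof. exact: all_rcons. Qed.

(** Lengths are measured with respect to the letters of Y only, so that the sign
    theorem below applies to A_Y without comparing lengths in different groups. *)
Definition reduced Y u :=
  letters Y u /\ forall w, letters Y w -> sameact u w -> (size u <= size w)%N.

Lemma reduceP Y u : letters Y u -> exists2 w, reduced Y w & sameact u w.
Proof.
have [n] := ubnP (size u); elim: n u => // n IHn u un uY.
have [red|/existsNP [w /not_implyP [wY /not_implyP [uw /negP]]]] :=
    pselect (forall w, letters Y w -> sameact u w -> (size u <= size w)%N).
  by exists u.
rewrite -ltnNge => wu; have [||w' w'r ww'] := IHn w => //; first by lia.
by exists w' => //; apply: sameact_trans ww'.
Qed.

Lemma not_path_cancel s (x : seq V) : ~~ path (fun a b => a != b) s x ->
  exists x' : seq V, [/\ {subset x' <= s :: x}, (size x' < size x)%N & sameact (s :: x) x'].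
Proof.
elim: x s => [//|a x IHx] s /=; rewrite negb_and negbK => /orP[/eqP <-|].
  exists x; split=> //; last exact: sameact_cancel.
  by move=> b bx; rewrite !inE bx !orbT.
move=> /IHx [x' [sub lt same]]; exists (s :: x'); split=> //.
  move=> b; rewrite inE => /predU1P[->|/sub]; first by rewrite mem_head.
  by rewrite !inE => /orP[->|->]; rewrite !orbT.
by move=> v; rewrite run_cons same.
Qed.

Lemma path_alt s t (x : seq V) : all (mem [:: s; t]) x -> s != t ->
  path (fun a b => a != b) s x -> x = alt t s (size x).
Proof.
elim: x s t => [//|a x IHx] s t /= /andP[ast xst] st /andP[sa pax].
move: ast; rewrite !inE eq_sym (negbTE sa) => /eqP at_; subst a; congr cons.
by apply: IHx => //; rewrite 1?eq_sym//; apply: sub_all xst => b; rewrite !inE orbC.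
Qed.

(** The classical induction on length: split u as a word x in s and t followed by
    a word v that is shortest possible.  Then v does not shorten s or t, so by
    induction it sends their roots to nonnegative vectors, while x is an
    alternating word of length less than m and keeps the coordinates of the
    root of s in the dihedral plane nonnegative. *)
Lemma ascent_nonneg Y u s : reduced Y u -> s \in Y ->
  (forall w, letters Y w -> sameact (s :: u) w -> (size u <= size w)%N) ->
  nonneg (run u (sroot s)).
Proof.
have [n] := ubnP (size u); elim: n u s => // n IHn [|t u'] s un ured sY asc.
  exact: nonneg_sroot.
set u := t :: u' in un ured asc *.
have tY : t \in Y by case: ured => /= /andP[].
have st : s != t.
  apply/eqP => e; have /asc : sameact (s :: u) u' by rewrite e; apply: sameact_cancel.
  case: ured => /= /andP[_ uY] _ /(_ uY); rewrite /u /=; lia.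
(* Decompositions u = x v with x in the dihedral group of s and t, indexed by the length of v. *)
pose Q m := exists (x : seq V) (v : seq V), [/\ all (mem [:: s; t]) x, letters Y v, sameact u (x ++ v),
                            (size x + size v)%N = size u & size v = m].
have exQ : exists m, `[< Q m >].
  exists (size u'); apply/asboolP; exists [:: t], u'; split=> //.
  - by rewrite /= !inE eqxx orbT.
  - by case: ured => /= /andP[].
case: (@ex_minnP (fun m => `[< Q m >]) exQ) => m /asboolP [x [v [xst vY uxv sz vm]]] minm.
have {minm}minm m' : (m' < m)%N -> ~ Q m'.
  by move=> mm' /asboolP /minm; rewrite leqNgt mm'.
have stY b : b \in [:: s; t] -> b \in Y by rewrite !inE => /orP[] /eqP ->.
have xY : letters Y x by apply: sub_all xst.
have vlt : (size v < size u)%N.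
  rewrite ltnNge; apply/negP => le.
  apply: (minm (size u')); first by rewrite -vm; move: le; rewrite /u /=; lia.
  exists [:: t], u'; split=> //; first by rewrite /= !inE eqxx orbT.
  by case: ured => /= /andP[].
have vred : reduced Y v.
  split=> // w wY vw; rewrite -(leq_add2l (size x)) sz -size_cat.
  apply: ured.2; first by rewrite letters_cat xY.
  by apply: sameact_trans uxv _; apply: sameact_cat vw.
have vasc r : r \in [:: s; t] -> nonneg (run v (sroot r)).
  move=> rst; apply: IHn => //; first by lia.
    exact: stY.
  move=> w wY vw; rewrite leqNgt; apply/negP => wv.
  have urw : sameact u (rcons x r ++ w).
    apply: sameact_trans uxv _; rewrite -cats1 -catA; apply: sameact_cat => // z.
    by rewrite run_cat -vw run_cons /= reflK.
  have rxY : letters Y (rcons x r ++ w).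
    by rewrite letters_cat letters_rcons stY//= xY.
  have := ured.2 _ rxY urw; rewrite size_cat size_rcons => le.
  apply: (minm (size w)); first by lia.
  exists (rcons x r), w; split=> //; last by rewrite size_rcons; lia.
  by rewrite all_rcons xst andbT.
have short (x' : seq V) : all (mem Y) x' -> (size x' < size x)%N -> ~ sameact (s :: x) x'.
  move=> x'Y lt same; have /asc : sameact (s :: u) (x' ++ v).
    move=> z; rewrite run_cons uxv -run_cons -cat_cons.
    by apply: sameact_cat.
  by rewrite letters_cat /letters x'Y => /(_ vY); rewrite size_cat; lia.
have px : path (fun a b => a != b) s x.
  apply/negP => /negP /not_path_cancel [x' [sub lt same]].
  apply: (short x') => //; apply/allP => b /sub; rewrite inE => /predU1P[->//|bx].
  by move/allP: xY; apply.
have xalt := path_alt xst st px.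
have kle : joined s t -> (size x < lab s t)%N.
  move=> stE; rewrite ltnNge; apply/negP => le.
  have m2 := lab_ge2 stE.
  have [k sk] : exists k, size x = (lab s t + k)%N by exists (size x - lab s t)%N; lia.
  have [rest [rst szr e]] : exists rest : seq V, [/\ letters Y rest, size rest = k &
      x = alt t s (lab s t) ++ rest].
    exists (if odd (lab s t) then alt s t k else alt t s k); split.
    - by have := xY; rewrite xalt sk altD letters_cat => /andP[].
    - by case: ifP => _; rewrite size_alt.
    - by rewrite -altD -sk.
  apply: (short (alt t s (lab s t).-1 ++ rest)).
  - rewrite all_cat; apply/andP; split=> //.
    by apply: sub_all (alt_mem _ _ _) => b /=; rewrite inE orbC => b'; apply: stY; rewrite !inE in b' *.
  - by rewrite size_cat size_alt szr; lia.
  - move=> z; rewrite e -cat_cons !run_cat; congr (run rest _).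
    rewrite run_cons -(run_braid _ stE).
    by rewrite -{1}(prednK (ltnW m2)) /= reflK.
rewrite uxv run_cat xalt run_alt_sroot//.
have pge k : (k <= (size x).+1)%N -> 0 <= cheb (cosine s t) k.
  rewrite /cosine; case: ifP => [stE|_ _]; last by rewrite cheb2_id.
  move: (kle stE) => lt le; have [->|k0] := posnP k; first by rewrite cheb0.
  have [->|km] := eqVneq k (lab s t); first by rewrite cheb_ccos_m// lab_ge2.
  by apply/ltW/cheb_ccos_gt0; lia.
by case: ifP => _; rewrite linearD !linearZ /=; apply: nonneg_comb;
  rewrite ?pge ?vasc ?inE ?eqxx ?orbT.
Qed.

Lemma root_sign Y u s : letters Y u -> s \in Y ->
  nonneg (run u (sroot s)) \/ nonneg (- run u (sroot s)).
Proof.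
move=> uY sY; have [w wred uw] := reduceP uY; rewrite uw.
have [asc|/existsNP [w' /not_implyP [w'Y /not_implyP [sw /negP]]]] :=
    pselect (forall w', letters Y w' -> sameact (s :: w) w' -> (size w <= size w')%N).
  by left; apply: ascent_nonneg asc.
rewrite -ltnNge => lt; right.
have swY : letters Y (s :: w) by rewrite /letters /= sY; case: wred.
have [w2 w2red sw2] := reduceP swY.
have ww2 : sameact w (s :: w2) by move=> v; rewrite run_cons -sw2 run_cons reflK.
have le2 : (size w2 <= size w')%N.
  by apply: w2red.2 => //; apply: sameact_trans (sameact_sym sw2) sw.
have -> : - run w (sroot s) = run (s :: w) (sroot s) by rewrite run_cons refl_self linearN.
rewrite sw2; apply: (ascent_nonneg w2red sY) => w3 w3Y e.
have := wred.2 _ w3Y (sameact_trans ww2 e); lia.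
Qed.

Lemma run_eq0 u v : run u v = 0 -> v = 0.
Proof. by move=> e; apply: (@run_inj _ u); rewrite e linear0. Qed.

(** A nontrivial reduced word sends the root of its first letter to a negative
    vector, so only the trivial element keeps all simple roots of Y positive. *)
Lemma dominant_trivial Y u : letters Y u ->
  {in Y, forall y, nonneg (run u (sroot y))} -> sameact u [::].
Proof.
move=> uY pos; have [[|t w] wred uw] := reduceP uY; first exact: uw.
have [twY min] := wred; have /andP[tY wY] := twY.
have w'red : reduced Y w.
  split=> // w' w'Y ww'; rewrite -ltnS -[(size w).+1]/(size (t :: w)).
  rewrite -[(size w').+1]/(size (t :: w')) ; apply: min; first exact/andP.
  by move=> v; rewrite !run_cons ww'.
have p1 : nonneg (run w (sroot t)).
  apply: (ascent_nonneg w'red tY) => w' w'Y e; have := min _ w'Y e; rewrite /=; lia.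
have := pos _ tY; rewrite uw run_cons refl_self linearN => p2.
by have /run_eq0 /eqP := nonneg_anti p1 p2; rewrite (negbTE (sroot_neq0 t)).
Qed.

End Positivity.

(** * Retraction onto a standard parabolic subgroup *)

Section Retraction.
Import Order.TTheory GRing.Theory Num.Theory.
Local Open Scope ring_scope.
Notation R := Rdefinitions.R.
Context (Gamma : artin_graph) (Y : {set Gamma}).
Notation V := (vertex Gamma).
Notation G := (artin_group Gamma).
Notation sroot := (@sroot Gamma).
Notation vec := (vec Gamma).
Notation cfg := (G * (vec -> vec))%type.
Implicit Types (s t x y : V) (u w : seq V) (v z : vec) (a g : G) (f : vec -> vec).

Lemma sroot_inj : injective sroot.
Proof.
move=> s t /ffunP/(_ s); rewrite !ffunE eqxx; case: eqVneq => // _ /eqP.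
by rewrite (oner_eq0 R).
Qed.

Lemma letters_setT u : letters [set: V]%SET u.
Proof. by apply/allP => x _; rewrite /= inE. Qed.

(** A reflection in s makes negative only one positive root, the simple root of s. *)
Lemma nonneg_refl u y s : let v := run u (sroot y) in
  nonneg v -> v != sroot s -> nonneg (refl s v).
Proof.
move=> v v0 vs; have := root_sign (letters_setT (rcons u s)) (finset.in_setT y).
rewrite run_rcons -/v => -[//|neg].
have off x : x != s -> v x = 0.
  move=> xs; have /nonnegP/(_ x) := neg; have /nonnegP/(_ x) := v0.
  rewrite /refl !ffunE (negbTE xs) /GRing.scale /= mulr0; lra.
have ve : v = v s *: sroot s.
  apply/ffunP => x; rewrite !ffunE /GRing.scale /=.
  by have [->|/off->] := eqVneq x s; rewrite ?mulr1 ?mulr0.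
have : bil v v = 2 by rewrite bil_run bil_sroot form_sroot gramxx.
rewrite {2}ve linearZ /= bilC bil_sroot {2}ve linearZ /= form_sroot gramxx.
rewrite /GRing.scale /= => e.
have s0 : 0 <= v s by move/nonnegP: v0.
have v1 : v s = 1 by nra.
by case/eqP: vs; rewrite ve v1 scale1r.
Qed.

(** A letter s is blocked in the state f by y when f sends the root of y to the
    root of s: it then contributes the letter y to the retraction and leaves the
    state unchanged. *)
Definition block f s : option V := [pick y in Y | f (sroot y) == sroot s].

(** The first component accumulates the value of the retraction; the second
    describes the position of Y, namely the minimal representative of the
    current coset of the Coxeter group of Y, acting on vectors. *)
Definition rstep (l : V * bool) (c : cfg) : cfg :=
  if block c.2 l.1 is Some y
  then ((if l.2 then c.1 * (artin_gen y)^-1 else c.1 * artin_gen y)%g, c.2)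
  else (c.1, refl l.1 \o c.2).

Lemma rstepE l c : rstep l c = if block c.2 l.1 is Some y
  then ((if l.2 then c.1 * (artin_gen y)^-1 else c.1 * artin_gen y)%g, c.2)
  else (c.1, refl l.1 \o c.2).
Proof. by []. Qed.

(** The states that occur: f comes from the Coxeter group and keeps the simple
    roots of Y positive, that is, it is minimal in its coset. *)
Definition dominant (c : cfg) :=
  (exists u, c.2 = run u) /\ {in Y, forall y, nonneg (c.2 (sroot y))}.

Lemma blockP f s : (forall y, y \in Y -> f (sroot y) != sroot s) ->
  block f s = None.
Proof. by rewrite /block => h; case: pickP => // y /andP[/h/negbTE->]. Qed.

Lemma block_run u s y : y \in Y -> run u (sroot y) = sroot s ->
  block (run u) s = Some y.
Proof.
move=> yY e; rewrite /block; case: pickP => [x /andP[xY /eqP]|/(_ y)].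
  by rewrite -e => /run_inj/sroot_inj->.
by rewrite yY e eqxx.
Qed.

Lemma rstepI l c : dominant c -> dominant (rstep l c).
Proof.
case: c => a f [[u fu] pos]; rewrite /rstep /=; rewrite /= in fu pos.
rewrite /block; case: pickP => [y _|nb]; split=> //=; first by exists u.
  by exists (rcons u l.1); apply/funext => v; rewrite run_rcons -fu.
move=> y yY; have := pos _ yY; have := nb y; rewrite yY fu /= => ne p.
by apply: nonneg_refl => //; rewrite ne.
Qed.

Lemma rstepK s b c : dominant c -> rstep (s, ~~ b) (rstep (s, b) c) = c.
Proof.
case: c => a f [[u fu] pos]; rewrite /rstep /=; rewrite /= in fu pos.
case E: (block f s) => [y|] /=; rewrite ?E.
  by case: b => /=; rewrite ?mulgK ?mulgVK.
rewrite blockP; first by congr pair; apply/funext => v /=; rewrite reflK.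
move=> y yY /=; apply/eqP => e.
have e2 : f (sroot y) = - sroot s by rewrite -[LHS](@reflK _ s) e refl_self.
have := pos _ yY; rewrite e2 => p.
have := nonneg_anti (nonneg_sroot s) p => /eqP; by rewrite (negbTE (sroot_neq0 s)).
Qed.

Definition prun u (c : cfg) := foldl (fun c s => rstep (s, false) c) c u.

Lemma prun_cat u w c : prun (u ++ w) c = prun w (prun u c).
Proof. exact: foldl_cat. Qed.

Lemma prun_cons s u c : prun (s :: u) c = prun u (rstep (s, false) c).
Proof. by []. Qed.

Lemma rrun_alternating s t k c :
  rrun rstep (alternating s t k) c = prun (alt s t k) c.
Proof.
rewrite /prun -alternatingE /rrun /alternating /mkseq.
have : all (fun l : V * bool => l.2 == false) [seq (if odd i then t else s, false) | i <- iota 0 k].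
  by rewrite all_map; apply/allP.
by elim: (map _ _) c => [//|[x b] l IHl] c /= /andP[/eqP -> /IHl].
Qed.

Lemma prun_dominant u c : dominant c -> dominant (prun u c).
Proof. by elim: u c => //= s u IHu c /(rstepI (s, false)) /IHu. Qed.

Lemma rstep_free s a f : block f s = None -> rstep (s, false) (a, f) = (a, refl s \o f).
Proof. by rewrite /rstep /= => ->. Qed.

Lemma rstep_block s a f y : block f s = Some y ->
  rstep (s, false) (a, f) = ((a * artin_gen y)%g, f).
Proof. by rewrite /rstep /= => ->. Qed.

Section Braid.
Context (s t : V) (stE : joined s t).

Let st := joined_neq stE.
Let m := lab s t.
Let m2 := lab_ge2 stE.

(** The vectors in the plane of the roots of s and t, by their vanishing
    coordinates. *)
Definition inplane v := [forall x, (x != s) && (x != t) ==> (v x == 0)].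

Lemma inplaneE v : inplane v -> v = v s *: sroot s + v t *: sroot t.
Proof.
move=> /forallP h; apply/ffunP => x; rewrite !ffunE /GRing.scale /=.
have [->|xs] := eqVneq x s; first by rewrite (negbTE st) mulr0 addr0 mulr1.
have [->|xt] := eqVneq x t; first by rewrite mulr0 add0r mulr1.
by rewrite !mulr0 addr0; apply/eqP; have := h x; rewrite xs xt.
Qed.

Lemma inplane_refl r v : r \in [:: s; t] -> inplane (refl r v) = inplane v.
Proof.
move=> rst; suff h z : inplane z -> inplane (refl r z).
  by apply/idP/idP => /h //; rewrite reflK.
move=> /forallP zp; apply/forallP => x; apply/implyP => xst.
move: rst; rewrite /refl !ffunE /GRing.scale /= !inE => /orP[] /eqP ->;
  case/andP: (xst) => /negbTE xs /negbTE xt; rewrite ?xs ?xt mulr0 subr0;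
  exact: (implyP (zp x)).
Qed.

Lemma inplane_sroot r : r \in [:: s; t] -> inplane (sroot r).
Proof.
move=> rst; apply/forallP => x; apply/implyP => /andP[xs xt]; rewrite ffunE.
by move: rst; rewrite !inE => /orP[] /eqP ->; rewrite ?(negbTE xs) ?(negbTE xt).
Qed.

Lemma free_off_plane r a f : r \in [:: s; t] ->
  {in Y, forall y, ~~ inplane (f (sroot y)) \/ f (sroot y) != sroot r} ->
  rstep (r, false) (a, f) = (a, refl r \o f).
Proof.
move=> rst off; apply/rstep_free/blockP => y /off[|//]; apply: contra => /eqP ->.
exact: inplane_sroot.
Qed.

Lemma prun_off_plane u a f : all (mem [:: s; t]) u ->
  {in Y, forall y, ~~ inplane (f (sroot y))} -> prun u (a, f) = (a, run u \o f).
Proof.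
elim: u f => [//|r u IHu] f /= /andP[rst ust] off.
rewrite free_off_plane//; last by move=> y /off; left.
by rewrite IHu// => y /off /=; rewrite inplane_refl.
Qed.

Lemma cos_st : cosine s t = ccos m. Proof. by rewrite /cosine stE. Qed.

Lemma longest_neg r r' : [:: s; t] = [:: r; r'] \/ [:: s; t] = [:: r'; r] ->
  nonneg (- run (alt r r' m) (sroot r')).
Proof.
move=> e; have rr' : r' != r by case: e => -[<- <-] //; rewrite eq_sym.
have crr : cosine r' r = ccos m.
  by case: e => -[<- <-]; rewrite ?cos_st// cosineC cos_st.
rewrite run_alt_sroot// crr cheb_ccos_m// scale0r.
have -> : cheb (ccos m) m.+1 = - cheb (ccos m) m.-1.
  have e1 : m = m.-1.+1 by have := m2; rewrite -/m; lia.
  by rewrite {2}e1 chebSS -e1 cheb_ccos_m// mulr0 sub0r.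
have pm : 0 <= cheb (ccos m) m.-1 by apply/ltW/cheb_ccos_gt0; have := m2; rewrite -/m; lia.
case: ifP => _; rewrite ?scale0r ?add0r ?addr0 scaleNr opprK; apply/nonnegP => x;
  by rewrite !ffunE mulr_ge0// ler0n.
Qed.

Section OneRoot.
Context (y0 : V) (y0Y : y0 \in Y).

Definition only f := {in Y, forall y, y != y0 -> ~~ inplane (f (sroot y))}.

Lemma only_refl r f : r \in [:: s; t] -> only f -> only (refl r \o f).
Proof. by move=> rst h y yY ne /=; rewrite inplane_refl// h. Qed.

Lemma only_run u f : all (mem [:: s; t]) u -> only f -> only (run u \o f).
Proof.
elim: u f => //= r u IHu f /andP[rst ust] fo.
by have := IHu _ ust (only_refl rst fo).
Qed.

Lemma only_free r a f : r \in [:: s; t] -> only f -> f (sroot y0) != sroot r ->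
  rstep (r, false) (a, f) = (a, refl r \o f).
Proof.
move=> rst fo ne; apply: free_off_plane => // y yY.
by have [->|yy0] := eqVneq y y0; [right|left; apply: fo].
Qed.

Lemma after_block r r' q j a f : r \in [:: s; t] -> r' \in [:: s; t] -> r' != r ->
  only f -> f (sroot y0) = run (alt r r' q) (sroot r') -> (q + j < m)%N ->
  let w := if odd q then alt r' r j else alt r r' j in
  prun w (a, f) = (a, run w \o f).
Proof.
move=> rst r'st rr'.
have crr : cosine r' r = ccos m.
  rewrite -cos_st; move: rst r'st rr'; rewrite !inE => /orP[] /eqP -> /orP[] /eqP ->;
    by rewrite ?eqxx// cosineC.
elim: j q f => [|j IHj] q f fo fe qj; first by case: ifP.
pose x := if odd q then r' else r.
have xst : x \in [:: s; t] by rewrite /x; case: ifP.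
have qpos : 0 < cheb (ccos m) q.+1 by apply: cheb_ccos_gt0; lia.
have ne : f (sroot y0) != sroot x.
  rewrite fe run_alt_sroot// crr; apply/eqP.
  rewrite /x; case: (odd q) => /ffunP.
    move/(_ r); rewrite !ffunE /GRing.scale /= eqxx [r == r']eq_sym (negbTE rr') /=; lra.
  by move/(_ r'); rewrite !ffunE /GRing.scale /= eqxx (negbTE rr') /=; lra.
have fe' : (refl x \o f) (sroot y0) = run (alt r r' q.+1) (sroot r').
  by rewrite altSr run_rcons /= fe.
have qj' : (q.+1 + j < m)%N by rewrite addSnnS.
have := IHj q.+1 _ (only_refl xst fo) fe' qj'.
move: ne; rewrite /x /=; case: (odd q) => /= ne ih; rewrite only_free ?ih//.
Qed.

Lemma until_block r r' j a f : r \in [:: s; t] -> r' \in [:: s; t] -> only f ->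
  prun (alt r r' j) (a, f) = (a, run (alt r r' j) \o f) \/
  exists2 i, (i < j)%N &
    prun (alt r r' i) (a, f) = (a, run (alt r r' i) \o f) /\
    run (alt r r' i) (f (sroot y0)) = sroot (if odd i then r' else r).
Proof.
move=> rst r'st fo; elim: j => [|j [IHj|[i ij h]]]; first by left.
  have [e|ne] := eqVneq (run (alt r r' j) (f (sroot y0))) (sroot (if odd j then r' else r)).
    by right; exists j.
  left; rewrite altSr -cats1 prun_cat IHj /= only_free//.
  - by congr pair; apply/funext => v /=; rewrite run_cat.
  - by case: ifP.
  - apply: only_run => //; apply: sub_all (alt_mem _ _ _) => b.
    by rewrite /= !inE => /orP[] /eqP ->; move: rst r'st; rewrite !inE.
by right; exists i => //; apply: ltnW.
Qed.

(** When a single root b lies in the dihedral plane, exactly one of the m letters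
    of either side of the braid relation is blocked, because the longest element
    must make b negative; deleting that letter amounts to composing with the
    reflection in b, and this does not depend on the side. *)
Lemma one_root r r' a f : [:: s; t] = [:: r; r'] \/ [:: s; t] = [:: r'; r] ->
  dominant (a, f) -> only f -> inplane (f (sroot y0)) ->
  let b := f (sroot y0) in
  prun (alt r r' m) (a, f) =
    ((a * artin_gen y0)%g, fun v => run (alt r r' m) (f v - bil b (f v) *: b)).
Proof.
move=> e dom fo pl b.
have rst : r \in [:: s; t] by case: e => ->; rewrite !inE eqxx ?orbT.
have r'st : r' \in [:: s; t] by case: e => ->; rewrite !inE eqxx ?orbT.
have rr' : r' != r by case: e => -[<- <-] //; rewrite eq_sym.
have [free|[i im [pi fi]]] := until_block m a rst r'st fo.
  have := prun_dominant (alt r r' m) dom; rewrite free => -[_ /(_ _ y0Y) /= pos].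
  have [_ /(_ _ y0Y) /= bpos] := dom.
  have lr' := longest_neg e.
  have lr : nonneg (- run (alt r r' m) (sroot r)).
    have <- : run (alt r' r m) (sroot r) = run (alt r r' m) (sroot r).
      by case: e => -[<- <-]; rewrite /m run_braid.
    by apply: longest_neg; case: e; [right|left].
  have bE := inplaneE pl.
  have bE' : f (sroot y0) = f (sroot y0) r *: sroot r + f (sroot y0) r' *: sroot r'.
    by rewrite {1}bE; case: e => -[<- <-] //; rewrite addrC.
  have neg : nonneg (- run (alt r r' m) (f (sroot y0))).
    rewrite {1}bE' linearD !linearZ /= opprD -!scalerN.
    by apply: nonneg_comb => //; move/nonnegP: bpos.
  have /run_eq0 e0 := nonneg_anti pos neg.
  have [[u fu] _] := dom; rewrite /= in fu; move: e0; rewrite fu => /run_eq0 /eqP.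
  by rewrite (negbTE (sroot_neq0 y0)).
pose x := if odd i then r' else r; pose x' := if odd i then r else r'.
have xst : x \in [:: s; t] by rewrite /x; case: ifP.
have x'st : x' \in [:: s; t] by rewrite /x'; case: ifP.
have xx' : x != x' by rewrite /x /x'; case: ifP => // _; rewrite eq_sym.
have E : alt r r' m = alt r r' i ++ x :: alt x' x (m - i.+1).
  have em : m = (i + (m - i.+1).+1)%N by rewrite subnSK// subnKC// ltnW.
  by rewrite {1}em altD /x /x'; case: ifP.
have fo' : only (run (alt r r' i) \o f).
  apply: only_run => //; apply: sub_all (alt_mem _ _ _) => d.
  by rewrite /= !inE => /orP[] /eqP ->; move: rst r'st; rewrite !inE.
have [[u fu] _] := dom; rewrite /= in fu.
have blk : block (run (alt r r' i) \o f) x = Some y0.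
  have -> : run (alt r r' i) \o f = run (u ++ alt r r' i).
    by apply/funext => v; rewrite run_cat fu.
  by apply: block_run => //; rewrite run_cat -fu.
rewrite E prun_cat pi prun_cons (rstep_block _ blk).
have := @after_block x' x 0 (m - i.+1) (a * artin_gen y0)%g _ x'st xst xx' fo' fi.
rewrite /= => -> //; last by rewrite add0n ltn_subrL (leq_ltn_trans _ im).
congr pair; apply/funext => v /=; rewrite run_cat run_cons; congr run.
rewrite linearB linearZ /= -/b fi -/x; set z := run _ (f v).
have -> : bil b (f v) = form x z by rewrite -bil_sroot -fi -/b bil_run.
by rewrite -/(refl x z) reflK.
Qed.

End OneRoot.

(** Two nonnegative roots of Y in the dihedral plane must be the simple ones: the
    preimages of the roots of s and t are combinations of two simple roots of Y
    and have coordinates of constant sign. *)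
Lemma two_roots a f y y' : dominant (a, f) -> y \in Y -> y' \in Y -> y != y' ->
  inplane (f (sroot y)) -> inplane (f (sroot y')) ->
  (f (sroot y) = sroot s /\ f (sroot y') = sroot t) \/
  (f (sroot y) = sroot t /\ f (sroot y') = sroot s).
Proof.
move=> [[u /= fu] pos] yY y'Y yy' /inplaneE e1 /inplaneE e2.
set b1 := f (sroot y) in e1 *; set b2 := f (sroot y') in e2 *.
have /nonnegP n1 := pos _ yY; have /nonnegP n2 := pos _ y'Y; rewrite -/b1 -/b2 in n1 n2.
set p1 := b1 s in e1 *; set q1 := b1 t in e1 *.
set p2 := b2 s in e2 *; set q2 := b2 t in e2 *.
have p10 : 0 <= p1 by exact: n1. have q10 : 0 <= q1 by exact: n1.
have p20 : 0 <= p2 by exact: n2. have q20 : 0 <= q2 by exact: n2.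
have fl k l : k *: b1 + l *: b2 = f (k *: sroot y + l *: sroot y').
  by rewrite /b1 /b2 fu linearD !linearZ.
have f0 z : f z = 0 -> z = 0 by rewrite fu; apply: run_eq0.
have comb0 k l : k *: b1 + l *: b2 = 0 -> k = 0 /\ l = 0.
  rewrite fl => /f0 /ffunP e; split; [move: (e y)|move: (e y')];
  rewrite !ffunE /GRing.scale /= eqxx; rewrite ?[y' == y]eq_sym (negbTE yy') /= !mulr1 !mulr0 ?addr0 ?add0r => -> //.
pose D := p1 * q2 - p2 * q1.
have Es : q2 *: b1 + (- q1) *: b2 = D *: sroot s.
  by rewrite e1 e2 /D; apply/ffunP => x; rewrite !ffunE /GRing.scale /=; ring.
have Et : (- p2) *: b1 + p1 *: b2 = D *: sroot t.
  by rewrite e1 e2 /D; apply/ffunP => x; rewrite !ffunE /GRing.scale /=; ring.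
have D0 : D != 0.
  apply/eqP => D0; move: Es Et; rewrite D0 !scale0r => /comb0 [q20' q10'] /comb0 [p20' p10'].
  have : 1 *: b1 + 0 *: b2 = 0.
    move/eqP: q10'; rewrite oppr_eq0 => /eqP q1z.
    by rewrite scale1r scale0r addr0 e1 q1z p10' !scale0r addr0.
  by move=> /comb0 [/eqP]; rewrite oner_eq0.
have sgn k l r : k *: b1 + l *: b2 = D *: sroot r -> 0 <= k * l.
  move=> e; have : run (rev u) (D *: sroot r) = k *: sroot y + l *: sroot y'.
    by rewrite -e fl fu runK.
  rewrite linearZ /= => e'.
  have := root_sign (letters_setT (rev u)) (finset.in_setT r).
  have ey : k = D * run (rev u) (sroot r) y.
    move/ffunP/(_ y): e'; rewrite !ffunE /GRing.scale /= eqxx (negbTE yy') /=; lra.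
  have ey' : l = D * run (rev u) (sroot r) y'.
    move/ffunP/(_ y'): e'; rewrite !ffunE /GRing.scale /= eqxx [y' == y]eq_sym (negbTE yy') /=; lra.
  have d2 : 0 <= D * D by rewrite -expr2 sqr_ge0.
  have -> : k * l = (D * D) * (run (rev u) (sroot r) y * run (rev u) (sroot r) y').
    by rewrite {1}ey {1}ey'; ring.
  move=> [] /nonnegP h; apply: mulr_ge0 => //; have := h y; have := h y'; rewrite ?ffunE.
    by move=> *; apply: mulr_ge0.
  by move=> h1 h2; rewrite -mulrNN; apply: mulr_ge0.
have qq : q1 * q2 = 0.
  by have := sgn _ _ _ Es; have := mulr_ge0 q10 q20; rewrite mulrN mulrC; lra.
have pp : p1 * p2 = 0.
  by have := sgn _ _ _ Et; have := mulr_ge0 p10 p20; rewrite mulNr mulrC; lra.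
have norm w x0 : bil (run w (sroot x0)) (run w (sroot x0)) = 2.
  by rewrite bil_run bil_sroot form_sroot gramxx.
have unit k r x0 : 0 <= k -> f (sroot x0) = k *: sroot r -> k = 1.
  move=> k0 e; have := norm u x0; rewrite -fu e linearZ /= bilC linearZ /= bil_sroot form_sroot.
  by rewrite gramxx /GRing.scale /=; nra.
move: qq => /eqP; rewrite mulf_eq0 => /orP[] /eqP q0.
  left; have b1s : b1 = p1 *: sroot s by rewrite e1 q0 scale0r addr0.
  have P1 := unit _ _ _ p10 b1s; move: pp; rewrite P1 mul1r => p20'.
  have b2t : b2 = q2 *: sroot t by rewrite e2 p20' scale0r add0r.
  by have Q2 := unit _ _ _ q20 b2t; rewrite b1s b2t P1 Q2 !scale1r.
right; have b2s : b2 = p2 *: sroot s by rewrite e2 q0 scale0r addr0.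
have P2 := unit _ _ _ p20 b2s; move: pp; rewrite P2 mulr1 => p10'.
have b1t : b1 = q1 *: sroot t by rewrite e1 p10' scale0r add0r.
by have Q1 := unit _ _ _ q10 b1t; rewrite b1t b2s P2 Q1 !scale1r.
Qed.

Lemma gram_label y y' : y != y' -> gram y y' = gram s t ->
  joined y y' /\ lab y y' = m.
Proof.
move=> yy'; rewrite !gramE// => /oppr_inj; rewrite cos_st /cosine.
case: ifP => [yE e|_ e]; last by case: (ccos_neq2 m2).
by split=> //; apply: (ccos_inj _ m2 e); apply: lab_ge2.
Qed.

Lemma prun_two a u r r' y y' k : y \in Y -> y' \in Y ->
  run u (sroot y) = sroot r -> run u (sroot y') = sroot r' ->
  prun (alt r r' k) (a, run u) = ((a * ev (alternating y y' k))%g, run u).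
Proof.
move=> yY y'Y e e'; elim: k a r r' y y' yY y'Y e e' => [|k IHk] a r r' y y' yY y'Y e e'.
  by rewrite /= mulg1.
rewrite [alt _ _ _]/= prun_cons (rstep_block _ (block_run yY e)) (IHk _ _ _ _ _ y'Y yY e' e).
congr pair; rewrite -mulgA; congr (_ * _)%g.
have -> : alternating y y' k.+1 = (y, false) :: alternating y' y k.
  rewrite /alternating /mkseq /= -[1%N]/(1 + 0)%N iotaDl -map_comp; congr cons.
  by apply: eq_map => i /=; case: (odd i).
by rewrite -cat1s ev_cat.
Qed.

(** Both sides of a braid relation act alike on states.  The three cases are
    given by the number of roots of Y in the plane of s and t: none, and all
    letters are free; two, and all letters are blocked and spell a braid relation
    of Y; or one. *)
Lemma rrun_braid a f : dominant (a, f) ->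
  rrun rstep (alternating s t m) (a, f) = rrun rstep (alternating t s m) (a, f).
Proof.
move=> dom; rewrite !rrun_alternating.
have [/existsP [y /andP[yY yp]]|none] := boolP [exists y in Y, inplane (f (sroot y))]; last first.
  have off : {in Y, forall y, ~~ inplane (f (sroot y))}.
    by move=> y yY; apply: contra none => yp; apply/existsP; exists y; rewrite yY.
  rewrite !prun_off_plane ?alt_mem//; last first.
    by apply: sub_all (alt_mem _ _ _) => b; rewrite /= !inE orbC.
  by congr pair; apply/funext => v /=; apply: run_braid.
have [/existsP [y' /andP[y'Y /andP[y'y y'p]]]|one] :=
    boolP [exists y' in Y, (y' != y) && inplane (f (sroot y'))].
  have [[u fu] _] := dom; rewrite /= in fu.
  suff h (z z' : V) : z \in Y -> z' \in Y -> z != z' ->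
      f (sroot z) = sroot s -> f (sroot z') = sroot t ->
      prun (alt s t m) (a, f) = prun (alt t s m) (a, f).
    have [] := two_roots dom y'Y yY y'y y'p yp => -[e1 e2]; first exact: h e1 e2.
    by apply: h e2 e1; rewrite 1?eq_sym.
  move=> zY z'Y zz'; rewrite fu => e1 e2.
  rewrite (prun_two _ _ zY z'Y e1 e2) (prun_two _ _ z'Y zY e2 e1); congr (_ * _, _)%g.
  have [zE zm] : joined z z' /\ lab z z' = m.
    by apply: gram_label => //; rewrite -!form_sroot -!bil_sroot -e1 -e2 bil_run.
  by rewrite -zm; apply/ev_eqP/pres_eq_rel; exists z, z'; split.
have onl : only y f.
  move=> x xY xy; apply: contra one => xp; apply/existsP; exists x.
  by rewrite xY xy.
rewrite (one_root yY _ dom onl yp); last by left.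
rewrite (one_root yY _ dom onl yp); last by right.
by congr pair; apply/funext => v; rewrite run_braid.
Qed.

End Braid.

End Retraction.

(** * Parabolic subgroups inside standard ones *)

(** It is enough to conjugate generators. *)
Lemma conj_generated (G : groupType) (g : G) (S H : set G) : subgroup H ->
  (forall x, S x -> H (g * x * g^-1)%g) -> (conj_set g (generated S) `<=` H)%classic.
Proof.
move=> Hs SH; rewrite -(conj_setVK g H); apply: conj_setS; apply: generated_min.
  exact: conj_subgroup.
by move=> x /SH Hx; apply/conj_setE; rewrite invgK.
Qed.

Section LinearAction.
Import Order.TTheory GRing.Theory Num.Theory.
Local Open Scope ring_scope.
Context (Gamma : artin_graph).
Notation V := (vertex Gamma).
Notation G := (artin_group Gamma).
Notation sroot := (@sroot Gamma).
Notation vec := (vec Gamma).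
Implicit Types (s t x y : V) (u : word V) (v z : vec) (g h : G) (X Y : {set V}).

(** A right action, as [actM] shows. *)
Definition act g v : vec := run (map fst (repr g)) v.

Lemma rrun_refl u v : rrun (fun l => @refl Gamma l.1) u v = run (map fst u) v.
Proof. by rewrite /run /rrun; elim: u v => //= a u IHu v; rewrite IHu. Qed.

Lemma act_ev u v : act (ev u) v = run (map fst u) v.
Proof.
rewrite /act -!rrun_refl; apply: (@rrun_pres_eq _ (@artin_rel Gamma) _ (fun l => @refl Gamma l.1) (fun _ => True)) => //.
- by move=> x b p _ /=; rewrite reflK.
- move=> _ _ p [s [t [stE [-> ->]]]] _; rewrite !rrun_refl !alternatingE.
  exact: run_braid.
- exact: repr_ev.
Qed.

Lemma act1 v : act 1%g v = v. Proof. by rewrite -(ev_nil Gamma) act_ev. Qed.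

Lemma actM g h v : act (g * h)%g v = act h (act g v).
Proof. by rewrite -(ev_repr g) -(ev_repr h) -ev_cat !act_ev map_cat run_cat. Qed.

Lemma actK g v : act g^-1%g (act g v) = v.
Proof. by rewrite -actM mulgV act1. Qed.

Lemma actVK g v : act g (act g^-1%g v) = v.
Proof. by rewrite -actM mulVg act1. Qed.

Lemma act_gen s v : act (artin_gen s) v = refl s v.
Proof. by rewrite /artin_gen [pres_gen _ _](_ : _ = ev [:: (s, false)])// act_ev. Qed.

Lemma act_run g : exists w : seq V, act g = run w.
Proof. by exists (map fst (repr g)). Qed.

Lemma act_std Y g : std_parabolic Y g -> exists2 w : seq V, letters Y w & act g = run w.
Proof.
move=> /std_parabolicP [u uY <-]; exists (map fst u); last by apply/funext => v; rewrite act_ev.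
by rewrite /letters all_map.
Qed.

(** The kernel of the linear representation: the pure, or coloured, Artin group. *)
Definition pure : set G := [set g | forall v, act g v = v].

Lemma pure_subgroup : subgroup pure.
Proof.
split; first exact: act1.
- by move=> g h pg ph v; rewrite actM pg ph.
- by move=> g pg v; rewrite -{1}(pg v) actK.
Qed.

Lemma pureJ g h : pure h -> pure (g * h * g^-1)%g.
Proof. by move=> ph v; rewrite !actM ph actK. Qed.

End LinearAction.

Section RetractionTheory.
Import Order.TTheory GRing.Theory Num.Theory.
Local Open Scope ring_scope.
Context (Gamma : artin_graph) (Y : {set Gamma}).
Notation V := (vertex Gamma).
Notation G := (artin_group Gamma).
Notation sroot := (@sroot Gamma).
Notation vec := (vec Gamma).
Notation cfg := (G * (vec -> vec))%type.
Implicit Types (s t x y : V) (v z : vec) (g h a b : G) (X Z : {set V}) (c : cfg) (f : vec -> vec).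
Notation rstep := (rstep Y).
Notation dominant := (dominant Y).

Definition rconf g c := rrun rstep (repr g) c.

Lemma rconf_ev (u : word V) c : dominant c -> rconf (ev u) c = rrun rstep u c.
Proof.
apply: (@rrun_pres_eq _ (@artin_rel Gamma) _ rstep dominant).
- exact: rstepI.
- by move=> x b p; apply: rstepK.
- move=> _ _ [a f] [s [t [stE [-> ->]]]]; exact: rrun_braid.
- exact: repr_ev.
Qed.

Lemma rconf_dominant g c : dominant c -> dominant (rconf g c).
Proof. by apply: rrunI => l p; apply: rstepI. Qed.

Lemma rconfM g h c : dominant c -> rconf (g * h)%g c = rconf h (rconf g c).
Proof.
move=> dc; rewrite -(ev_repr g) -(ev_repr h) -ev_cat rconf_ev// rrun_cat.
rewrite (rconf_ev (repr g))// rconf_ev//.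
by apply: (@rrunI _ _ rstep dominant) => // l p; apply: rstepI.
Qed.

Lemma dominant_id a : dominant (a, id).
Proof. by split; [exists [::]|move=> y yY; apply: nonneg_sroot]. Qed.

Lemma rconf_equivariant g b a f :
  rconf g ((b * a)%g, f) = ((b * (rconf g (a, f)).1)%g, (rconf g (a, f)).2).
Proof.
rewrite /rconf; elim: (repr g) a f => [//|[s e] u IHu] a f; rewrite /rrun /= -!/(rrun _ _ _).
rewrite {2 4 6}/rstep /=; case: (block _ _ _) => [y|]; last exact: IHu.
by rewrite -IHu; case: e; rewrite mulgA.
Qed.

Lemma blockE f s y : block Y f s = Some y -> y \in Y /\ f (sroot y) = sroot s.
Proof. by rewrite /block; case: pickP => // x /andP[xY /eqP fx] [<-]. Qed.

(** Blocking keeps this square commutative, since the state conjugates the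
    reflection in y to the reflection in s. *)
Lemma rconf_act g a f : dominant (a, f) -> exists b,
  [/\ std_parabolic Y b, (rconf g (a, f)).1 = (a * b)%g &
      forall v, (rconf g (a, f)).2 (act b v) = act g (f v)].
Proof.
move=> dom; rewrite -(ev_repr g) rconf_ev//.
elim: (repr g) a f dom => [|[s e] u IHu] a f dom.
  by exists 1%g; rewrite mulg1; split=> //; [case: (std_subgroup Y)|move=> v; rewrite act1 ev_nil act1].
have [b0 [b0Y e1 e2]] : exists b0, [/\ std_parabolic Y b0, (rstep (s, e) (a, f)).1 = (a * b0)%g &
    forall v, (rstep (s, e) (a, f)).2 (act b0 v) = refl s (f v)].
  rewrite /rstep /=; case E: (block _ _ _) => [y|] /=; last first.
    by exists 1%g; rewrite mulg1; split=> //; [case: (std_subgroup Y)|move=> v; rewrite act1].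
  have [yY fy] := blockE E.
  have [[w /= fw] _] := dom.
  have key v : f (refl y v) = refl s (f v).
    rewrite /refl fw linearB linearZ /= -fw fy; congr (_ - _ *: _).
    by rewrite -!bil_sroot -fy fw bil_run.
  case: e => /=; [exists (artin_gen y)^-1%g|exists (artin_gen y)]; split=> //; rewrite -?key.
  - by have [_ _ V] := std_subgroup Y; apply: V; apply: std_gen.
  - by move=> v; rewrite -[in RHS](actVK (artin_gen y) v) act_gen key reflK.
  - exact: std_gen.
  - by move=> v; rewrite act_gen.
have := rstepI (s, e) dom; rewrite [rrun _ _ _]/(rrun rstep u (rstep (s, e) (a, f))).
case: (rstep (s, e) (a, f)) e1 e2 => a1 f1 /= -> e2 dom1.
have [b [bY -> eb]] := IHu _ _ dom1.
exists (b0 * b)%g; split; first by have [_ M _] := std_subgroup Y; apply: M.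
  by rewrite mulgA.
move=> v; rewrite actM eb e2 -cat1s ev_cat actM; congr act.
by rewrite act_ev.
Qed.

Definition retr g := (rconf g (1%g, id)).1.
Definition rstate g := (rconf g (1%g, id)).2.

Lemma retrP g : std_parabolic Y (retr g) /\ forall v, rstate g (act (retr g) v) = act g v.
Proof.
have [b [bY e1 e2]] := rconf_act g (dominant_id 1%g).
by rewrite /retr /rstate e1 mul1g; split.
Qed.

Lemma retr_std g : std_parabolic Y (retr g). Proof. by have [] := retrP g. Qed.

Lemma rconf_std g a : std_parabolic Y g -> rconf g (a, id) = ((a * g)%g, id).
Proof.
move=> /std_parabolicP [u uY <-]; rewrite rconf_ev; last exact: dominant_id.
elim: u a uY => [|[s e] u IHu] a /=; first by rewrite ev_nil mulg1.
move=> /andP[sY uY]; rewrite /rrun /= -/(rrun _ _ _).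
have bl : block Y id s = Some s.
  by have := @block_run _ Y [::] s s sY erefl; rewrite [run _](_ : _ = id)//.
rewrite {2}/rstep /= bl IHu//; congr pair.
rewrite -cat1s ev_cat mulgA; congr (_ * _)%g; case: e => //; congr (_ * _)%g.
by rewrite -[[:: _]]/(word_inv [:: (s, false)]) ev_inv.
Qed.

Lemma retr_id g : std_parabolic Y g -> retr g = g.
Proof. by move=> gY; rewrite /retr rconf_std// mul1g. Qed.

(** The final state of a pure element belongs to the Coxeter group of Y and is
    dominant, hence it is the identity. *)
Lemma rstate_pure g : pure g -> rstate g = id /\ pure (retr g).
Proof.
move=> pg; have [gY e] := retrP g.
have [u uY au] := act_std gY.
have inv v : rstate g (act (retr g) v) = v by rewrite e pg.
have [_ pos] := rconf_dominant g (dominant_id 1%g).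
have st : rstate g = run (rev u).
  by apply/funext => v; rewrite -{1}(runVK u v) -au inv.
have triv : sameact (rev u) [::].
  apply: (@dominant_trivial _ Y); first by rewrite /letters all_rev.
  by move=> y yY; have := pos y yY; rewrite -/(rstate g) st.
have sid : rstate g = id by apply/funext => v; rewrite st triv.
by split=> // v; have := inv v; rewrite sid.
Qed.

Lemma pure_retr g : pure g -> pure (retr g).
Proof. by move=> /rstate_pure []. Qed.

(** After a pure element the retraction starts afresh from the initial state. *)
Lemma retrM_pure g h : pure g -> retr (g * h)%g = (retr g * retr h)%g.
Proof.
move=> /rstate_pure [st _]; rewrite {1}/retr rconfM; last exact: dominant_id.
have -> : rconf g (1%g, id) = ((retr g * 1)%g, id).
  by move: st; rewrite mulg1 /retr /rstate; case: rconf => a f /= ->.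
by rewrite rconf_equivariant.
Qed.

Lemma gram_joined s t x y : s != t -> x != y -> gram s t = gram x y ->
  joined x y -> joined s t.
Proof.
move=> st xy e xyE; suff [] : joined s t /\ lab s t = lab x y by [].
by apply: gram_label.
Qed.

(** For x in X, compare the runs of g * x read as such and as (g x g^-1) * g.  The
    element g x g^-1 belongs to A_Y, so the second one ends in the state of g;
    hence x is blocked in this state by some t(x) in Y, and g x g^-1 is the
    conjugate of t(x) by the retraction of g.  The roots of x and t(x)
    correspond under the state, so t is injective and preserves adjacency. *)
Lemma parabolic_in_std X g : (conj_set g (std_parabolic X) `<=` std_parabolic Y)%classic ->
  exists Z : {set V}, [/\ Z \subset Y, #|Z| = #|X|,
    conj_set g (std_parabolic X) = conj_set (retr g) (std_parabolic Z) &
    free_of_infinity X -> free_of_infinity Z].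
Proof.
move=> sub; pose f := rstate g; pose h := retr g.
have [[w fw] pos] := rconf_dominant g (dominant_id 1%g); rewrite -/(rstate g) -/f in fw pos.
have ch : rconf g (1%g, id) = (h, f) by rewrite /h /f /retr /rstate; case: rconf.
have blk x : x \in X -> exists y, [/\ y \in Y, f (sroot y) = sroot x &
    (g * artin_gen x * g^-1 = h * artin_gen y * h^-1)%g].
  move=> xX; set k := (g * _ * _)%g.
  have kY : std_parabolic Y k.
    by apply: sub; exists (artin_gen x) => //; apply: std_gen.
  have E1 : rconf (g * artin_gen x)%g (1%g, id) = ((k * h)%g, f).
    have -> : (g * artin_gen x = k * g)%g by rewrite /k mulgVK.
    rewrite rconfM; last exact: dominant_id.
    by rewrite rconf_std// mul1g -{1}[k]mulg1 rconf_equivariant ch.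
  have E2 : rconf (g * artin_gen x)%g (1%g, id) = rstep (x, false) (h, f).
    rewrite rconfM; last exact: dominant_id.
    rewrite ch [artin_gen x](_ : _ = ev [:: (x, false)])// rconf_ev//.
    by rewrite -ch; apply/rconf_dominant/dominant_id.
  move: E2; rewrite E1 /rstep /=; case E: (block _ _ _) => [y|].
    have [yY fy] := blockE E.
    by move=> [ke]; exists y; split=> //; rewrite -ke mulgK.
  move=> [_ fe]; have := congr1 (@^~ (run (rev w) (sroot x))) fe.
  rewrite /= fw runVK refl_self => /eqP; rewrite -addr_eq0 -mulr2n -scaler_nat scaler_eq0.
  by rewrite (negbTE (sroot_neq0 x)) orbF pnatr_eq0.
have [t tP] : exists t : V -> V, forall x, x \in X -> [/\ t x \in Y, f (sroot (t x)) = sroot x &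
    (g * artin_gen x * g^-1 = h * artin_gen (t x) * h^-1)%g].
  have ht x : exists y, x \in X -> [/\ y \in Y, f (sroot y) = sroot x &
      (g * artin_gen x * g^-1 = h * artin_gen y * h^-1)%g].
    by case: (boolP (x \in X)) => [/blk [y ?]|_]; [exists y|exists x].
  by exists (fun x => projT1 (cid (ht x))) => x; apply: (projT2 (cid (ht x))).
have tinj : {in X &, injective t}.
  move=> x x' xX x'X e; apply: (@sroot_inj Gamma).
  by have [_ <- _] := tP _ xX; have [_ <- _] := tP _ x'X; rewrite e.
exists [set t x | x in X]%SET; split.
- by apply/fintype.subsetP => _ /imsetP [x xX ->]; have [] := tP _ xX.
- by rewrite card_in_imset.
- have hg x : x \in X -> conj_set h (std_parabolic [set t x | x in X]%SET) (g * artin_gen x * g^-1)%g.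
    move=> xX; have [_ _ ->] := tP _ xX; exists (artin_gen (t x)) => //.
    by apply: std_gen; apply/imsetP; exists x.
  apply/seteqP; split; apply: conj_generated; try by apply: conj_subgroup; apply: std_subgroup.
    by move=> _ [x xX <-]; apply: hg.
  move=> _ [y /imsetP [x xX ->] <-]; have [_ _ <-] := tP _ xX.
  by exists (artin_gen x) => //; apply: std_gen.
- move=> Xf _ _ /imsetP [x xX ->] /imsetP [x' x'X ->] ne.
  have xx' : x != x' by apply: contra ne => /eqP ->.
  have [_ e1 _] := tP _ xX; have [_ e2 _] := tP _ x'X.
  have := Xf _ _ xX x'X xx'; rewrite -!/(joined _ _); apply: gram_joined => //.
  by rewrite -!form_sroot -!bil_sroot -e1 -e2 fw bil_run.
Qed.

Lemma run_support X u x v : letters X u -> x \notin X -> run u v x = v x.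
Proof.
elim: u v => //= s u IHu v /andP[sX uX] xX; rewrite IHu// /refl !ffunE /GRing.scale /=.
by rewrite (_ : x == s = false) ?mulr0 ?subr0//; apply: contraNF xX => /eqP ->.
Qed.

(** While letters of X are read, the state moves vectors only along the roots of
    X; so a letter can only be blocked by an element of X. *)
Lemma retr_stdI X g : std_parabolic X g -> std_parabolic (X :&: Y) (retr g).
Proof.
move=> /std_parabolicP [u uX <-]; rewrite /retr rconf_ev; last exact: dominant_id.
have [S1 SM SV] := std_subgroup (X :&: Y).
have : std_parabolic (X :&: Y) 1%g /\ exists2 w, letters X w & (@id vec) = run w.
  by split=> //; exists [::].
elim: u uX 1%g (@id vec) => [|[s e] u IHu] /=; first by move=> _ a f [].
move=> /andP[sX uX] a f [aXY [w wX fw]]; rewrite /rrun /= -/(rrun _ _ _).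
rewrite rstepE /=; case E: (block Y f s) => [y|].
  apply: IHu => //; split; last by exists w.
  have [yY fy] := blockE E.
  have yX : y \in X.
    apply: contraT => yX; have := run_support (sroot y) wX yX.
    rewrite -fw fy !ffunE eqxx; case: eqVneq => [ys|_ /eqP].
      by move: yX; rewrite ys sX.
    by rewrite eq_sym (oner_eq0 Rdefinitions.R).
  have Sy : std_parabolic (X :&: Y) (artin_gen y) by apply: std_gen; rewrite inE yX.
  by case: e; apply: SM => //; apply: SV.
apply: IHu => //; split=> //; exists (rcons w s); first by rewrite letters_rcons sX.
by apply/funext => v; rewrite run_rcons -fw.
Qed.

Lemma std_parabolicI X :
  (std_parabolic X `&` std_parabolic Y)%classic = @std_parabolic Gamma (X :&: Y).
Proof.
apply/seteqP; split=> [g [gX gY]|g gXY].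
  by rewrite -(retr_id gY); apply: retr_stdI.
by split; apply: std_sub gXY; rewrite ?finset.subsetIl ?finset.subsetIr.
Qed.

End RetractionTheory.

(** * Residual finiteness of the linear representation *)

Section IntegerSpan.
Import Order.TTheory GRing.Theory Num.Theory.
Local Open Scope ring_scope.
Notation R := Rdefinitions.R.
Context (gamma : R) (P : {poly int}).
Hypothesis Pmonic : P \is monic.
Implicit Types (f q : {poly int}) (z : R).

(** The rings below are the images of integer polynomials under evaluation at
    gamma, an algebraic integer that is a root of P. *)
Definition ival f : R := (map_poly (intr : int -> R) f).[gamma].
Hypothesis Proot : ival P = 0.

Lemma ivalD f q : ival (f + q) = ival f + ival q.
Proof. by rewrite /ival rmorphD hornerD. Qed.
Lemma ivalB f q : ival (f - q) = ival f - ival q.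
Proof. by rewrite /ival rmorphB hornerD hornerN. Qed.
Lemma ivalM f q : ival (f * q) = ival f * ival q.
Proof. by rewrite /ival rmorphM hornerM. Qed.
Lemma ivalC (k : int) : ival k%:P = k%:~R.
Proof. by rewrite /ival map_polyC hornerC. Qed.
Lemma ivalZ (k : int) f : ival (k *: f) = k%:~R * ival f.
Proof. by rewrite -mul_polyC ivalM ivalC. Qed.

Lemma ival_reduce f : exists2 q : {poly int}, (size q < size P)%N & ival f = ival q.
Proof.
exists (Pdiv.Ring.rmodp f P).
  by rewrite Pdiv.Ring.ltn_rmodp monic_neq0.
by rewrite {1}(Pdiv.RingMonic.rdivp_eq Pmonic f) ivalD ivalM Proot mulr0 add0r.
Qed.

Definition inO z := exists f, z = ival f.
Definition divO r z := exists f, z = 2 ^+ r * ival f.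

(** Pseudo-division by an integer relation q of gamma.  The power of the leading
    coefficient is bounded in terms of the size of f, which is what makes the
    next lemma work. *)
Lemma pseudo_reduce q n f : q != 0 -> ival q = 0 -> (size f <= n)%N ->
  exists2 f' : {poly int}, (size f' < size q)%N & (lead_coef q)%:~R ^+ n * ival f = ival f'.
Proof.
move=> q0 rq; elim: n f => [|n IHn] f fn.
  exists 0; first by rewrite size_poly0 size_poly_gt0.
  move: fn; rewrite leqn0 size_poly_eq0 => /eqP ->.
  by rewrite /ival rmorph0 horner0 mulr0.
have [fq|qf] := ltnP (size f) (size q).
  exists (lead_coef q ^+ n.+1 *: f); first exact: leq_ltn_trans (size_scale_leq _ _) fq.
  by rewrite ivalZ rmorphXn.
pose g := lead_coef q *: f - lead_coef f *: (q * 'X^(size f - size q)).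
have gn : (size g <= n)%N.
  have [f0|f0] := eqVneq f 0.
    by rewrite /g f0 scaler0 lead_coef0 scale0r subr0 size_poly0.
  have sf : (0 < size f)%N by rewrite size_poly_gt0.
  have sq : (0 < size q)%N by rewrite size_poly_gt0.
  apply: leq_trans (_ : (size f).-1 <= n)%N; last by rewrite -ltnS prednK.
  apply/leq_sizeP => j; rewrite leq_eqVlt => /orP[/eqP <-|fj]; rewrite /g coefB !coefZ coefMXn.
    have -> : ((size f).-1 < size f - size q)%N = false by lia.
    have -> : ((size f).-1 - (size f - size q) = (size q).-1)%N by lia.
    by rewrite -!/(lead_coef _) mulrC subrr.
  have fj' : (size f <= j)%N by lia.
  rewrite nth_default// mulr0; case: ifP => [_|_]; first by rewrite mulr0 subr0.
  have hq : (size q <= j - (size f - size q))%N by lia.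
  by rewrite (nth_default _ hq) mulr0 subr0.
have [f' f'q e] := IHn g gn; exists f' => //.
by rewrite -e exprSr -mulrA; congr (_ * _); rewrite /g ivalB !ivalZ ivalM rq mul0r mulr0 subr0.
Qed.

(** Take a relation q of minimal size: remainders modulo q are then determined
    by their values.  After multiplication by a fixed integer, the remainder of
    an element divisible by all powers of 2 has coefficients divisible by all
    powers of 2. *)
Lemma divO_eq0 z : (forall r, divO r z) -> z = 0.
Proof.
move=> dz; pose rel n := `[< exists q : {poly int}, [/\ q != 0, ival q = 0 & size q = n] >].
have ex : exists n, rel n by exists (size P); apply/asboolP; exists P; rewrite monic_neq0.
case: (ex_minnP ex) => d /asboolP [q [q0 rq sq]] min; set a := lead_coef q.
have a0 : a%:~R != 0 :> R by rewrite intr_eq0 lead_coef_eq0.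
pose n := size P.
have [f0 e0] := dz 0%N.
have [f1 f1n e1] := ival_reduce f0.
have [f2 f2q e2] := pseudo_reduce q0 rq (ltnW f1n).
have ez : a%:~R ^+ n * z = ival f2 by rewrite e0 expr0 mul1r e1.
have div j r : (2 ^+ r %| f2`_j)%Z.
  have [g0 h0] := dz r; have [g1 g1n h1] := ival_reduce g0.
  have [g2 g2q h2] := pseudo_reduce q0 rq (ltnW g1n).
  have e : ival (f2 - (2 ^+ r : int) *: g2) = 0.
    by rewrite ivalB ivalZ -ez -h2 h0 h1 rmorphXn /= -/n -/a; ring.
  have : f2 - (2 ^+ r : int) *: g2 = 0.
    apply/eqP; apply: contraT => ne0.
    have /min : rel (size (f2 - (2 ^+ r : int) *: g2)) by apply/asboolP; eexists; split; eauto.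
    rewrite -sq leqNgt (leq_ltn_trans (size_polyD _ _))// size_polyN gtn_max f2q.
    exact: leq_ltn_trans (size_scale_leq _ _) g2q.
  move=> /subr0_eq ->; rewrite coefZ; apply: dvdz_mulr; exact: dvdzz.
have f20 : f2 = 0.
  apply/polyP => j; rewrite coef0; apply/eqP; apply: contraT => nz.
  have := div j (absz f2`_j); rewrite /dvdz abszX /= => /dvdn_leq.
  rewrite absz_gt0 => /(_ nz); rewrite leqNgt => /negP [].
  exact: ltn_expl.
move: ez; rewrite f20 /ival rmorph0 horner0 => /eqP; rewrite mulf_eq0 expf_eq0.
by rewrite (negbTE a0) andbF => /eqP.
Qed.

Lemma inO_int (k : int) : inO k%:~R. Proof. by exists k%:P; rewrite ivalC. Qed.
Lemma inOD z z' : inO z -> inO z' -> inO (z + z').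
Proof. by move=> [f ->] [f' ->]; exists (f + f'); rewrite ivalD. Qed.
Lemma inOM z z' : inO z -> inO z' -> inO (z * z').
Proof. by move=> [f ->] [f' ->]; exists (f * f'); rewrite ivalM. Qed.
Lemma inON z : inO z -> inO (- z).
Proof. by move=> ?; rewrite -mulN1r; apply: inOM => //; apply: (inO_int (- 1)). Qed.
Lemma inO_sum (I : finType) (F : I -> R) : (forall i, inO (F i)) -> inO (\sum_i F i).
Proof. by move=> h; elim/big_ind: _ => //; [apply: (inO_int 0)|apply: inOD]. Qed.

(** Reduction modulo the monic polynomial P leaves boundedly many coefficients;
    reduce them modulo 2^r. *)
Lemma residues r : exists (K : finType) (res : R -> K), forall z z', inO z -> inO z' ->
  res z = res z' -> exists2 w, inO w & z - z' = 2 ^+ r * w.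
Proof.
pose K := {ffun 'I_(size P) -> 'I_(2 ^ r).-1.+1}.
have [h hP] : exists h : R -> {poly int}, forall z, inO z -> (size (h z) < size P)%N /\ z = ival (h z).
  have ex z : exists f, inO z -> (size f < size P)%N /\ z = ival f.
    have [[f e]|nz] := pselect (inO z); last by exists 0.
    by have [q qs e'] := ival_reduce f; exists q => _; rewrite e e'.
  by exists (fun z => projT1 (cid (ex z))) => z; apply: (projT2 (cid (ex z))).
pose md (c : int) : 'I_(2 ^ r).-1.+1 := inord (absz (c %% 2 ^+ r)%Z).
have n0 : (0 < 2 ^ r)%N by rewrite expn_gt0.
have z0 : (2 ^+ r : int) != 0 by rewrite expf_neq0.
exists K, (fun z => [ffun i : 'I_(size P) => md (h z)`_i]) => z z' zO z'O /ffunP e.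
have [sz ez] := hP _ zO; have [sz' ez'] := hP _ z'O.
have coe j : (2 ^+ r %| (h z)`_j - (h z')`_j)%Z.
  have [jn|nj] := ltnP j (size P); last by rewrite !nth_default ?subr0 ?dvdz0// (leq_trans (ltnW _) nj).
  rewrite -eqz_mod_dvd; have := e (Ordinal jn); rewrite !ffunE /= => /(congr1 val) /=.
  have bd (c : int) : (absz (c %% 2 ^+ r)%Z < (2 ^ r).-1.+1)%N.
    rewrite prednK// -ltz_nat gez0_abs ?modz_ge0// -[X in _ < X]natz natrX.
    by rewrite ltz_pmod// exprn_gt0.
  rewrite (inordK (bd _)) (inordK (bd _)) => /(congr1 Posz).
  by rewrite !gez0_abs ?modz_ge0// => ->.
pose w := \poly_(i < size P) (((h z)`_i - (h z')`_i) %/ 2 ^+ r)%Z.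
exists (ival w); first by exists w.
have : h z - h z' = (2 ^+ r : int) *: w.
  apply/polyP => j; rewrite coefZ coef_poly coefB; case: ltnP => jn.
    by rewrite mulrC divzK.
  by rewrite !nth_default ?subr0 ?mulr0// (leq_trans (ltnW _) jn).
by move=> /(congr1 ival); rewrite ivalB ivalZ -ez -ez' rmorphXn.
Qed.

End IntegerSpan.

Section DoubleCosine.
Import Order.TTheory GRing.Theory Num.Theory.
Local Open Scope ring_scope.
Notation R := Rdefinitions.R.

(** Chebyshev polynomials, normalized so that the value of [dcos k] at 2 cos x is
    2 cos (k x), in consecutive pairs. *)
Fixpoint dcos2 (k : nat) : {poly int} * {poly int} :=
  if k is k'.+1 then let: (p, q) := dcos2 k' in (q, 'X * q - p) else (2%:P, 'X).
Definition dcos k := (dcos2 k).1.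

Lemma dcosS k : (dcos2 k).2 = dcos k.+1.
Proof. by rewrite /dcos /=; case: (dcos2 k). Qed.

Lemma dcosSS k : dcos k.+2 = 'X * dcos k.+1 - dcos k.
Proof. by rewrite -dcosS /= -dcosS /dcos; case: (dcos2 k). Qed.

Lemma ival_dcos x k : ival (2 * cos x) (dcos k) = 2 * cos (k%:R * x).
Proof.
have [//] : ival (2 * cos x) (dcos k) = 2 * cos (k%:R * x) /\
  ival (2 * cos x) (dcos k.+1) = 2 * cos (k.+1%:R * x).
elim: k => [|k [IH0 IH1]].
  by rewrite mul0r cos0 mul1r /dcos /= ivalC /ival map_polyX hornerX mulr1.
split=> //; rewrite dcosSS ivalB ivalM IH0 IH1 {1}/ival map_polyX hornerX.
have -> : k.+2%:R * x = k.+1%:R * x + x by rewrite -[k.+2]addn1 natrD; ring.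
have -> : k%:R * x = k.+1%:R * x - x by rewrite -[k.+1]addn1 natrD; ring.
by rewrite !(cosD, cosN, sinN); ring.
Qed.

Lemma dcos_lead k : (0 < k)%N -> size (dcos k) = k.+1 /\ dcos k \is monic.
Proof.
case: k => // k _; suff [] : (size (dcos k) <= k.+1)%N /\
  (size (dcos k.+1) = k.+2 /\ dcos k.+1 \is monic) by [].
elim: k => [|k [IH0 [IH1 IH2]]].
  by rewrite /dcos /= size_polyX monicX; split=> //; exact: size_polyC_leq1.
have sX : size ('X * dcos k.+1) = k.+3 by rewrite mulrC size_mulX ?monic_neq0// IH1.
have lt : (size (- dcos k)%R < size ('X * dcos k.+1)%R)%N.
  by rewrite size_polyN sX; apply: leq_trans (_ : k.+2 <= _)%N => //; lia.
rewrite IH1; split=> //; rewrite dcosSS size_polyDl// sX; split=> //.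
by rewrite monicE lead_coefDl// lead_coefM lead_coefX mul1r -monicE.
Qed.

End DoubleCosine.

Section Residual.
Import Order.TTheory GRing.Theory Num.Theory.
Local Open Scope ring_scope.
Notation R := Rdefinitions.R.
Context (Gamma : artin_graph).
Notation V := (vertex Gamma).
Notation G := (artin_group Gamma).
Notation sroot := (@sroot Gamma).
Notation vec := (vec Gamma).
Implicit Types (s t x y : V) (v z w : vec) (g h : G).

(** A common multiple of the labels, so that every 2 cos(pi/m) is an integer
    polynomial in [gamma]. *)
Definition label_prod := (\prod_(e in edges Gamma) label e)%N.
Definition gamma : R := ccos label_prod.
(** The value of [dcos label_prod] at [gamma] is 2 cos pi. *)
Definition relation : {poly int} := dcos label_prod + 2%:P.

Lemma label_prod_gt0 : (0 < label_prod)%N.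
Proof. by rewrite prodn_cond_gt0// => e /label_ge2; lia. Qed.

Lemma relation_monic : relation \is monic.
Proof.
have [sz mon] := dcos_lead label_prod_gt0; rewrite monicE lead_coefDl -?monicE//.
by rewrite sz (leq_ltn_trans (size_polyC_leq1 _))// ltnS label_prod_gt0.
Qed.

Lemma relation_root : ival gamma relation = 0.
Proof.
rewrite ivalD ivalC /gamma /ccos ival_dcos.
have -> : label_prod%:R * (pi / label_prod%:R) = pi :> R.
  by rewrite mulrC divfK// pnatr_eq0 -lt0n label_prod_gt0.
by rewrite cospi; ring.
Qed.

Notation inO := (inO gamma).

Lemma inO_gram s t : inO (gram s t).
Proof.
rewrite /gram; case: eqVneq => _; first exact: (inO_int gamma 2).
apply: inON; rewrite /cosine; case: ifP => [stE|_]; last exact: (inO_int gamma 2).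
pose k := (\prod_(e in edges Gamma | e != [set s; t]%SET) label e)%N.
have Mk : (label_prod = lab s t * k)%N by rewrite /label_prod (bigD1 [set s; t]%SET).
have := label_prod_gt0; rewrite Mk muln_gt0 => /andP[l0 k0].
exists (dcos k); rewrite /gamma {1}/ccos ival_dcos Mk /ccos; congr (2 * cos _).
by rewrite natrM invfM; field; rewrite !pnatr_eq0; lia.
Qed.

Definition integral v := forall x, inO (v x).
(** Integral vectors divisible by 2^r. *)
Definition small r v := exists2 w, integral w & v = (2 ^+ r : R) *: w.

Lemma integral_sroot s : integral (sroot s).
Proof. by move=> x; rewrite ffunE; case: (x == s); [apply: (inO_int gamma 1)|apply: (inO_int gamma 0)]. Qed.

Lemma integralD v w : integral v -> integral w -> integral (v + w).
Proof. by move=> iv iw x; rewrite ffunE; apply: inOD. Qed.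

Lemma integralZ (k : R) v : inO k -> integral v -> integral (k *: v).
Proof. by move=> ik iv x; rewrite ffunE; apply: inOM. Qed.

Lemma integral_act g v : integral v -> integral (act g v).
Proof.
have [u ->] := act_run g; elim: u v => //= s u IHu v iv; apply: IHu => x.
rewrite /refl !ffunE; apply: inOD => //; apply: inON; apply: inOM.
  by apply: inO_sum => t; apply: inOM; [apply: inO_gram|].
by have := integral_sroot s x; rewrite ffunE.
Qed.

Lemma act_linear g k v w : act g (k *: v + w) = k *: act g v + act g w.
Proof. by have [u ->] := act_run g; rewrite linearP. Qed.
HB.instance Definition _ g := GRing.isLinear.Build R vec vec *:%R (act g) (fun k v w => act_linear g k v w).

Lemma smallD r v w : small r v -> small r w -> small r (v + w).
Proof. by move=> [v' iv ->] [w' iw ->]; exists (v' + w'); [apply: integralD|rewrite scalerDr]. Qed.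

Lemma smallZ r (k : R) v : inO k -> small r v -> small r (k *: v).
Proof.
by move=> ik [v' iv ->]; exists (k *: v'); [apply: integralZ|rewrite !scalerA mulrC].
Qed.

Lemma small_act r g v : small r v -> small r (act g v).
Proof. by move=> [w iw ->]; exists (act g w); [apply: integral_act|rewrite linearZ]. Qed.

Definition congruence r : set G := [set g | forall v, integral v -> small r (act g v - v)].

Lemma congruence_subgroup r : subgroup (congruence r).
Proof.
split.
- move=> v _; rewrite act1 subrr; exists 0; last by rewrite scaler0.
  by move=> x; rewrite ffunE; apply: (inO_int gamma 0).
- move=> g h cg ch v iv; rewrite actM.
  have -> : act h (act g v) - v = act h (act g v - v) + (act h v - v).
    by rewrite linearB /= addrA subrK.
  by apply: smallD; [apply/small_act/cg|apply: ch].
- move=> g cg v iv; have := small_act g^-1%g (cg _ iv); rewrite linearB /= actK.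
  move=> /(smallZ (inO_int gamma (- 1))); rewrite scaleN1r opprB; exact.
Qed.

(** If g = 1 + 2^r n, then g^2 = 1 + 2^(r+1) n + 2^(2r) n^2. *)
Lemma congruence_sqr r g : (0 < r)%N -> congruence r g -> congruence r.+1 (g ^+ 2)%g.
Proof.
move=> r0 cg v iv; have [w iw e] := cg _ iv; have [w' iw' e'] := cg _ iw.
have gv : act g v = v + (2 ^+ r : R) *: w by rewrite -e addrC subrK.
have gw : act g w = w + (2 ^+ r : R) *: w' by rewrite -e' addrC subrK.
exists (w + (2 ^+ r.-1 : R) *: w').
  apply: integralD => //; apply: integralZ => //; rewrite -natrX.
  exact: (inO_int gamma (2 ^ r.-1)%N).
rewrite expgS expg1 actM gv linearD linearZ /= gv gw.
apply/ffunP => x; rewrite !ffunE /GRing.scale /= exprS.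
have -> : (2 ^+ r : R) = 2 * 2 ^+ r.-1 by rewrite -exprS prednK.
ring.
Qed.

(** No nonzero element of the ring is divisible by all powers of 2. *)
Lemma congruence_pure g : (forall r, congruence r g) -> pure g.
Proof.
have sp s : (forall r, congruence r g) -> act g (sroot s) = sroot s.
  move=> cg; apply/subr0_eq/ffunP => x; rewrite [RHS]ffunE.
  apply: (divO_eq0 relation_monic relation_root) => r.
  have [w iw ->] := cg r _ (integral_sroot s); have [f e] := iw x.
  by exists f; rewrite ffunE e.
move=> cg v; have -> : v = \sum_s v s *: sroot s.
  apply/ffunP => x; rewrite sum_ffunE (bigD1 x)//= ffunE /GRing.scale /= ffunE eqxx mulr1.
  by rewrite big1 ?addr0// => t tx; rewrite !ffunE /GRing.scale /= eq_sym (negbTE tx) mulr0.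
by rewrite linear_sum; apply: eq_bigr => s _; rewrite linearZ /= sp.
Qed.

(** By the pigeonhole principle two of the first powers of g agree modulo 2^r, with
    a bound that depends on the number of matrices over a finite set only; a
    factorial serves all g at once. *)
Lemma congruence_exponent r : exists2 B, (0 < B)%N & forall g, congruence r (g ^+ B)%g.
Proof.
have [K [res resP]] := residues relation_monic relation_root r.
pose K' := {ffun V * V -> K}; pose N := #|K'|.+1.
exists N`!; first exact: fact_gt0.
move=> g; pose c (i : 'I_N) : K' := [ffun p => res (act (g ^+ i)%g (sroot p.1) p.2)].
have /injectivePn [i [j ij cij]] : ~~ injectiveb c.
  by apply/negP => /injectiveP /leq_card; rewrite card_ord ltnn.
wlog ltij : i j ij cij / (i < j)%N.
  by move=> th; case: (ltngtP i j) => [|/th|/val_inj/eqP]; [exact: th|rewrite eq_sym => /(_ ij); apply|rewrite (negbTE ij)].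
have key s : small r (act (g ^+ (j - i))%g (sroot s) - sroot s).
  suff h : small r (act (g ^+ j)%g (sroot s) - act (g ^+ i)%g (sroot s)).
    have := small_act (g ^+ i)^-1%g h; rewrite linearB /= actK -actM.
    by rewrite -{1}(subnK (ltnW ltij)) expgnDr mulgK.
  have ex x : exists w : R, inO w /\ act (g ^+ j)%g (sroot s) x - act (g ^+ i)%g (sroot s) x = 2 ^+ r * w.
    have [|||w iw e] := resP (act (g ^+ j)%g (sroot s) x) (act (g ^+ i)%g (sroot s) x).
    - by apply/integral_act/integral_sroot.
    - by apply/integral_act/integral_sroot.
    - by move/ffunP/(_ (s, x)): cij; rewrite !ffunE.
    - by exists w.
  have [w wP] := boolp.choice ex.
  exists [ffun x => w x] => [x|]; first by rewrite ffunE; have [] := wP x.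
  by apply/ffunP => x; rewrite !ffunE; have [_] := wP x.
have cg : congruence r (g ^+ (j - i))%g.
  move=> v iv; have -> : v = \sum_s v s *: sroot s.
    apply/ffunP => x; rewrite sum_ffunE (bigD1 x)//= ffunE /GRing.scale /= ffunE eqxx mulr1.
    by rewrite big1 ?addr0// => t tx; rewrite !ffunE /GRing.scale /= eq_sym (negbTE tx) mulr0.
  rewrite linear_sum -sumrB; elim/big_ind: _ => //.
  - by exists 0; [move=> x; rewrite ffunE; apply: (inO_int gamma 0)|rewrite scaler0].
  - exact: smallD.
  - by move=> s _; rewrite linearZ -scalerBr /=; apply: smallZ.
have : (j - i %| N`!)%N by apply: dvdn_fact; rewrite subn_gt0 ltij /= (leq_trans (leq_subr _ _))// ltnW.
by move=> /dvdnP [k ->]; rewrite mulnC expgnA; exact: (@subgroupX _ (congruence r) _ k (congruence_subgroup r) cg).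
Qed.

End Residual.

(** * Trees as metric spaces *)

(** The vertex set of a simplicial tree with its path metric, characterized by the
    four-point condition.  Parity expresses that the tree is bipartite, so that
    midpoints of segments of even length are vertices. *)
Record tree := Tree {
  point :> Type;
  dist : point -> point -> nat;
  dist_eq0 : forall x y, dist x y = 0%N <-> x = y;
  distC : forall x y, dist x y = dist y x;
  dist_four : forall x y z w,
    (dist x y + dist z w <= maxn (dist x z + dist y w) (dist x w + dist y z))%N;
  dist_parity : forall x y z, ~~ odd (dist x y + dist y z + dist x z);
  dist_geodesic : forall x y i, (i <= dist x y)%N ->
    exists2 z, dist x z = i & dist z y = (dist x y - i)%N
}.

Section TreeTheory.
Context (T : tree).
Implicit Types (x y z w a b c : T).
Notation d := (@dist T).

Lemma distxx x : d x x = 0%N. Proof. exact/dist_eq0. Qed.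

Lemma dist_triangle x y z : (d x z <= d x y + d y z)%N.
Proof. by have := dist_four x z y y; rewrite distxx addn0 [d z y]distC maxnn. Qed.

Definition between x z y := d x z + d z y = d x y.

(** The Gromov products of a, b, c at x form an ultrametric triple.  Chains of
    this inequality replace arguments about branching of geodesics. *)
Lemma product_trans x a b c k :
  (d a b + k.*2 <= d x a + d x b)%N -> (d b c + k.*2 <= d x b + d x c)%N ->
  (d a c + k.*2 <= d x a + d x c)%N.
Proof. by have := dist_four a c b x; rewrite [d c x]distC [d b x]distC [d a x]distC [d c b]distC; lia. Qed.

Lemma between_unique x y z w : between x z y -> between x w y -> d x z = d x w -> z = w.
Proof.
rewrite /between => bz bw e; apply/dist_eq0.
by have := dist_four z w x y; rewrite [d z x]distC [d w x]distC; lia.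
Qed.

Lemma dist_point x y i : (i <= d x y)%N -> exists2 z, d x z = i & between x z y.
Proof. by move=> h; have [z e1 e2] := dist_geodesic h; exists z => //; rewrite /between e1 e2; lia. Qed.

Lemma edge_side z z' x : d z z' = 1%N -> d x z = (d x z').+1 \/ d x z' = (d x z).+1.
Proof.
move=> e; have := dist_parity x z z'; have := dist_triangle x z z'; have := dist_triangle x z' z.
rewrite [d z' z]distC e; lia.
Qed.

Lemma edge_across z z' x y : d z z' = 1%N -> d x z' = (d x z).+1 -> d y z = (d y z').+1 ->
  d x y = (d x z + 1 + d z' y)%N.
Proof.
move=> e xz yz.
have := dist_four x z' y z; have := dist_four x y z z'; have := dist_four x z y z'.
rewrite [d z' y]distC [d z' z]distC [d z y]distC; lia.
Qed.

Definition on_path x y z z' := [/\ d z z' = 1%N & d x y = (d x z + 1 + d z' y)%N].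

(** An edge separates the tree into two sides, and y is on one of them. *)
Lemma on_path_split x y w z z' : on_path x w z z' -> on_path x y z z' \/ on_path y w z z'.
Proof.
move=> [e xw].
have xz : d x z' = (d x z).+1.
  by have [] := edge_side x e => //; have := dist_triangle x z' w; lia.
have wz : d w z = (d w z').+1.
  have [] := edge_side w e => // h; have := dist_triangle x z w.
  by rewrite [d z w]distC; rewrite [d z' w]distC in xw; lia.
have [yz|yz] := edge_side y e.
  by left; split=> //; apply: edge_across.
by right; split=> //; apply: edge_across.
Qed.

Lemma next_on_path x y : x <> y -> exists2 z, on_path x y x z & d z y = (d x y).-1.
Proof.
move=> ne; have h : (1 <= d x y)%N by rewrite lt0n; apply/eqP => /dist_eq0.
have [z e1 e2] := dist_geodesic h; exists z; last by rewrite e2 subn1.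
by split=> //; rewrite distxx e2; lia.
Qed.

(** The nearest point q of the convex set: if f fixes x and moved q inside the set,
    the midpoint of q and f q would be nearer to x. *)
Lemma projection (C : set T) x : (exists y, C y) ->
  (forall y z w, C y -> C w -> between y z w -> C z) ->
  exists2 q, C q & forall f : T -> T, (forall y z, d (f y) (f z) = d y z) ->
    f x = x -> C (f q) -> f q = q.
Proof.
move=> [y0 Cy0] conv.
pose P n := `[< exists2 q, C q & d x q = n >].
have ex : exists n, P n by exists (d x y0); apply/asboolP; exists y0.
case: (ex_minnP ex) => n /asboolP [q Cq dq] min; exists q => // f iso fx Cfq.
have dfq : d x (f q) = n by rewrite -dq -[in LHS]fx iso.
have par := dist_parity x q (f q).
apply: contrapT => ne.
have pos : (0 < d q (f q))%N by rewrite lt0n; apply/eqP => /dist_eq0 /esym.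
have le : ((d q (f q))./2 <= d q (f q))%N by lia.
have [z e1 bz] := dist_point le.
have Cz := conv _ _ _ Cq Cfq bz.
have /min : P (d x z) by apply/asboolP; exists z.
rewrite /between in bz.
have := dist_four x z q (f q); rewrite dq dfq [d z q]distC; lia.
Qed.

Section Automorphism.
Context (f : T -> T).
Hypothesis iso : forall x y, d (f x) (f y) = d x y.
Hypothesis even_disp : forall x, ~~ odd (d x (f x)).

Definition fixes x := f x = x.

(** An isometry which does not stretch a segment when applied twice folds it
    at its midpoint. *)
Lemma midpoint_fixed x z : (d x (f (f x)) <= d x (f x))%N ->
  between x z (f x) -> d x z = (d x (f x))./2 -> f z = z.
Proof.
rewrite /between => le bz zx; apply/esym/dist_eq0; have := even_disp x.
have := dist_four z (f z) x (f x); have := dist_four (f z) x (f x) (f (f x)).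
have e1 : d (f x) (f z) = d x z by rewrite iso.
have e2 : d (f z) (f (f x)) = d z (f x) by rewrite iso.
have e3 : d (f x) (f (f x)) = d x (f x) by rewrite iso.
rewrite [d (f z) x]distC [d (f z) (f x)]distC [d z x]distC; lia.
Qed.

Lemma fixed_point x : (d x (f (f x)) <= d x (f x))%N ->
  exists z, f z = z /\ (d x z).*2 = d x (f x).
Proof.
move=> le; have h : ((d x (f x))./2 <= d x (f x))%N by lia.
have [z e1 bz] := dist_point h; exists z; split; first exact: midpoint_fixed e1.
by rewrite e1; have := even_disp x; lia.
Qed.

Lemma elliptic_disp p x : f p = p -> (d x (f (f x)) <= d x (f x))%N.
Proof.
move=> fp; have e1 : d p (f x) = d p x by rewrite -[in LHS]fp iso.
have e2 : d p (f (f x)) = d p x by rewrite -[in LHS]fp iso.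
have e3 : d (f x) (f (f x)) = d x (f x) by rewrite iso.
have := dist_four x (f (f x)) (f x) p; rewrite [d (f x) p]distC [d (f (f x)) p]distC [d (f (f x)) (f x)]distC [d x p]distC; lia.
Qed.

(** The number (2 D - d(m, f^2 m)) / 2 is the Gromov product of m and f^2 m at f m,
    the length along which the two segments issued from f m coincide. *)
Lemma fold_reverse m x x' s : let D := d m (f m) in
  (d m (f (f m)) + s.*2 <= D + D)%N -> (s <= D)%N ->
  between m x (f m) -> d m x = s -> between m x' (f m) -> d m x' = (D - s)%N -> f x = x'.
Proof.
move=> D le sD; rewrite /between => bx xs bx' xs'; apply/esym/dist_eq0.
have e1 : d (f m) (f x) = s by rewrite iso.
have e2 : d (f x) (f (f m)) = (D - s)%N by rewrite iso; lia.
have e3 : d (f m) (f (f m)) = D by rewrite iso.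
have h1 : (d x' m + s.*2 <= d (f m) x' + d (f m) m)%N.
  by rewrite [d x' m]distC [d (f m) x']distC [d (f m) m]distC; lia.
have h2 : (d m (f (f m)) + s.*2 <= d (f m) m + d (f m) (f (f m)))%N by rewrite [d (f m) m]distC; lia.
have h3 : (d (f (f m)) (f x) + s.*2 <= d (f m) (f (f m)) + d (f m) (f x))%N.
  by rewrite [d (f (f m)) _]distC; lia.
have := product_trans (product_trans h1 h2) h3; rewrite [d (f m) x']distC; lia.
Qed.

Section Hyperbolic.
Hypothesis hyp : forall x, f x <> x.

Lemma hyperbolic_disp x : (d x (f x) < d x (f (f x)))%N.
Proof. by rewrite ltnNge; apply/negP => /fixed_point [z [/hyp]]. Qed.

Definition translation x := (d x (f (f x)) - d x (f x))%N.
Definition axis_dist x := (d x (f x) - (d x (f (f x)))./2)%N.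

Lemma isoX n x y : d (iter n f x) (iter n f y) = d x y.
Proof. by elim: n => //= n IHn; rewrite iso. Qed.

Lemma even_disp2 x : ~~ odd (d x (f (f x))).
Proof.
have := dist_parity x (f x) (f (f x)); rewrite iso.
by have := even_disp x; lia.
Qed.

Lemma translation_gt0 x : (0 < translation x)%N.
Proof. by rewrite subn_gt0 hyperbolic_disp. Qed.

Lemma disp1 x : d x (f x) = ((axis_dist x).*2 + translation x)%N.
Proof.
have := hyperbolic_disp x; have := dist_triangle x (f x) (f (f x)); rewrite iso.
by have := even_disp2 x; rewrite /axis_dist /translation; lia.
Qed.

(** In the four-point condition for x, f x, f^n x, f^(n+1) x two of the three sums
    are known, and they determine the third. *)
Lemma dist_iter x n : (0 < n)%N ->
  d x (iter n f x) = ((axis_dist x).*2 + n * translation x)%N.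
Proof.
have l0 := translation_gt0 x; set p := axis_dist x; set l := translation x in l0 *.
have D1 : d x (f x) = (p.*2 + l)%N := disp1 x.
case: n => // n _.
suff [//] : d x (iter n.+1 f x) = (p.*2 + n.+1 * l)%N /\ d x (iter n.+2 f x) = (p.*2 + n.+2 * l)%N.
elim: n => [|n [IH1 IH2]].
  by rewrite /= mul1n D1; split=> //; have := hyperbolic_disp x; have := disp1 x; rewrite /l /translation; lia.
split=> //.
have e1 : d (f x) (iter n.+3 f x) = d x (iter n.+2 f x) by rewrite -(iso x).
have e2 : d (f x) (iter n.+2 f x) = d x (iter n.+1 f x) by rewrite -(iso x).
have e3 : d (iter n.+2 f x) (iter n.+3 f x) = d x (f x).
  by rewrite -[RHS](isoX n.+2) -iterSr.
have := dist_four x (iter n.+3 f x) (f x) (iter n.+2 f x).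
have := dist_four x (iter n.+2 f x) (f x) (iter n.+3 f x).
rewrite [d (iter n.+3 f x) (f x)]distC [d (iter n.+3 f x) (iter n.+2 f x)]distC [d (iter n.+2 f x) (f x)]distC.
rewrite e1 e2 e3 D1 IH1 IH2 !mulSn; lia.
Qed.

Lemma axis_point x : exists2 b, d x b = axis_dist x & between x b (f x).
Proof. by apply: dist_point; have := disp1 x; lia. Qed.

Section Axis.
Context (x b : T).
Hypotheses (xb : d x b = axis_dist x) (xbfx : between x b (f x)).
Let p := axis_dist x.
Let l := translation x.

Let bfx : d b (f x) = (p + l)%N.
Proof. by move: xbfx; rewrite /between xb disp1 -/p -/l; lia. Qed.

Lemma dist_axis n : d x (iter n f b) = (p + n * l)%N.
Proof.
case: n => [|n]; first by rewrite mul0n addn0.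
have e1 : d (iter n.+1 f x) (iter n.+1 f b) = p by rewrite isoX.
have e2 : d (iter n.+1 f b) (iter n.+2 f x) = (p + l)%N by rewrite [iter n.+2 _ _]iterSr isoX.
have e3 : d (iter n.+1 f x) (iter n.+2 f x) = (p.*2 + l)%N by rewrite [iter n.+2 _ _]iterSr isoX disp1.
have a1 := @dist_iter x n.+1 isT; have a2 := @dist_iter x n.+2 isT; rewrite -/p -/l in a1 a2.
have := dist_triangle x (iter n.+1 f b) (iter n.+2 f x).
have := dist_four x (iter n.+1 f b) (iter n.+1 f x) (iter n.+2 f x).
rewrite [d (iter n.+1 f b) (iter n.+1 f x)]distC; nia.
Qed.

Lemma dist_axis_end n : d b (iter n f x) = (p + n * l)%N.
Proof.
case: n => [|[|n]]; [by rewrite distC mul0n addn0|by rewrite mul1n|].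
have a2 := @dist_iter x n.+2 isT; rewrite -/p -/l in a2.
have a1 : d (f x) (iter n.+2 f x) = (p.*2 + n.+1 * l)%N by rewrite iterS iso dist_iter.
have := dist_triangle x b (iter n.+2 f x).
have := dist_four b (iter n.+2 f x) x (f x).
rewrite [d (iter n.+2 f x) (f x)]distC [d (iter n.+2 f x) x]distC [d b x]distC disp1 -/p -/l.
by rewrite xb -/p bfx; nia.
Qed.

Lemma axis_between j n : (j <= n)%N -> (0 < n)%N -> between x (iter j f b) (iter n f x).
Proof.
move=> jn n0; rewrite /between dist_axis dist_iter//.
have -> : iter n f x = iter j f (iter (n - j) f x) by rewrite -iterD subnKC.
by rewrite isoX dist_axis_end -/p -/l; nia.
Qed.

Lemma dist_axis_iter n : d b (iter n f b) = (n * l)%N.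
Proof.
case: n => [|n]; first by rewrite distxx.
have e1 := dist_axis n.+1; have e2 : d (f x) (iter n.+1 f b) = (p + n * l)%N by rewrite iterS iso dist_axis.
have := dist_triangle x b (iter n.+1 f b).
have := dist_four b (iter n.+1 f b) x (f x).
rewrite [d (iter n.+1 f b) (f x)]distC [d (iter n.+1 f b) x]distC [d b x]distC disp1 -/p -/l.
by rewrite xb -/p bfx; nia.
Qed.

End Axis.

(** Displacements of the iterates at two points differ by a bounded amount. *)
Lemma translation_const x y : translation x = translation y.
Proof.
suff le x' y' : (translation x' <= translation y')%N by apply/eqP; rewrite eqn_leq !le.
rewrite leqNgt; apply/negP => lt.
pose n := ((axis_dist y').*2 + (d x' y').*2).+1.
have := @dist_iter x' n isT; have := @dist_iter y' n isT.
have := dist_triangle x' y' (iter n f x'); have := dist_triangle y' (iter n f y') (iter n f x').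
rewrite [d (iter n f y') _]distC isoX; nia.
Qed.

Lemma hyperbolic_iter n x : (0 < n)%N -> iter n f x <> x.
Proof.
move=> n0 e; have := @dist_iter x n n0; rewrite e distxx.
by have := translation_gt0 x; nia.
Qed.

End Hyperbolic.

End Automorphism.

(** Serre's criterion.  Take a fixed point x of F and a fixed point p of g at
    minimal distance.  The first vertex from x towards p is moved by some f in F,
    so the segments from x to g^-1 x and from x to f g x leave x in different
    directions, and f g doubles its displacement when applied twice. *)
Lemma elliptic_product (F : set (T -> T)) (g gi : T -> T) :
  (forall f, F f -> forall x y, d (f x) (f y) = d x y) ->
  (forall x y, d (g x) (g y) = d x y) -> (forall x, ~~ odd (d x (g x))) -> cancel gi g ->
  (exists x, forall f, F f -> f x = x) -> (exists p, g p = p) ->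
  (forall x, g x = x -> exists2 f, F f & f x <> x) ->
  exists f x, F f /\ (d x (f (g x)) < d x (f (g (f (g x)))))%N.
Proof.
move=> isoF isog eveng giK [x0' fx0'] [p0' gp0'] nofix.
pose P n := `[< exists x p, [/\ forall f, F f -> f x = x, g p = p & d x p = n] >].
have ex : exists n, P n by exists (d x0' p0'); apply/asboolP; exists x0', p0'.
case: (ex_minnP ex) => r /asboolP [x0 [p0 [fx0 gp0 dxp]]] min {x0' fx0' p0' gp0'}.
have r0 : (0 < r)%N.
  rewrite lt0n; apply/eqP => r0; have xp : x0 = p0 by apply/dist_eq0; rewrite dxp.
  by have [|f Ff] := nofix x0; [rewrite xp|rewrite fx0].
have r1 : (1 <= d x0 p0)%N by rewrite dxp.
have [x1 e1 e2] := dist_geodesic r1.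
have [f Ff fx1] : exists2 f, F f & f x1 <> x1.
  apply: contrapT => h; have /min : P (r - 1)%N; last by lia.
  apply/asboolP; exists x1, p0; split=> [f Ff| |]; [|by []|by rewrite e2 dxp].
  by apply: contrapT => ne; apply: h; exists f.
exists f, x0; split=> //.
have dg : d x0 (g x0) = r.*2.
  have [z [gz dz]] := fixed_point isog eveng (elliptic_disp isog x0 gp0).
  have /min : P (d x0 z) by apply/asboolP; exists x0, z.
  have := dist_triangle x0 p0 (g x0); have : d p0 (g x0) = r by rewrite -gp0 isog distC.
  lia.
have du : d x0 (gi x0) = r.*2 by rewrite -(isog x0) giK distC.
have dpu : d p0 (gi x0) = r by rewrite -(isog p0) giK gp0 distC.
have df y : d x0 (f y) = d x0 y by rewrite -{1}(fx0 _ Ff) isoF.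
have dfw : d x0 (f (g x0)) = r.*2 by rewrite df.
have dfp : d x0 (f p0) = r by rewrite df.
have dfx : d x0 (f x1) = 1%N by rewrite df.
have dwp : d (f (g x0)) (f p0) = r by rewrite isoF// -gp0 isog.
have dpx : d (f p0) (f x1) = (r - 1)%N by rewrite isoF// distC e2 dxp.
have -> : d x0 (f (g (f (g x0)))) = d (gi x0) (f (g x0)).
  by rewrite df -{1}(giK x0) isog.
rewrite dfw.
have h1 : (d x1 p0 + 1.*2 <= d x0 x1 + d x0 p0)%N by rewrite e2 e1 dxp; lia.
have h2 : (d p0 (gi x0) + 1.*2 <= d x0 p0 + d x0 (gi x0))%N by rewrite dpu dxp du; lia.
have h4 : (d (f (g x0)) (f p0) + 1.*2 <= d x0 (f (g x0)) + d x0 (f p0))%N by rewrite dwp dfw dfp; lia.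
have h5 : (d (f p0) (f x1) + 1.*2 <= d x0 (f p0) + d x0 (f x1))%N by rewrite dpx dfp dfx; lia.
rewrite ltnNge; apply/negP => le.
have h3 : (d (gi x0) (f (g x0)) + 1.*2 <= d x0 (gi x0) + d x0 (f (g x0)))%N by rewrite du dfw; lia.
have := product_trans (product_trans (product_trans (product_trans h1 h2) h3) h4) h5.
rewrite e1 dfx => h; apply/fx1/esym/dist_eq0; lia.
Qed.

End TreeTheory.

(** * The tree of two non-adjacent vertices *)

Section CommonPrefix.
Context (E : eqType).
Implicit Types (x y : E) (p q r : seq E).

(** The tree of all sequences, with edges joining a sequence to its extensions by one letter, has the metric [sdist]. *)
Fixpoint lcp p q : nat :=
  match p, q with
  | x :: p', y :: q' => if x == y then (lcp p' q').+1 else 0%N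
  | _, _ => 0%N
  end.

Lemma lcpC p q : lcp p q = lcp q p.
Proof. by elim: p q => [|x p IHp] [|y q] //=; rewrite eq_sym IHp. Qed.

Lemma lcp_le p q : (lcp p q <= size p)%N.
Proof. by elim: p q => [|x p IHp] [|y q] //=; case: ifP => // _; apply: IHp. Qed.

Lemma lcpxx p : lcp p p = size p.
Proof. by elim: p => //= x p ->; rewrite eqxx. Qed.

Lemma lcp_full p q : lcp p q = size p -> size p = size q -> p = q.
Proof.
elim: p q => [|x p IHp] [|y q] //=; case: eqP => // -> [e] [f].
by rewrite (IHp q).
Qed.

Lemma lcp_ultra p q r : (minn (lcp p q) (lcp q r) <= lcp p r)%N.
Proof.
elim: p q r => [|x p IHp] [|y q] [|z r] //=; rewrite ?min0n ?minn0//.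
case: (x =P y) => [<-|_]; last by rewrite min0n.
by case: (x =P z) => [_|_]; [rewrite minnSS ltnS|rewrite minn0].
Qed.

Lemma lcp_take n p q : lcp (take n p) q = minn n (lcp p q).
Proof.
elim: n p q => [|n IHn] [|x p] [|y q] //=; rewrite ?min0n ?minn0//.
by case: ifP => _; rewrite ?minn0// IHn minnSS.
Qed.

Lemma lcp_map (f : E -> E) p q : injective f -> lcp (map f p) (map f q) = lcp p q.
Proof. by move=> fi; elim: p q => [|x p IHp] [|y q] //=; rewrite (inj_eq fi) IHp. Qed.

Definition sdist p q := (size p + size q - (lcp p q).*2)%N.

Lemma sdistC p q : sdist p q = sdist q p.
Proof. by rewrite /sdist addnC lcpC. Qed.

Lemma sdist_eq0 p q : sdist p q = 0%N <-> p = q.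
Proof.
rewrite /sdist; split=> [e|->]; last by rewrite lcpxx addnn subnn.
have := lcp_le p q; have := lcp_le q p; rewrite lcpC => *.
by apply: lcp_full; lia.
Qed.

Lemma sdist_four p q r s :
  (sdist p q + sdist r s <= maxn (sdist p r + sdist q s) (sdist p s + sdist q r))%N.
Proof.
have D u v : sdist u v + (lcp u v).*2 = size u + size v.
  by have := lcp_le u v; have := lcp_le v u; rewrite /sdist [lcp v u]lcpC; lia.
have := D p q; have := D r s; have := D p r; have := D q s; have := D p s; have := D q r.
have := lcp_ultra p r q; have := lcp_ultra p s q; have := lcp_ultra r p s; have := lcp_ultra r q s.
rewrite [lcp r q]lcpC [lcp s q]lcpC [lcp r p]lcpC.
move: (lcp p q) (lcp r s) (lcp p r) (lcp q s) (lcp p s) (lcp q r) (size p) (size q) (size r) (size s).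
move: (sdist p q) (sdist r s) (sdist p r) (sdist q s) (sdist p s) (sdist q r).
clear; lia.
Qed.

Lemma sdist_parity p q r : ~~ odd (sdist p q + sdist q r + sdist p r).
Proof.
rewrite /sdist; have := lcp_le p q; have := lcp_le q p; have := lcp_le q r; have := lcp_le r q.
by have := lcp_le p r; have := lcp_le r p; rewrite [lcp q p]lcpC [lcp r q]lcpC [lcp r p]lcpC; lia.
Qed.

Lemma sdist_take p q i : (i <= size p - lcp p q)%N ->
  let z := take (size p - i) p in sdist p z = i /\ sdist z q = (sdist p q - i)%N.
Proof.
move=> ip z; have e1 : lcp z p = (size p - i)%N by rewrite lcp_take lcpxx; lia.
have e2 : lcp z q = lcp p q by rewrite lcp_take; have := lcp_le p q; lia.
have e3 : size z = (size p - i)%N by rewrite size_take_min; lia.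
have := lcp_le p q; have := lcp_le q p; rewrite [lcp q p]lcpC.
by rewrite /sdist [lcp p z]lcpC e1 e2 e3; lia.
Qed.

Lemma sdist_geodesic p q i : (i <= sdist p q)%N ->
  exists z, [/\ exists n, z = take n p \/ z = take n q,
    sdist p z = i & sdist z q = (sdist p q - i)%N].
Proof.
move=> ipq; have [ip|pi] := leqP i (size p - lcp p q).
  by have [e1 e2] := sdist_take ip; eexists; split; [eexists; left| |]; eauto.
have lq := lcp_le q p; have lp := lcp_le p q.
have iq : (sdist p q - i <= size q - lcp q p)%N.
  by move: lq lp pi ipq; rewrite /sdist [lcp q p]lcpC; lia.
have [e1 e2] := sdist_take iq.
exists (take (size q - (sdist p q - i)) q); split; first by eexists; right.
  by rewrite sdistC e2 [sdist q p]sdistC; lia.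
by rewrite sdistC.
Qed.

End CommonPrefix.

Section CosetPaths.
Context (Gamma : artin_graph) (c d : vertex Gamma).
Notation V := (vertex Gamma).
Notation G := (artin_group Gamma).
Notation W := (bool * set G)%type.
Implicit Types (g h : G) (u v w : W) (p q : seq W) (i b : bool).

Definition removed i := if i then d else c.
(** The two factors of the amalgam, stabilizers of the two base vertices. *)
Definition vstab i : set G := std_parabolic (~: [set removed i])%SET.

Definition gact g w : W := (w.1, [set x | w.2 (g^-1 * x)]%classic).
Definition base i : W := (i, vstab i).

Lemma gactM g h w : gact (g * h) w = gact g (gact h w).
Proof. by congr pair; apply/seteqP; split=> x /=; rewrite invgM mulgA. Qed.

Lemma gact1 w : gact 1 w = w.
Proof. by case: w => i S; congr pair; apply/seteqP; split=> x /=; rewrite invg1 mul1g. Qed.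

Lemma gactK g : cancel (gact g) (gact g^-1).
Proof. by move=> w; rewrite -gactM mulVg gact1. Qed.

Lemma gact_inj g : injective (gact g).
Proof. exact: can_inj (gactK g). Qed.

Lemma gact_base g i : gact g (base i) = base i <-> vstab i g.
Proof.
have [S1 SM SV] := std_subgroup (~: [set removed i])%SET; split=> [[e]|Sg].
  have : [set x | vstab i (g^-1 * x)]%classic g by rewrite /= mulVg.
  by rewrite e.
congr pair; apply/seteqP; split=> x /= Sx; last by apply: SM => //; apply: SV.
by rewrite -[x]mul1g -(mulgV g) -mulgA; apply: SM.
Qed.

(** Cosets of the two factors, joined when they meet.  The tree is
    obtained as the set of reduced paths of this graph, and its stabilizers are
    read off from the end points of paths. *)
Definition edge u v := `[< exists g i, u = gact g (base i) /\ v = gact g (base (~~ i)) >].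

Lemma edge_sym u v : edge u v = edge v u.
Proof.
suff h u' v' : edge u' v' -> edge v' u' by apply/idP/idP; apply: h.
by move=> /asboolP [g [i [-> ->]]]; apply/asboolP; exists g, (~~ i); rewrite negbK.
Qed.

Lemma edge_gact g u v : edge (gact g u) (gact g v) = edge u v.
Proof.
suff h g' u' v' : edge u' v' -> edge (gact g' u') (gact g' v').
  by apply/idP/idP => [/(h g^-1)|/h //]; rewrite !gactK.
move=> /asboolP [k [i [-> ->]]]; apply/asboolP.
by exists (g' * k), i; rewrite !gactM.
Qed.

Lemma edge_base i : edge (base i) (base (~~ i)).
Proof. by apply/asboolP; exists 1, i; rewrite !gact1. Qed.

Lemma edge_baseP i v : edge (base i) v -> exists2 h, vstab i h & v = gact h (base (~~ i)).
Proof.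
move=> /asboolP [g [j [e ->]]]; have ij : i = j by case: e.
by subst j; exists g => //; apply/gact_base; rewrite -e.
Qed.

(** No backtracking along the path. *)
Fixpoint nobt u p := if p is v :: p' then
  (if p' is w :: _ then u != w else true) && nobt v p' else true.

Definition ok i p := path edge (base i) p && nobt (base i) p.

Lemma nobt_map g u p : nobt (gact g u) (map (gact g) p) = nobt u p.
Proof.
elim: p u => //= v p IHp u; rewrite IHp; congr andb.
by case: p {IHp} => //= w p; rewrite (inj_eq (@gact_inj g)).
Qed.

Lemma ok_map g i p : vstab i g -> ok i (map (gact g) p) = ok i p.
Proof.
move=> /gact_base e; rewrite /ok -{1 2}e nobt_map path_map; congr andb.
by apply: eq_path => u v /=; rewrite edge_gact.
Qed.

Lemma ok_take n i p : ok i p -> ok i (take n p).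
Proof.
rewrite /ok; elim: p n (base i) => [|v p IHp] [|n] u //=.
move=> /andP[/andP[uv pp] /andP[nb np]].
have /andP[-> ->] : path edge v (take n p) && nobt v (take n p) by apply: IHp; rewrite pp.
by rewrite uv /= andbT; case: p nb {IHp pp np} => [|w p] nb; case: n => [|n] //=; rewrite nb.
Qed.

(** A reduced path from a base vertex, seen from the other base vertex. *)
Definition reroot i p : seq W :=
  if p is v :: p' then if v == base (~~ i) then p' else base i :: p else [:: base i].

Lemma reroot_ok i p : ok i p -> ok (~~ i) (reroot i p).
Proof.
rewrite /ok; case: p => [_|v p] /=; first by rewrite edge_sym edge_base.
move=> /andP[/andP[uv pp] /andP[nb np]].
case: eqP => [<-|/eqP ne]; first by rewrite pp.
by rewrite /= edge_sym edge_base uv pp [_ == v]eq_sym ne /= nb.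
Qed.

Lemma rerootK i p : ok i p -> reroot (~~ i) (reroot i p) = p.
Proof.
case: p => [_|v p] /=; first by rewrite negbK eqxx.
rewrite /ok /= => /andP[_ /andP[nb _]].
case: eqP => [->|_]; last by rewrite /= negbK eqxx.
by case: p nb => [//|w p]; rewrite /= negbK [w == _]eq_sym => /negbTE ->.
Qed.

Lemma reroot_map g i p : vstab i g -> vstab (~~ i) g ->
  reroot i (map (gact g) p) = map (gact g) (reroot i p).
Proof.
move=> /gact_base e1 /gact_base e2; case: p => [|v p] /=; first by rewrite e1.
by rewrite -{1}e2 (inj_eq (@gact_inj g)); case: ifP => //= _; rewrite e1.
Qed.

Lemma reroot_sdist i p q : ok i p -> ok i q -> sdist (reroot i p) (reroot i q) = sdist p q.
Proof.
have h p' q' : ok i (base (~~ i) :: p') -> reroot i q' = base i :: q' ->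
    sdist p' (reroot i q') = sdist (base (~~ i) :: p') q'.
  move=> /andP[_ /= /andP[nb _]] e; rewrite e /sdist /=.
  have -> : lcp p' (base i :: q') = 0%N.
    by case: p' nb => //= w p'; rewrite eq_sym => /negbTE ->.
  case: q' e => [|v q'] /=; first by lia.
  by case: ifP => [_ /(congr1 size) /=|]; [lia|rewrite eq_sym => ->; lia].
have s q' : size q' = size q' by [].
case: p => [|v p]; case: q => [|w q] /= okp okq.
- by rewrite /sdist /= eqxx.
- case: eqP => [e|_]; last by rewrite /sdist /= eqxx; lia.
  by rewrite sdistC [RHS]sdistC e; apply: (h q [::]) => //; rewrite -e.
- case: eqP => [e|_]; last by rewrite /sdist /= eqxx; lia.
  by rewrite e; apply: (h p [::]) => //; rewrite -e.
- case: (v =P _) => [e|ne]; case: (w =P _) => [e'|ne'].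
  + by rewrite e e' /sdist /= eqxx; lia.
  + rewrite e; have := h p (w :: q); rewrite /= (introF eqP ne'); apply=> //.
    by rewrite -e.
  + rewrite e' sdistC [RHS]sdistC; have := h q (v :: p); rewrite /= (introF eqP ne); apply=> //.
    by rewrite -e'.
  + by rewrite /sdist /= eqxx; case: ifP => _; lia.
Qed.

Lemma reroot_last i p : last (base (~~ i)) (reroot i p) = last (base i) p.
Proof. by case: p => //= v p; case: eqP => [->|]. Qed.

Lemma reroot_odd i p : odd (size (reroot i p)) = ~~ odd (size p).
Proof. by case: p => //= v p; case: ifP => //= _; rewrite negbK. Qed.

Definition letter (l : V * bool) : G := ev [:: l].

Lemma letter_std (X : {set V}) (l : V * bool) : l.1 \in X -> std_parabolic X (letter l).
Proof. by move=> lX; apply/std_parabolicP; exists [:: l] => //=; rewrite lX. Qed.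

(** Each generator fixes one of the two base vertices, and acts by translation on
    the paths that start there. *)
Definition step (l : V * bool) p : seq W :=
  if l.1 == c then reroot true (map (gact (letter l)) (reroot false p))
  else map (gact (letter l)) p.

Hypotheses (cd : c != d) (ncd : [set c; d]%SET \notin edges Gamma).

Lemma vstab_letter i (l : V * bool) : l.1 != removed i -> vstab i (letter l).
Proof. by move=> ne; apply: letter_std; rewrite !inE. Qed.

Lemma vstab_word i (u : word V) : all (fun l => l.1 != removed i) u -> vstab i (ev u).
Proof.
move=> h; apply/std_parabolicP; exists u => //; apply: sub_all h => l.
by rewrite !inE.
Qed.

Lemma stepI l p : ok false p -> ok false (step l p).
Proof.
move=> okp; rewrite /step; case: eqP => [e|/eqP ne].
  apply: (@reroot_ok true); rewrite ok_map; first exact: (@reroot_ok false).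
  by apply: vstab_letter; rewrite e.
by rewrite ok_map//; apply: vstab_letter.
Qed.

Lemma letterK (x : V) b : letter (x, ~~ b) * letter (x, b) = 1.
Proof.
rewrite /letter -ev_cat /=; apply/(ev_eqP _ [::]).
by have := pres_eq_cancel (@artin_rel Gamma) x (~~ b); rewrite negbK.
Qed.

Lemma stepK (x : V) b p : ok false p -> step (x, ~~ b) (step (x, b) p) = p.
Proof.
move=> okp; have K : cancel (gact (letter (x, b))) (gact (letter (x, ~~ b))).
  by move=> w; rewrite -gactM letterK gact1.
rewrite /step /=; case: eqP => [e|_]; last by rewrite mapK.
have ok1 : ok true (map (gact (letter (x, b))) (reroot false p)).
  by rewrite ok_map ?(@reroot_ok false)//; apply: vstab_letter; rewrite /= e.
by rewrite (@rerootK true _ ok1) mapK// (@rerootK false).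
Qed.

Lemma lrun_map (u : word V) p : all (fun l => l.1 != c) u -> lrun step u p = map (gact (ev u)) p.
Proof.
elim: u => [|l u IHu] /=.
  by rewrite ev_nil => _; rewrite (eq_map (@gact1)) map_id.
move=> /andP[lc uc]; rewrite IHu// /step (negbTE lc) -map_comp.
by apply: eq_map => w /=; rewrite -gactM /letter -ev_cat.
Qed.

Lemma lrun_reroot (u : word V) p : all (fun l => l.1 != d) u -> ok false p ->
  lrun step u p = reroot true (map (gact (ev u)) (reroot false p)).
Proof.
move=> + okp; elim: u => [|l u IHu] /=.
  by rewrite ev_nil => _; rewrite (eq_map (@gact1)) map_id (@rerootK false).
move=> /andP[ld ud]; rewrite IHu//.
have ok1 : ok true (map (gact (ev u)) (reroot false p)).
  by rewrite ok_map ?(@reroot_ok false)//; apply: vstab_word.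
have -> : map (gact (ev (l :: u))) (reroot false p) =
    map (gact (letter l)) (map (gact (ev u)) (reroot false p)).
  by rewrite -map_comp; apply: eq_map => w /=; rewrite -gactM /letter -ev_cat.
rewrite /step; case: eqP => [_|/eqP lc]; first by rewrite (@rerootK true).
by rewrite (@reroot_map (letter l) true)//; [apply: (@vstab_letter true)|apply: (@vstab_letter false)].
Qed.

Lemma alternating_letters (P : pred V) s t n : P s -> P t -> all (fun l => P l.1) (alternating s t n).
Proof.
move=> Ps Pt; rewrite /alternating /mkseq all_map; apply/allP => j _ /=.
by case: odd.
Qed.

(** The two letters of a defining relation are joined, so c or d is missing among
    them, and then both words act by translation from the same base vertex. *)
Lemma lrun_rel (u v : word V) p : artin_rel u v -> ok false p -> lrun step u p = lrun step v p.
Proof.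
move=> uv okp; have e : ev u = ev v by apply/ev_eqP/pres_eq_rel.
move: uv e => [s [t [stE [-> ->]]]] e.
have [cst|] := boolP ((s != c) && (t != c)).
  have /andP[sc tc] := cst.
  by rewrite !lrun_map ?e//; apply: (@alternating_letters (fun x => x != c)).
rewrite negb_and !negbK => cst.
have [sd td] : s != d /\ t != d.
  have st : s != t.
    by have := edges_card2 stE; rewrite cards2; case: eqP.
  by split; apply: contraNneq ncd => e'; move: stE st cst; rewrite e' => stE st;
    rewrite ?[d == c]eq_sym (negbTE cd) ?orbF /= => /eqP <-; rewrite ?orbF// finset.setUC.
by rewrite !lrun_reroot ?e//; apply: (@alternating_letters (fun x => x != d)).
Qed.

Definition bs_point := {p : seq W | ok false p}.

Lemma bs_geodesic (x y : bs_point) k : (k <= sdist (val x) (val y))%N ->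
  exists2 z : bs_point, sdist (val x) (val z) = k &
    sdist (val z) (val y) = (sdist (val x) (val y) - k)%N.
Proof.
move=> /sdist_geodesic [z [[n zE] e1 e2]].
have okz : ok false z by case: zE => ->; apply: ok_take; apply: valP.
by exists (Sub z okz).
Qed.

Lemma bs_eq0 (x y : bs_point) : sdist (val x) (val y) = 0%N <-> x = y.
Proof. by rewrite sdist_eq0; split=> [/val_inj|->]. Qed.

Canonical bs_tree : tree := @Tree bs_point (fun x y : bs_point => sdist (val x) (val y))
  bs_eq0 (fun _ _ => sdistC _ _) (fun _ _ _ _ => sdist_four _ _ _ _)
  (fun _ _ _ => sdist_parity _ _ _) bs_geodesic.
Implicit Types (x y : bs_point).

Lemma lrun_ok (u : word V) p : ok false p -> ok false (lrun step u p).
Proof. exact: (@lrunI _ _ step (fun p => ok false p) stepI). Qed.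

Definition tact g (x : bs_point) : bs_point := Sub (lrun step (repr g) (val x)) (lrun_ok (repr g) (valP x)).

Lemma tact_ev (u : word V) x : val (tact (ev u) x) = lrun step u (val x).
Proof.
apply: (@lrun_pres_eq _ (@artin_rel Gamma) _ step (fun p => ok false p)) => //.
- exact: stepI.
- exact: stepK.
- exact: lrun_rel.
- exact: repr_ev.
- exact: valP.
Qed.

Lemma tactM g h x : tact (g * h) x = tact g (tact h x).
Proof.
apply: val_inj; rewrite -{1}(ev_repr g) -{1}(ev_repr h) -ev_cat tact_ev lrun_cat.
by rewrite -tact_ev ev_repr -tact_ev ev_repr.
Qed.

Lemma tact1 x : tact 1 x = x.
Proof. by apply: val_inj; rewrite -(ev_nil Gamma) tact_ev. Qed.

Lemma tactK g : cancel (tact g) (tact g^-1).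
Proof. by move=> x; rewrite -tactM mulVg tact1. Qed.

Lemma tactVK g : cancel (tact g^-1) (tact g).
Proof. by move=> x; rewrite -tactM mulgV tact1. Qed.

Lemma step_sdist l p q : ok false p -> ok false q -> sdist (step l p) (step l q) = sdist p q.
Proof.
move=> okp okq; have M g p' q' : sdist (map (gact g) p') (map (gact g) q') = sdist p' q'.
  by rewrite /sdist !size_map lcp_map//; apply: gact_inj.
rewrite /step; case: eqP => [e|_]; last exact: M.
have ls : vstab true (letter l) by apply: vstab_letter; rewrite e.
by rewrite (@reroot_sdist true) ?ok_map ?(@reroot_ok false)// M (@reroot_sdist false).
Qed.

Lemma tact_iso g x y : dist (tact g x) (tact g y) = dist x y.
Proof.
rewrite /dist /=; elim: (repr g) => //= l u IHu.
by rewrite step_sdist ?lrun_ok//; apply: valP.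
Qed.

Lemma lrun_odd (u : word V) p : odd (size (lrun step u p)) = odd (size p).
Proof.
elim: u => //= l u <-; rewrite /step; case: ifP => _; last by rewrite size_map.
by rewrite reroot_odd size_map reroot_odd negbK.
Qed.

Lemma tact_even g x : ~~ odd (dist x (tact g x)).
Proof.
rewrite /dist /= /sdist; have := lcp_le (val x) (val (tact g x)).
have := lcp_le (val (tact g x)) (val x); rewrite lcpC.
by have := lrun_odd (repr g) (val x) => /=; lia.
Qed.

Lemma vstabP i g : vstab i g -> exists2 u : word V, all (fun l => l.1 != removed i) u & ev u = g.
Proof.
move=> /std_parabolicP [u uX <-]; exists u => //; apply: sub_all uX => l.
by rewrite !inE.
Qed.

Lemma lrun_last (u : word V) p :
  last (base false) (lrun step u p) = gact (ev u) (last (base false) p).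
Proof.
elim: u => [|l u IHu]; first by rewrite ev_nil gact1.
rewrite -cat1s ev_cat gactM -IHu lrun_cat /= /step -/(letter l); set q := lrun step u p.
have lm i' q' : vstab i' (letter l) ->
    last (base i') (map (gact (letter l)) q') = gact (letter l) (last (base i') q').
  by move=> /gact_base e; rewrite -{1}e last_map.
case: eqP => [e|/eqP ne]; last by rewrite lm//; apply: (@vstab_letter false).
rewrite (@reroot_last true) lm; last by apply: (@vstab_letter true); rewrite e.
by rewrite (@reroot_last false).
Qed.

Definition bvertex i : bs_point :=
  if i then exist (fun p => ok false p) [:: base true] (@reroot_ok true [::] isT)
  else exist (fun p => ok false p) [::] isT.

Lemma bvertex_last i : last (base false) (val (bvertex i)) = base i.
Proof. by case: i. Qed.

(** The end point of a path is an equivariant map to the coset graph, where the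
    stabilizers of vertices are known. *)
Lemma tact_bvertex g i : tact g (bvertex i) = bvertex i <-> vstab i g.
Proof.
split=> [e|/vstabP [u uX <-]].
  apply/gact_base; have := lrun_last (repr g) (val (bvertex i)).
  by rewrite -[lrun _ _ _]/(val (tact g (bvertex i))) e bvertex_last ev_repr.
apply: val_inj; rewrite tact_ev; case: i uX => uX.
  have rr : reroot false [:: base true] = [::] by rewrite /reroot eqxx.
  by rewrite lrun_reroot; [rewrite [val _]/= rr|by []|exact: valP].
by rewrite lrun_map.
Qed.

Lemma bvertex_dist i : dist (bvertex i) (bvertex (~~ i)) = 1%N.
Proof. by case: i. Qed.

Lemma bvertex_adjacent i y : dist (bvertex i) y = 1%N ->
  exists2 h, vstab i h & y = tact h (bvertex (~~ i)).
Proof.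
case: i => [|]; rewrite /dist /=.
  case: y => [[|v q]] okq /= => [_|].
    exists 1; first by have [] := std_subgroup (~: [set removed true])%SET.
    by rewrite tact1; apply: val_inj.
  rewrite /sdist /=; case: eqP => [e|ne]; last by move=> /=; lia.
  case: q okq => [|w [|w' q]] okq /=; try by lia.
  subst v; move=> _; have := okq; rewrite /ok /= => /andP[/andP[_ /andP[ew _]] /andP[nb _]].
  have [h hS we] := edge_baseP ew; exists h => //; apply: val_inj.
  have [u uX eh] := vstabP hS; rewrite -eh tact_ev lrun_reroot; [|by []|exact: valP].
  by rewrite /= eh -we [w == _]eq_sym (negbTE nb).
case: y => [q okq]; rewrite /= /sdist /=; case: q okq => [|v [|w q]] okq //=; try lia.
move=> _; have := okq; rewrite /ok /= => /andP[/andP[ev _] _].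
have [h hS ve] := edge_baseP ev; exists h => //; apply: val_inj.
by have [u uX eh] := vstabP hS; rewrite -eh tact_ev lrun_map//= eh ve.
Qed.

(** By induction on the length of the path, adding one edge at a time. *)
Lemma bs_orbit x : exists g i, x = tact g (bvertex i).
Proof.
case: x => p okp; elim/last_ind: p okp => [|p w IHp] okp.
  by exists 1, false; rewrite tact1; apply: val_inj.
have okq : ok false p by have := @ok_take (size p) false _ okp; rewrite -cats1 take_size_cat.
have [g [i e]] := IHp okq.
set x : bs_point := exist (fun p => ok false p) _ okp.
have dx : dist (exist (fun p => ok false p) p okq : bs_point) x = 1%N.
  rewrite /dist /= /sdist size_rcons lcpC -cats1.
  suff -> : lcp (p ++ [:: w]) p = size p by rewrite -addnn addnS subSn ?subnn.
  by elim: (p) => //= a q ->; rewrite eqxx.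
have [|h _ e'] := @bvertex_adjacent i (tact g^-1 x).
  by rewrite -(tact_iso g) tactVK -e.
by exists (g * h), (~~ i); rewrite tactM -e' tactVK.
Qed.

End CosetPaths.

(** * Intersections of complete parabolic subgroups *)

Section Orbits.
Context (Gamma : artin_graph) (c d : vertex Gamma).
Hypotheses (cd : c != d) (ncd : [set c; d]%SET \notin edges Gamma).
Notation V := (vertex Gamma).
Notation G := (artin_group Gamma).
Notation T := (bs_tree c d).
Notation bv := (@bvertex Gamma c d).
Notation rem := (removed c d).
Notation tact := (tact cd).
Implicit Types (g h k f : G) (x y z w : T) (i j : bool) (S X Y : {set V}).

Lemma base_parity g i j : odd (dist (bv i : T) (tact g (bv j))) = (i != j).
Proof.
have e := tact_even cd ncd g (bv i).
have [->|ne] := eqVneq i j; first by move: (tact_even cd ncd g (bv j)) => /negbTE.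
have -> : j = ~~ i by case: i j ne {e} => [] [].
have := dist_parity (bv i : T) (tact g (bv i)) (tact g (bv (~~ i))).
by rewrite tact_iso bvertex_dist; move: e; lia.
Qed.

Lemma base_type g h i j : tact g (bv i) = tact h (bv j) -> i = j.
Proof.
move=> e; have := base_parity (g^-1 * h) i j.
rewrite tactM// -e tactK// distxx => /esym/negbT.
by rewrite negbK => /eqP.
Qed.

Lemma in_std_vstab S i g : std_parabolic S g -> vstab c d i g ->
  std_parabolic (S :\ rem i) g.
Proof.
move=> gS gi; have : (std_parabolic S `&` std_parabolic (~: [set rem i])%SET) g by split.
by rewrite std_parabolicI; apply: std_sub; apply/fintype.subsetP => x; rewrite !inE andbC.
Qed.

Lemma std_vstab S i g : rem i \notin S -> std_parabolic S g -> vstab c d i g.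
Proof.
move=> nS; apply: std_sub; apply/fintype.subsetP => x xS; rewrite !inE.
by apply: contraNneq nS => <-.
Qed.

Lemma tact_fix g h i : tact h (tact g (bv i)) = tact g (bv i) <-> conj_set g (vstab c d i) h.
Proof.
rewrite conj_setE -(tact_bvertex cd ncd) !tactM//; split=> [->|e].
  by rewrite tactK.
by rewrite -[LHS](tactVK cd ncd g) e.
Qed.

Section Orbit.
Context (S : {set V}).
Notation AS := (@std_parabolic Gamma S).

Let S1 : AS 1. Proof. by have [] := std_subgroup S. Qed.
Let SM g h : AS g -> AS h -> AS (g * h). Proof. by have [_ M _] := std_subgroup S; apply: M. Qed.
Let SV g : AS g -> AS g^-1. Proof. by have [_ _ I] := std_subgroup S; apply: I. Qed.

Definition orbit_vertex x := exists g i, AS g /\ x = tact g (bv i).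
Definition orbit_edge x y :=
  exists g i, [/\ AS g, x = tact g (bv i) & y = tact g (bv (~~ i))].
Definition orbit_path x y := forall z z', on_path x y z z' -> orbit_edge z z'.

Lemma orbit_path_trans x y w : orbit_path x y -> orbit_path y w -> orbit_path x w.
Proof. by move=> xy yw z z' /(on_path_split y) [/xy|/yw]. Qed.

Lemma orbit_path_act g x y : AS g -> orbit_path x y -> orbit_path (tact g x) (tact g y).
Proof.
move=> gS xy z z' [e1 e2].
have [|h [i [hS e e']]] := xy (tact g^-1 z) (tact g^-1 z').
  by split; [rewrite tact_iso|rewrite -(tact_iso cd g) e2 -(tact_iso cd g x) -(tact_iso cd g _ y) !tactVK].
by exists (g * h), i; rewrite !tactM// -e -e' !tactVK//; split=> //; apply: SM.
Qed.

Lemma orbit_path_base i j : orbit_path (bv i) (bv j).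
Proof.
move=> z z' [e1]; have [->|ne] := eqVneq i j; first by rewrite distxx; lia.
have -> : j = ~~ i by case: i j ne => [] [].
rewrite bvertex_dist => e; exists 1, i; rewrite !tact1//; split=> //.
  by apply/esym/dist_eq0; lia.
by apply/dist_eq0; lia.
Qed.

(** A word in the letters of S moves the base edge through a chain of translates
    in which consecutive ones share a vertex, and a geodesic uses only edges
    that occur in any chain connecting its ends. *)
Lemma orbit_path_word g i j : AS g -> orbit_path (bv i) (tact g (bv j)).
Proof.
move=> /std_parabolicP [u uS <-].
elim: u uS i => [|l u IHu] /=; first by move=> _ i; rewrite ev_nil tact1//; apply: orbit_path_base.
move=> /andP[lS uS] i; rewrite -cat1s ev_cat tactM//.
have [k kl] : exists k : bool, l.1 != rem k.
  have [e|ne] := eqVneq l.1 c; first by exists true; rewrite e.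
  by exists false.
apply: (@orbit_path_trans _ (bv k)); first exact: orbit_path_base.
have /(tact_bvertex cd ncd) e := vstab_letter kl.
rewrite -{1}e; apply: orbit_path_act; last exact: IHu.
exact: letter_std.
Qed.

Lemma orbit_pathP x y : orbit_vertex x -> orbit_vertex y -> orbit_path x y.
Proof.
move=> [g [i [gS ->]]] [h [j [hS ->]]].
have := orbit_path_act gS (@orbit_path_word _ i j (SM (SV gS) hS)).
by rewrite tactM// tactVK.
Qed.

Lemma orbit_convex x z y : orbit_vertex x -> orbit_vertex y -> between x z y -> orbit_vertex z.
Proof.
move=> xS yS bz; have [->//|zy] := pselect (z = y).
have [z1 [e1 e2] _] := next_on_path zy.
have [|g [i [gS -> _]]] := orbit_pathP xS yS (z := z) (z' := z1).
  by split=> //; rewrite -bz e2 distxx; lia.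
by exists g, i.
Qed.

Lemma orbit_vertex_act g x : AS g -> orbit_vertex x -> orbit_vertex (tact g x).
Proof.
by move=> gS [h [i [hS ->]]]; exists (g * h), i; rewrite tactM//; split=> //; apply: SM.
Qed.

Lemma orbit_vertex_base i : orbit_vertex (bv i).
Proof. by exists 1, i; rewrite tact1. Qed.

(** The orbit under A_S of the base edge spans a convex subtree invariant under
    A_S; project the fixed vertex onto it. *)
Lemma orbit_fixed (F : set G) x : F `<=` AS -> (forall f, F f -> tact f x = x) ->
  exists g i, AS g /\ F `<=` conj_set g (std_parabolic (S :\ rem i)).
Proof.
move=> FS Fx.
have [||q [g [i [gS qE]]] fq] := @projection T orbit_vertex x.
- by exists (bv false); apply: orbit_vertex_base.
- by move=> y z w yS wS; apply: orbit_convex.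
exists g, i; split=> // f Ff; apply/conj_setE; apply: in_std_vstab.
  by apply: SM; [apply: SM; [apply: SV|apply: FS]|].
have /tact_fix/conj_setE // : tact f (tact g (bv i)) = tact g (bv i).
rewrite -qE; apply: fq; [exact: tact_iso|exact: Fx|].
by apply: orbit_vertex_act; [apply: FS|exists g, i].
Qed.

End Orbit.

End Orbits.

Section Intersections.
Context (Gamma : artin_graph) (hB : class_B Gamma).
Notation V := (vertex Gamma).
Notation G := (artin_group Gamma).
Implicit Types (g h k f u : G) (i j : bool) (S X Y Z : {set V}) (P Q F : set G).
Notation A X := (@std_parabolic Gamma X).

Lemma std1 S : A S 1. Proof. by have [] := std_subgroup S. Qed.
Lemma stdM S g h : A S g -> A S h -> A S (g * h). Proof. by have [_ M _] := std_subgroup S; apply: M. Qed.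
Lemma stdV S g : A S g -> A S g^-1. Proof. by have [_ _ I] := std_subgroup S; apply: I. Qed.

Lemma conj_std_id S g : A S g -> conj_set g (A S) = A S.
Proof.
move=> gS; apply/seteqP; split=> x; first move=> /conj_setE xS.
  have -> : x = g * (g^-1 * x * g) * g^-1 by rewrite !mulgA mulgV mul1g mulgK.
  by apply: stdM; [apply: stdM|apply: stdV].
by move=> xS; apply/conj_setE; apply: stdM => //; apply: stdM => //; apply: stdV.
Qed.

Lemma free_of_infinityS X Y : X \subset Y -> free_of_infinity Y -> free_of_infinity X.
Proof. by move=> /fintype.subsetP XY Yf x y /XY xY /XY yY; apply: Yf. Qed.

Lemma complete_conj g P : complete_parabolic P -> complete_parabolic (conj_set g P).
Proof. by move=> [h [X [Xf ->]]]; exists (g * h), X; rewrite conj_setM. Qed.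

Lemma complete_std X : free_of_infinity X -> complete_parabolic (A X).
Proof. by move=> Xf; exists 1, X; rewrite conj_set1. Qed.

Lemma not_free S : ~ free_of_infinity S ->
  exists c d, [/\ c \in S, d \in S, c != d & [set c; d]%SET \notin edges Gamma].
Proof.
move=> nf; apply: contrapT => h; apply: nf => c d cS dS cd.
by apply: contrapT => /negP ncd; apply: h; exists c, d.
Qed.

Section Dihedral.
Context (c d : V) (cd : c != d) (ncd : [set c; d]%SET \notin edges Gamma).
Context (S : {set V}) (cS : c \in S) (dS : d \in S).
Notation T := (bs_tree c d).
Notation bv := (@bvertex Gamma c d).
Notation rem := (removed c d).
Notation tact := (tact cd).

Hypothesis IH : forall i X Y g, X \subset S :\ rem i -> Y \subset S :\ rem i ->
  free_of_infinity Y -> A (S :\ rem i) g -> complete_parabolic (A Y `&` conj_set g (A X)).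

(** The intersection fixes the first edge of the geodesic from the vertex of A_Y to
    that of the conjugate of A_X.  That edge is a translate of the base edge, so
    the induction hypothesis on S intersects A_Y with the edge stabilizer;
    what results is conjugate to some A_Z with a vertex that is one step nearer. *)
Lemma intersection_step n i j X Y g : dist (bv i : T) (tact g (bv j)) = n ->
  X \subset S :\ rem j -> Y \subset S :\ rem i -> free_of_infinity Y -> A S g ->
  complete_parabolic (A Y `&` conj_set g (A X)).
Proof.
elim: n i Y g => [|n IHn] i Y g dn XS YS Yf gS.
  have e := (dist_eq0 (bv i : T) _).1 dn.
  have ij : i = j by apply: (@base_type _ _ _ cd ncd 1 g); rewrite tact1.
  subst j; apply: (@IH i) => //; apply: in_std_vstab => //.
  by apply/(tact_bvertex cd ncd).
have ne : (bv i : T) <> tact g (bv j) by move=> e; move: dn; rewrite -e distxx.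
have [y1 op dy] := next_on_path ne.
have Si : orbit_vertex cd S (bv i) by apply: orbit_vertex_base.
have Sj : orbit_vertex cd S (tact g (bv j)) by exists g, j.
have [k [i' [kS ki ky]]] := orbit_pathP ncd Si Sj op.
have ii' : i = i' by apply: (@base_type _ _ _ cd ncd 1 k); rewrite tact1.
subst i'; pose X0 := S :\ rem i :\ rem (~~ i).
have kv : vstab c d i k by apply/(tact_bvertex cd ncd).
have kS' : A (S :\ rem i) k by apply: in_std_vstab.
have X0S : X0 \subset S :\ rem i by apply: subsetDl.
(* X0 is what generates the stabilizer of the base edge inside A_S. *)
have Pk : A Y `&` conj_set g (A X) `<=` conj_set k (A X0).
  move=> f [fY fX].
  have fi : tact f (bv i) = bv i.
    apply/(tact_bvertex cd ncd); apply: std_vstab fY.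
    by apply/negP => /(fintype.subsetP YS); rewrite !inE eqxx.
  have fj : tact f (tact g (bv j)) = tact g (bv j).
    apply/tact_fix => //; move: fX; apply: conj_setS => h; apply: std_vstab.
    by apply/negP => /(fintype.subsetP XS); rewrite !inE eqxx.
  have fy : tact f y1 = y1.
    have [e1 e2] := op.
    apply: (@between_unique T (bv i) (tact g (bv j))).
    - by rewrite /between -{1}fi -{1}fj !tact_iso e2 distxx; lia.
    - by rewrite /between e2 distxx; lia.
    - by rewrite -{1}fi tact_iso.
  have fS : A S f by apply: std_sub fY; apply: fintype.subset_trans YS (subsetDl _ _).
  apply/conj_setE; apply: (@in_std_vstab Gamma c d (S :\ rem i) (~~ i)).
    apply: (@in_std_vstab Gamma c d S i).
  - by apply: stdM => //; apply: stdM => //; apply: stdV.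
  - apply/conj_setE/(tact_fix cd ncd); by rewrite -ki.
  - by apply/conj_setE/(tact_fix cd ncd); rewrite -ky.
have [u [Z [Zf QE]]] := IH X0S YS Yf kS'.
have sub : conj_set (k^-1 * u) (A Z) `<=` A X0.
  rewrite conj_setM -QE conj_setI conj_setK; exact: subIsetr.
have [Z' [Z'S _ uE /(_ Zf) Z'f]] := parabolic_in_std sub.
set h := retr X0 (k^-1 * u) in uE.
have hX0 : A X0 h by apply: retr_std.
have QE' : A Y `&` conj_set k (A X0) = conj_set (k * h) (A Z').
  by rewrite QE conj_setM -uE conj_setM conj_setVK.
have -> : A Y `&` conj_set g (A X) =
    conj_set (k * h) (A Z' `&` conj_set ((k * h)^-1 * g) (A X)).
  rewrite conj_setI -QE' -conj_setM mulVKg; apply/seteqP; split=> f.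
    by move=> fP; split; [split; [case: fP|apply: Pk]|case: fP].
  by move=> [[]].
have hS : A S h by apply: std_sub hX0; apply: fintype.subset_trans X0S (subsetDl _ _).
apply/complete_conj/(IHn (~~ i)) => //.
- rewrite -(tact_iso cd (k * h)) -tactM// mulVKg tactM//.
  have -> : tact h (bv (~~ i)) = bv (~~ i).
    apply/(tact_bvertex cd ncd); apply: std_vstab hX0.
    by rewrite !inE eqxx.
  by rewrite -ky dy dn.
- apply: fintype.subset_trans Z'S _; apply/fintype.subsetP => x; rewrite !inE.
  by move=> /and3P[-> _ ->].
- by apply: stdM => //; apply: stdV; apply: stdM.
Qed.

(** The clique Y misses c or d, but X need not: projecting the vertex fixed by A_Y
    onto the subtree of the conjugate of A_X allows to remove c or d from X. *)
Lemma intersection_dihedral X Y g : X \subset S -> Y \subset S -> free_of_infinity Y -> A S g ->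
  complete_parabolic (A Y `&` conj_set g (A X)).
Proof.
move=> XS YS Yf gS.
have [i Yi] : exists i, rem i \notin Y.
  have [cY|] := boolP (c \in Y); last by exists false.
  by exists true; apply/negP => dY; move: ncd; rewrite (Yf _ _ cY dY cd).
have Yi' : Y \subset S :\ rem i by rewrite subsetD1 YS Yi.
set P := A Y `&` _.
have FX : conj_set g^-1 P `<=` A X by rewrite conj_setI conj_setK; apply: subIsetr.
have Fx f : conj_set g^-1 P f -> tact f (tact g^-1 (bv i)) = tact g^-1 (bv i).
  move=> fP; apply/(tact_fix cd ncd); move: fP; apply: conj_setS => h [hY _].
  exact: std_vstab hY.
have [g1 [j [g1X Fj]]] := orbit_fixed ncd FX Fx.
have PE : P = A Y `&` conj_set (g * g1) (A (X :\ rem j)).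
  apply/seteqP; split=> f.
    move=> Pf; split; first by case: Pf.
    have := Fj (g^-1 * f * g); rewrite conj_setM => h.
    apply/conj_setE; apply: h; apply/conj_setE; by rewrite invgK !mulgA mulgV mul1g mulgK.
  move=> [fY fX]; split=> //; move: fX; rewrite conj_setM; apply: conj_setS.
  rewrite -[X in _ `<=` X](conj_std_id g1X); apply: conj_setS; apply: std_sub.
  exact: subsetDl.
rewrite PE; apply: (intersection_step erefl (j := j) (i := i)) => //.
  exact: finset.setSD.
by apply: stdM => //; apply: std_sub g1X.
Qed.

End Dihedral.

Lemma complete_std_intersection S X Y g : X \subset S -> Y \subset S ->
  free_of_infinity Y -> A S g -> complete_parabolic (A Y `&` conj_set g (A X)).
Proof.
have [n] := ubnP #|S|; elim: n S X Y g => // n IHn S X Y g Sn XS YS Yf gS.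
have [Sf|/not_free [c [d [cS dS cd ncd]]]] := pselect (free_of_infinity S).
  have pY : parabolic_in S (A Y) by exists 1, Y; rewrite conj_set1; split=> //; apply: std1.
  have pX : parabolic_in S (conj_set g (A X)) by exists g, X.
  have [h [Z [hS ZS ->]]] := hB Sf pY pX.
  by exists h, Z; split=> //; apply: free_of_infinityS Sf.
apply: (intersection_dihedral cd ncd cS dS) XS YS Yf gS => i X' Y' g'.
apply: IHn; rewrite -ltnS; apply: leq_trans Sn; rewrite ltnS.
by rewrite (cardsD1 (removed c d i) S) (_ : removed c d i \in S)// /removed; case: i.
Qed.

Lemma subsetTs X : X \subset [set: V]%SET. Proof. exact: finset.subsetT. Qed.

Lemma complete_intersection P g X : complete_parabolic P ->
  complete_parabolic (P `&` conj_set g (A X)).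
Proof.
move=> [h [Y [Yf ->]]].
have -> : conj_set h (A Y) `&` conj_set g (A X) =
    conj_set h (A Y `&` conj_set (h^-1 * g) (A X)).
  by rewrite conj_setI -conj_setM mulVKg.
apply/complete_conj/(@complete_std_intersection [set: V]%SET) => //; try exact: subsetTs.
exact: std_setT.
Qed.

Definition of_rank n P := exists g X, [/\ free_of_infinity X, P = conj_set g (A X) & #|X| = n].

Lemma of_rank_complete n P : of_rank n P -> complete_parabolic P.
Proof. by move=> [g [X [Xf -> _]]]; exists g, X. Qed.

Lemma complete_of_rank P : complete_parabolic P -> exists2 n, of_rank n P & (n <= #|V|)%N.
Proof. by move=> [g [X [Xf ->]]]; exists #|X|; [exists g, X|apply: max_card]. Qed.

(** By [parabolic_in_std] an inclusion is, up to conjugation, an inclusion of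
    generating sets of the given cardinals. *)
Lemma rank_lt n m P Q : of_rank n P -> of_rank m Q -> P `<=` Q -> P <> Q -> (n < m)%N.
Proof.
move=> [g [X [Xf -> <-]]] [h [Y [Yf -> <-]]] sub ne.
have sub' : conj_set (h^-1 * g) (A X) `<=` A Y.
  by rewrite conj_setM -[X in _ `<=` X](conj_setK h); apply: conj_setS.
have [Z [ZY Zc e _]] := parabolic_in_std sub'; rewrite -Zc; apply: proper_card.
rewrite finset.properEneq ZY andbT; apply: contra_notN ne => /eqP ZE.
rewrite -(conj_setVK h (conj_set g (A X))) -(conj_setM h^-1) e ZE conj_std_id//.
exact: retr_std.
Qed.

(** A complete parabolic subgroup of least rank among those containing F. *)
Lemma parabolic_closure F : (exists2 P, complete_parabolic P & F `<=` P) ->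
  exists P, [/\ complete_parabolic P, F `<=` P &
    forall Q, complete_parabolic Q -> F `<=` Q -> P `<=` Q].
Proof.
move=> [P0 /complete_of_rank [n0 r0 _] F0].
pose B n := `[< exists2 P, of_rank n P & F `<=` P >].
have ex : exists n, B n by exists n0; apply/asboolP; exists P0.
case: (ex_minnP ex) => n /asboolP [P rP FP] min; exists P; split=> //.
  exact: of_rank_complete rP.
move=> Q [g [X [Xf QE]]] FQ.
have [m rm _] := complete_of_rank (complete_intersection g X (of_rank_complete rP)).
rewrite -QE in rm.
have [e|ne] := pselect (P `&` Q = P); first by rewrite -e; apply: subIsetr.
have /min : B m by apply/asboolP; exists (P `&` Q) => // x Fx; split; [apply: FP|apply: FQ].
by have := rank_lt rm rP (@subIsetl _ _ _) ne; lia.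
Qed.

Definition common_fixed c d F := forall (cd : c != d), [set c; d]%SET \notin edges Gamma ->
  exists x : bs_point c d, forall f, F f -> tact cd f x = x.

(** Each fixed vertex allows to remove one of two non-adjacent vertices from S, up
    to conjugation, until S is a clique. *)
Lemma common_fixed_complete S F : F `<=` A S ->
  {in S &, forall c d, common_fixed c d F} -> exists2 P, complete_parabolic P & F `<=` P.
Proof.
have [n] := ubnP #|S|; elim: n S F => // n IHn S F Sn FS fixF.
have [Sf|/not_free [c [d [cS dS cd ncd]]]] := pselect (free_of_infinity S).
  by exists (A S) => //; apply: complete_std.
have [x Fx] := fixF c d cS dS cd ncd.
have [g [i [gS Fg]]] := orbit_fixed ncd FS Fx.
have [|||P cP FP] := IHn (S :\ removed c d i) (conj_set g^-1 F).
- rewrite -ltnS; apply: leq_trans Sn; rewrite ltnS.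
  by rewrite (cardsD1 (removed c d i) S) (_ : removed c d i \in S)// /removed; case: (i).
- by rewrite -[X in _ `<=` X](conj_setK g); apply: conj_setS.
- move=> a b; rewrite !inE => /andP[_ aS] /andP[_ bS] ab nab.
  have [y Fy] := fixF a b aS bS ab nab; exists (tact ab g^-1 y) => f /conj_setE.
  rewrite invgK => /Fy e; rewrite -{2}e -!tactM//; congr (tact _ _ _).
  by rewrite -[g * f * _]mulgA mulKg.
exists (conj_set g P); first exact: complete_conj.
by rewrite -[F](conj_setVK g); apply: conj_setS.
Qed.

(** Take F in M, contained in a complete parabolic subgroup, with closure P of
    greatest rank.  For g in M, Serre's criterion gives F and g a common fixed
    vertex in every tree, as M has no hyperbolic elements; so F and g lie
    in a common complete parabolic subgroup; as the rank of P is greatest, g is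
    in P. *)
Lemma elliptic_complete (M : set G) : subgroup M ->
  (forall c d (cd : c != d), [set c; d]%SET \notin edges Gamma ->
    forall g, M g -> exists x : bs_point c d, tact cd g x = x) ->
  exists2 P, complete_parabolic P & M `<=` P.
Proof.
move=> [M1 MM MV] ell.
pose B n := `[< exists F P, [/\ F `<=` M, F `<=` P, of_rank n P &
   forall Q, complete_parabolic Q -> F `<=` Q -> P `<=` Q] >].
have ex : exists n, B n.
  have [|P [cP FP min]] := @parabolic_closure [set 1].
    exists (A finset.set0); last by move=> _ ->; apply: std1.
    by apply: complete_std => x y; rewrite inE.
  have [n rn _] := complete_of_rank cP; exists n; apply/asboolP.
  by exists [set 1], P; split=> // _ ->.
have bound n : B n -> (n <= #|V|)%N.
  by move=> /asboolP [_ [_ [_ _ [g [X [_ _ <-]]] _]]]; apply: max_card.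
case: (ex_maxnP ex bound) => n /asboolP [F [P [FM FP rP minP]]] maxn.
exists P; first exact: of_rank_complete rP.
move=> g Mg; apply: contrapT => Pg.
pose F' := F `|` [set g].
have [|P' [cP' FP' min']] := @parabolic_closure F'.
  apply: (@common_fixed_complete [set: V]%SET); first by move=> x _; apply: std_setT.
  move=> c d _ _ cd ncd; apply: contrapT => nofix.
  have [|||||||f [x [[k Fk <-] lt]]] :=
      @elliptic_product (bs_tree c d) [set tact cd k | k in F] (tact cd g) (tact cd g^-1).
  - by move=> _ [k _ <-]; apply: tact_iso.
  - exact: tact_iso.
  - exact: tact_even.
  - exact: tactVK.
  - have [h [X [Xf PE _]]] := rP.
    have [i Xi] : exists i, removed c d i \notin X.
      have [cX|] := boolP (c \in X); last by exists false.
      by exists true; apply/negP => dX; move: ncd; rewrite (Xf _ _ cX dX cd).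
    exists (tact cd h (bvertex c d i)) => _ [k Fk <-]; apply/(tact_fix cd ncd).
    by have := FP _ Fk; rewrite PE; apply: conj_setS => y; apply: std_vstab.
  - exact: ell.
  - move=> y gy; apply: contrapT => h; apply: nofix; exists y => f [Ff|->//].
    by apply: contrapT => ne; apply: h; exists (tact cd f) => //; exists f.
  have [p kp] := ell c d cd ncd (k * g) (MM _ _ (FM _ Fk) Mg).
  have := @elliptic_disp (bs_tree c d) (tact cd (k * g)) (tact_iso cd (k * g)) p x kp.
  by rewrite !tactM// leqNgt lt.
have [m rm _] := complete_of_rank cP'.
have PP' : P `<=` P' by apply: minP => // x Fx; apply: FP'; left.
have ne : P <> P' by move=> e; apply: Pg; rewrite e; apply: FP'; right.
have /maxn : B m.
  apply/asboolP; exists F', P'; split=> // x [/FM//|->//].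
by have := rank_lt rP rm PP' ne; lia.
Qed.

End Intersections.

(** * Stabilizers along an axis *)

Section AxisStabilizers.
Context (Gamma : artin_graph) (hB : class_B Gamma).
Context (c d : vertex Gamma) (cd : c != d) (ncd : [set c; d]%SET \notin edges Gamma).
Notation V := (vertex Gamma).
Notation G := (artin_group Gamma).
Notation T := (bs_tree c d).
Notation bv := (@bvertex Gamma c d).
Notation rem := (removed c d).
Notation tact := (tact cd).
Notation A X := (@std_parabolic Gamma X).
Implicit Types (g h k f : G) (x z : T) (P Q : set G).
Context (S : {set V}) (H : set G).
Hypotheses (Hsub : subgroup H) (HS : H `<=` A S).
Hypothesis edge_complete : forall z z', orbit_edge cd S z z' ->
  exists2 P, complete_parabolic P & forall f, H f -> tact f z = z -> tact f z' = z' -> P f.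

Lemma tactX g n x : tact (g ^+ n) x = iter n (tact g) x.
Proof. by elim: n => [|n IHn] /=; rewrite ?expg0 ?tact1// expgS tactM// IHn. Qed.

(** Vertex stabilizers are parabolic, so intersecting the parabolic closure with
    one of them gives a smaller candidate. *)
Lemma closure_fixes F P x : (forall Q, complete_parabolic Q -> F `<=` Q -> P `<=` Q) ->
  complete_parabolic P -> F `<=` P ->
  (forall f, F f -> tact f x = x) -> forall f, P f -> tact f x = x.
Proof.
move=> min cP FP Fx; have [g [i xE]] := bs_orbit cd ncd x.
have cI : complete_parabolic (P `&` conj_set g (A (~: [set rem i])%SET)).
  exact: complete_intersection.
have : P `<=` P `&` conj_set g (A (~: [set rem i])%SET).
  apply: min => // f Ff; split; first exact: FP.
  by apply/(tact_fix cd ncd); rewrite -xE; apply: Fx.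
by move=> PI f /PI [_ fg]; rewrite xE; apply/tact_fix.
Qed.

Lemma fix_between f x z y : tact f x = x -> tact f y = y -> between x z y -> tact f z = z.
Proof.
move=> fx fy bz; have e1 : dist x (tact f z) = dist x z by rewrite -{1}fx tact_iso.
have e2 : dist (tact f z) y = dist z y by rewrite -{1}fy tact_iso.
by apply: (between_unique _ bz) => //; rewrite /between e1 e2.
Qed.

Section Axis.
Context (y : G) (b : T) (l : nat).
Hypotheses (Hy : H y) (bS : orbit_vertex cd S b) (l0 : (0 < l)%N).
Hypothesis axis : forall n, dist b (tact (y ^+ n) b) = (n * l)%N.

Let bj n : T := tact (y ^+ n) b.

Lemma axis_dist_nat i n : dist (bj i) (bj (i + n)) = (n * l)%N.
Proof. by rewrite /bj expgnDr tactM// tact_iso axis. Qed.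

Lemma axis_fix_between f i m n : (m <= n)%N ->
  tact f (bj i) = bj i -> tact f (bj (i + n)) = bj (i + n) -> tact f (bj (i + m)) = bj (i + m).
Proof.
move=> mn e1 e2; apply: fix_between e1 e2 _.
have -> : (i + n = i + m + (n - m))%N by lia.
by rewrite /between !axis_dist_nat -addnA axis_dist_nat mulnDl.
Qed.

(** The elements of H that fix a segment consisting of m periods of the axis. *)
Definition Fix m : set G := [set f | [/\ H f, tact f b = b & tact f (bj m) = bj m]].

Lemma bj0 : bj 0 = b. Proof. by rewrite /bj expg0 tact1. Qed.

Lemma FixS m n : (m <= n)%N -> Fix n `<=` Fix m.
Proof.
move=> mn f [Hf fb fn]; split=> //; have := @axis_fix_between f 0 m n mn.
by rewrite bj0 !add0n; apply.
Qed.

Lemma Fix_complete m : (0 < m)%N -> exists2 P, complete_parabolic P & Fix m `<=` P.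
Proof.
move=> m0; have ne : b <> bj m.
  by move=> e; have := axis m; rewrite -/(bj m) -e distxx; nia.
have mS : orbit_vertex cd S (bj m).
  by apply: orbit_vertex_act => //; apply: HS; apply: subgroupX.
have [z op _] := next_on_path ne.
have [P cP sP] := edge_complete (orbit_pathP ncd bS mS op).
exists P => // f [Hf fb fm]; apply: sP => //.
apply: fix_between fb fm _.
by have [e1 e2] := op; rewrite /between e2 distxx e1.
Qed.

Lemma Fix_closure m : (0 < m)%N -> exists P n, [/\ of_rank n P, Fix m `<=` P,
  (forall Q, complete_parabolic Q -> Fix m `<=` Q -> P `<=` Q) & H `&` P `<=` Fix m].
Proof.
move=> m0; have [P [cP FP min]] := parabolic_closure hB (Fix_complete m0).
have [n rn _] := complete_of_rank cP.
exists P, n; split=> // f [Hf Pf]; split=> //.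
- by apply: (closure_fixes min cP FP _ Pf) => k [].
- by apply: (closure_fixes min cP FP _ Pf) => k [].
Qed.

(** The parabolic closures of the groups [Fix m] decrease with m and determine
    them, and a strictly decreasing chain has at most |V| + 1 members. *)
Lemma Fix_stable : exists2 m, (0 < m <= #|V|.+1)%N & Fix m `<=` Fix m.+1.
Proof.
apply: contrapT => h.
suff [P [n [_ _ _ _]]] : exists P n, [/\ of_rank n P, Fix #|V|.+2 `<=` P,
    (forall Q, complete_parabolic Q -> Fix #|V|.+2 `<=` Q -> P `<=` Q),
    H `&` P `<=` Fix #|V|.+2 & (n + #|V|.+1 <= #|V|)%N] by lia.
have : (#|V|.+1 <= #|V|.+1)%N by [].
elim: {1 3 4 5 6}#|V|.+1 => [_|m IHm mV].
  have [P [n [rn FP min HP]]] := @Fix_closure 1 isT; exists P, n; split=> //.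
  by rewrite addn0; have [g [X [_ _ <-]]] := rn; apply: max_card.
have [P [n [rn FP min HP nm]]] := IHm (ltnW mV).
have [P' [n' [rn' FP' min' HP']]] := @Fix_closure m.+2 isT; exists P', n'; split=> //.
have sub : P' `<=` P.
  apply: min'; first exact: of_rank_complete rn.
  by move=> f /(FixS (leqnSn m.+1)) /FP.
have ne : P' <> P.
  move=> e; apply: h; exists m.+1; first by rewrite mV.
  move=> f Ff; apply: HP'; split; first by case: Ff.
  by rewrite e; apply: FP.
by have := rank_lt rn' rn sub ne; lia.
Qed.

(** Once the groups [Fix m] are stationary, [Fix m] is contained in its conjugate
    by y.  Their parabolic closures have the same rank, so they are equal and
    [Fix m] is normalized by y; its elements fix all translates of b. *)
Lemma axis_rigid f i n : H f -> (#|V|.+1 <= n)%N ->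
  tact f (bj i) = bj i -> tact f (bj (i + n)) = bj (i + n) -> forall j, tact f (bj j) = bj j.
Proof.
move=> Hf nV fi fin; have [m /andP[m0 mV] Fm] := Fix_stable.
have [H1 HM HV] := Hsub.
have yF k : Fix m k -> Fix m (y^-1 * k * y).
  move=> Fk; have [Hk kb km1] := Fm _ Fk.
  split; first by apply: (HM) => //; apply: (HM) => //; apply: (HV).
    have k1 : tact k (bj 1) = bj 1 by have [] : Fix 1 k by apply: FixS Fk.
    by rewrite /bj expg1 in k1; rewrite !tactM// k1 tactK.
  by move: km1; rewrite /bj !tactM// expgS tactM// => ->; rewrite tactK.
have [P [r [rP FP min HP]]] := Fix_closure m0.
have yP : P = conj_set y P.
  have ry : of_rank r (conj_set y P).
    by have [g [X [Xf -> rX]]] := rP; exists (y * g), X; rewrite conj_setM.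
  apply: contrapT => ne.
  suff sub : P `<=` conj_set y P by have := rank_lt rP ry sub ne; lia.
  apply: min; first exact: of_rank_complete ry.
  by move=> k /yF /FP Pk; apply/conj_setE.
have Fy k : Fix m k -> Fix m (y * k * y^-1).
  move=> Fk; apply: HP; split.
    by have [Hk _ _] := Fk; apply: (HM); [apply: (HM)|apply: (HV)].
  by rewrite yP; exists k => //; apply: FP.
have FyX j k : Fix m k -> Fix m (y ^+ j * k * (y ^+ j)^-1).
  elim: j => [|j IHj] Fk; first by rewrite expg0 mul1g invg1 mulg1.
  by have := Fy _ (IHj Fk); rewrite expgS invgM !mulgA.
have yFX j k : Fix m k -> Fix m ((y ^+ j)^-1 * k * y ^+ j).
  elim: j => [|j IHj] Fk; first by rewrite expg0 mulg1 invg1 mul1g.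
  by have := yF _ (IHj Fk); rewrite expgSr invgM !mulgA.
have Ff : Fix m f.
  have : Fix m ((y ^+ i)^-1 * f * y ^+ i).
    apply: (@FixS m n); first exact: leq_trans mV nV.
    split.
    - have HX := subgroupX i Hsub Hy.
      by apply: (HM) => //; apply: (HM) => //; apply: (HV).
    - by move: fi; rewrite /bj !tactM// => ->; rewrite tactK.
    - move: fin; rewrite /bj !tactM// expgnDr tactM// => ->; by rewrite tactK.
  by move=> /(FyX i); rewrite !mulgA mulgV mul1g mulgK.
move=> j; have [_ e _] := yFX j _ Ff.
by move: e; rewrite !tactM// => e; rewrite /bj -[LHS](tactVK cd ncd (y ^+ j)) e.
Qed.

(** If f reverses the segment then y f y f^-1 fixes it, hence the whole axis by
    rigidity; so f conjugates y to y^-1 as far as the axis is concerned. *)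
Lemma axis_flip f K j0 J : H f -> (#|V|.+2 <= J)%N -> (j0 + J <= K)%N ->
  (forall j, (j0 <= j <= j0 + J)%N -> tact f (bj j) = bj (K - j)) ->
  forall j, (j <= K)%N -> tact f (bj j) = bj (K - j).
Proof.
move=> Hf JV JK flip; have [H1 HM HV] := Hsub.
have yb j : tact y (bj j) = bj j.+1 by rewrite /bj expgS tactM.
have fV j : (j0 <= j <= j0 + J)%N -> tact f^-1 (bj (K - j)) = bj j.
  by move=> /flip <-; rewrite tactK.
pose k := y * f * y * f^-1.
have Hk : H k by apply: (HM); [apply: (HM) => //; apply: HM|apply: (HV)].
have kfix j : (j0 <= j < j0 + J)%N -> tact k (bj (K - j)) = bj (K - j).
  move=> jJ; rewrite !tactM// fV; last by lia.
  rewrite yb flip; last by lia.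
  by rewrite yb; congr bj; lia.
have kall : forall j, tact k (bj j) = bj j.
  have e : (K - (j0 + J - 1) + (J - 1) = K - j0)%N by lia.
  apply: (@axis_rigid k (K - (j0 + J - 1)) (J - 1)) => //.
  - by lia.
  - by apply: kfix; lia.
  - by rewrite e; apply: kfix; lia.
have up j : (j < K)%N -> tact f (bj j) = bj (K - j) -> tact f (bj j.+1) = bj (K - j.+1).
  move=> jK fj; have := kall (K - j)%N; rewrite !tactM// -{1}fj tactK// yb => e.
  apply: (can_inj (tactK cd ncd y)); rewrite e yb; congr bj; lia.
have down j : (j < K)%N -> tact f (bj j.+1) = bj (K - j.+1) -> tact f (bj j) = bj (K - j).
  move=> jK fj; have := kall (K - j)%N.
  have e1 : tact f^-1 (bj (K - j)) = tact y^-1 (tact f^-1 (tact y^-1 (bj (K - j)))).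
    by have := kall (K - j)%N; rewrite !tactM// => {2}<-; rewrite !tactK.
  have e2 : tact y^-1 (bj (K - j)) = bj (K - j.+1).
    have -> : (K - j = (K - j.+1).+1)%N by lia.
    by rewrite -yb tactK.
  move: e1; rewrite e2 -fj tactK// -yb tactK// => e1 _.
  by rewrite -e1 tactVK.
have at0 : tact f (bj j0) = bj (K - j0) by apply: flip; lia.
have ups n : (j0 + n <= K)%N -> tact f (bj (j0 + n)) = bj (K - (j0 + n)).
  elim: n => [|n IHn] nK; first by rewrite addn0.
  by rewrite addnS; apply: up; [lia|apply: IHn; lia].
have downs n : (n <= j0)%N -> tact f (bj (j0 - n)) = bj (K - (j0 - n)).
  elim: n => [|n IHn] nj; first by rewrite subn0.
  apply: down; first by lia.
  have -> : (j0 - n.+1).+1 = (j0 - n)%N by lia.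
  by apply: IHn; lia.
move=> j jK; have [jj|jj] := leqP j0 j.
  by have := ups (j - j0)%N; rewrite subnKC//; apply.
by have := downs (j0 - j)%N; rewrite subKn ?(ltnW jj)//; apply; lia.
Qed.

End Axis.

End AxisStabilizers.

(** * Subgroups in which power equations are solvable *)

(** The divisibility condition makes the powers y_(n+1) ^ k_n trivial in every
    quotient of finite exponent, for n large. *)
Definition power_solvable (G : groupType) (H : set G) :=
  forall (h : nat -> G) (k : nat -> nat), (forall n, H (h n)) ->
    (forall n, (0 < k n)%N /\ (n`! %| k n)%N) ->
  exists y, forall n, H (y n) /\ y n = h n * y n.+1 ^+ k n.

Section PowerImage.
Context (Gamma : artin_graph).
Notation V := (vertex Gamma).
Notation G := (artin_group Gamma).
Notation A X := (@std_parabolic Gamma X).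
Context (H : set G) (X : {set V}) (g : G).
Hypotheses (Hsub : subgroup H) (Hpure : H `<=` @pure Gamma) (Hpow : power_solvable H).

(** The trace of H on a translate of a subtree; by [retr_id] it contains, up to
    conjugation by g, all elements of H in the conjugate of A_X by g. *)
Definition local_image : set G := [set retr X (g^-1 * f * g) | f in H].

Let pureC f : H f -> pure (g^-1 * f * g).
Proof. by move=> /Hpure /(pureJ g^-1); rewrite invgK. Qed.

Let phiM f f' : H f -> H f' ->
  retr X (g^-1 * (f * f') * g) = retr X (g^-1 * f * g) * retr X (g^-1 * f' * g).
Proof.
move=> Hf Hf'; rewrite -retrM_pure; last exact: pureC.
by rewrite !mulgA mulgK.
Qed.

Let phi1 : retr X (g^-1 * 1 * g) = 1.
Proof. by rewrite mulg1 mulVg retr_id//; apply: std1. Qed.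

Let phiX f n : H f -> retr X (g^-1 * f ^+ n * g) = retr X (g^-1 * f * g) ^+ n.
Proof.
move=> Hf; elim: n => [|n IHn]; first by rewrite !expg0 phi1.
by rewrite !expgS phiM// ?IHn//; apply: subgroupX.
Qed.

Lemma local_image_subgroup : subgroup local_image.
Proof.
have [H1 HM HV] := Hsub; split; first by exists 1.
- by move=> _ _ [f Hf <-] [f' Hf' <-]; exists (f * f'); rewrite ?phiM//; apply: (HM).
- move=> _ [f Hf <-]; exists f^-1; first exact: HV.
  have e : retr X (g^-1 * f^-1 * g) * retr X (g^-1 * f * g) = 1.
    by rewrite -phiM// ?mulVg ?phi1//; apply: (HV).
  by rewrite -[LHS](mulgK (retr X (g^-1 * f * g))) e mul1g.
Qed.

Lemma local_image_pure : local_image `<=` @pure Gamma.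
Proof. by move=> _ [f Hf <-]; apply/pure_retr/pureC. Qed.

Lemma local_image_std : local_image `<=` A X.
Proof. by move=> _ [f Hf <-]; apply: retr_std. Qed.

Lemma local_image_power : power_solvable local_image.
Proof.
move=> h k Hh kP.
have ex n : exists f, H f /\ retr X (g^-1 * f * g) = h n by have [f Hf e] := Hh n; exists f.
have [h' h'P] := boolp.choice ex.
have [|y yP] := Hpow _ kP (h := h'); first by move=> n; have [] := h'P n.
exists (fun n => retr X (g^-1 * y n * g)) => n; have [Hy ->] := yP n.
have [Hy1 _] := yP n.+1; have [Hh' e] := h'P n.
split; first by exists (h' n * y n.+1 ^+ k n) => //; have [_ HM _] := Hsub; apply: (HM) => //; apply: subgroupX.
by rewrite phiM ?phiX ?e//; apply: subgroupX.
Qed.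

End PowerImage.

Section Elliptic.
Context (Gamma : artin_graph) (hB : class_B Gamma).
Context (c d : vertex Gamma) (cd : c != d) (ncd : [set c; d]%SET \notin edges Gamma).
Notation V := (vertex Gamma).
Notation G := (artin_group Gamma).
Notation T := (bs_tree c d).
Notation bv := (@bvertex Gamma c d).
Notation rem := (removed c d).
Notation tact := (tact cd).
Notation A X := (@std_parabolic Gamma X).
Implicit Types (g h f : G) (x : T) (P Q : set G).
Context (S : {set V}) (H : set G).
Hypotheses (Hsub : subgroup H) (HS : H `<=` A S).
Hypothesis edge_complete : forall z z', orbit_edge cd S z z' ->
  exists2 P, complete_parabolic P & forall f, H f -> tact f z = z -> tact f z' = z' -> P f.

Let H1 : H 1. Proof. by have [] := Hsub. Qed.
Let HM g h : H g -> H h -> H (g * h). Proof. by have [_ M _] := Hsub; apply: (M). Qed.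
Let HV g : H g -> H g^-1. Proof. by have [_ _ M] := Hsub; apply: (M). Qed.
Let HX g n : H g -> H (g ^+ n). Proof. exact: subgroupX. Qed.

Notation iso g := (@tact_iso Gamma c d cd g).
Notation even g := (@tact_even Gamma c d cd ncd g).
Notation hyperbolic g := (forall x, tact g x <> x).
Notation tl g x := (@translation T (tact g) x).

Lemma hyp_dist y x n : hyperbolic y -> (0 < n)%N ->
  dist x (tact (y ^+ n) x) = ((@axis_dist T (tact y) x).*2 + n * tl y x)%N.
Proof. by move=> hy n0; rewrite tactX// (dist_iter (iso y) (even y) hy). Qed.

Lemma hyp_axis y m : hyperbolic y -> H y -> orbit_vertex cd S m -> exists b : T,
  [/\ orbit_vertex cd S b, (0 < tl y m)%N,
    forall n, dist b (tact (y ^+ n) b) = (n * tl y m)%N,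
    forall n, dist m (tact (y ^+ n) b) = (@axis_dist T (tact y) m + n * tl y m)%N &
    forall j n, (j <= n)%N -> (0 < n)%N ->
      between m (tact (y ^+ j) b) (tact (y ^+ n) m)].
Proof.
move=> hy Hy mS; have [b e1 e2] := axis_point (iso y) (even y) hy m.
exists b; split.
- apply: (orbit_convex ncd mS _ e2); apply: orbit_vertex_act => //; exact: HS.
- exact: (translation_gt0 (iso y) (even y) hy).
- by move=> n; rewrite tactX// (dist_axis_iter (iso y) (even y) hy e1 e2).
- by move=> n; rewrite tactX// (dist_axis (iso y) (even y) hy e1 e2).
- by move=> j n jn n0; rewrite !tactX//; apply: (axis_between (iso y) (even y) hy e1 e2).
Qed.

Lemma elliptic_orbit e : H e -> (exists x, tact e x = x) ->
  exists2 m, orbit_vertex cd S m & tact e m = m.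
Proof.
move=> He [x ex]; have := @elliptic_disp T (tact e) (iso e) x (bv false) ex.
move=> le; have [m [em dm]] := fixed_point (iso e) (even e) le.
have le2 : ((dist (bv false : T) (tact e (bv false)))./2 <= dist (bv false : T) (tact e (bv false)))%N by lia.
have [z dz bz] := dist_point le2.
exists z; last exact: (midpoint_fixed (iso e) (even e) le bz dz).
apply: (orbit_convex ncd _ _ bz); first exact: orbit_vertex_base.
by apply: orbit_vertex_act => //; [apply: HS|apply: orbit_vertex_base].
Qed.

(** If u sends m where a power of y does, and does not move it much farther when
    applied again, then u folds the segment from m to y^K m at its middle, and
    this segment contains most of the points y^j b of the axis. *)
Lemma reverse_start u y m b K j : let p := @axis_dist T (tact y) m in let l := tl y m in
  (forall n, dist m (tact (y ^+ n) b) = (p + n * l)%N) ->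
  (forall j n, (j <= n)%N -> (0 < n)%N -> between m (tact (y ^+ j) b) (tact (y ^+ n) m)) ->
  hyperbolic y -> tact u m = tact (y ^+ K) m -> (0 < K)%N -> (j <= K)%N ->
  (dist m (tact u (tact u m)) + (p + j * l).*2 <= dist m (tact u m) + dist m (tact u m))%N ->
  tact u (tact (y ^+ j) b) = tact (y ^+ (K - j)) b.
Proof.
move=> p l db bt hy um K0 jK le.
have D : dist m (tact u m) = (p.*2 + K * l)%N by rewrite um hyp_dist.
apply: (@fold_reverse T (tact u) (iso u) m _ _ (p + j * l)%N).
- exact: le.
- by rewrite D; nia.
- by rewrite um; apply: bt.
- exact: db.
- by rewrite um; apply: bt => //; apply: leq_subr.
- by rewrite D db; nia.
Qed.

Let J := #|V|.+2.
Context (a : nat) (aE : a = J.*2).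

Section Equations.
Context (h : G) (Hh : H h) (hyph : hyperbolic h).

Lemma hypV g : hyperbolic g -> hyperbolic g^-1.
Proof. by move=> hg x e; apply: (hg x); rewrite -{1}e tactVK. Qed.

Let u := h^-1.
Let Hu : H u. Proof. exact: HV. Qed.
Let hu : hyperbolic u. Proof. exact: hypV. Qed.

(** If e fixed a point m, then u^a = h^(-a) and y^k would agree at m.  Being
    hyperbolic, u^a reverses the segment from m to y^k m except for a part of
    bounded length in the middle; hence it reverses a long part of the axis of
    y, hence all of it, and fixes the point y^(k/2) b. *)
Lemma power_hyperbolic y e k x0 : H y -> H e -> e = h ^+ a * y ^+ k ->
  (a * tl u x0 + J.*2 <= k)%N -> ~~ odd k -> hyperbolic y -> hyperbolic e.
Proof.
move=> Hy He eE ka ke hy x ex.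
have [m mS em] := elliptic_orbit He (ex_intro _ x ex).
have [b [bS l0 ax db bt]] := hyp_axis hy Hy mS.
set p := axis_dist _ _ in db; set l := tl y m in l0 ax db.
pose f := (h ^+ a)^-1; have fE : f = u ^+ a by rewrite /f /u expVgn.
have fm : tact f m = tact (y ^+ k) m by rewrite -{1}em eE tactM// /f tactK.
have k0 : (0 < k)%N by move: ka; rewrite /J; lia.
have a0 : (0 < a)%N by rewrite aE /J; lia.
have lu : tl u m = tl u x0 by apply: (translation_const (iso u) (even u) hu).
have Df : dist m (tact f m) = ((@axis_dist T (tact u) m).*2 + a * tl u x0)%N by rewrite fE hyp_dist// lu.
have Df2 : dist m (tact f (tact f m)) = ((@axis_dist T (tact u) m).*2 + (a + a) * tl u x0)%N.
  by rewrite -tactM// fE -expgnDr hyp_dist// ?lu// addn_gt0 a0.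
have Dy : dist m (tact f m) = (p.*2 + k * l)%N by rewrite fm hyp_dist.
have flip j : (0 <= j <= 0 + J)%N -> tact f (tact (y ^+ j) b) = tact (y ^+ (k - j)) b.
  rewrite add0n => /andP[_ jJ]; apply: (reverse_start db bt hy fm k0).
    by apply: leq_trans jJ _; move: ka; lia.
  rewrite Df2 {1}Df Dy -/p -/l mulnDl.
  have : (a * tl u x0 + j.*2 <= k * l)%N by nia.
  have : (j * l <= J * l)%N by nia.
  move: ka l0 jJ; move: (a * _)%N => M; clear; nia.
have Hf : H f by apply/HV/HX.
have k2 : (k./2 <= k)%N by lia.
have Jk : (0 + J <= k)%N by rewrite add0n; move: ka; lia.
have := axis_flip hB ncd Hsub HS edge_complete Hy bS l0 ax Hf (leqnn _) Jk flip k2.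
have -> : (k - k./2 = k./2)%N by lia.
by rewrite fE (tactX cd ncd u); apply: (hyperbolic_iter (iso u) (even u) hu a0).
Qed.

(** At a fixed point m of e the element f = y^k, which is elliptic, sends m where
    u^a does; so f reverses the axis of u = h^-1, and e reverses it too.  Then
    e^2 fixes the axis, and z acts on it as h^a does. *)
Lemma elliptic_power_hyperbolic y e z k k' : H y -> H e -> e = h ^+ a * y ^+ k ->
  z = h ^+ a * e ^+ k' -> ~~ odd k' -> (exists x, tact y x = x) -> (exists x, tact e x = x) ->
  hyperbolic z.
Proof.
move=> Hy He eE zE k'e [x0 yx] eell.
have [m mS em] := elliptic_orbit He eell.
have [b [bS l0 ax db bt]] := hyp_axis hu Hu mS.
set p := axis_dist _ _ in db; set l := tl u m in l0 ax db.
pose f := y ^+ k; have fx : tact f x0 = x0.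
  by rewrite /f tactX//; elim: (k) => //= n ->.
have a0 : (0 < a)%N by rewrite aE /J; lia.
have uE : (h ^+ a)^-1 = u ^+ a by rewrite /u expVgn.
have fm : tact f m = tact (u ^+ a) m.
  by rewrite -uE -[m in RHS]em eE tactM// tactK.
have D : dist m (tact f m) = (p.*2 + a * l)%N by rewrite fm hyp_dist.
have D2 := @elliptic_disp T (tact f) (iso f) x0 m fx.
(* Starting the axis of u earlier makes all the relevant points u^j b' with j a natural number. *)
pose b' := tact (h ^+ a) b.
have ub n : tact (u ^+ (a + n)) b' = tact (u ^+ n) b.
  by rewrite addnC expgnDr tactM// -uE /b' tactK.
have b'S : orbit_vertex cd S b' by apply: orbit_vertex_act => //; exact: HS (HX a Hh).
have ax' n : dist b' (tact (u ^+ n) b') = (n * l)%N.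
  rewrite /b' -tactM//.
  have -> : u ^+ n * h ^+ a = h ^+ a * u ^+ n.
    have -> : h ^+ a = (u ^+ a)^-1 by rewrite -uE invgK.
    by apply: (mulgI (u ^+ a)); rewrite mulVKg mulgA -expgnDr addnC expgnDr mulgK.
  by rewrite (tactM cd ncd (h ^+ a) (u ^+ n)) tact_iso ax.
have flip j : (a <= j <= a + J)%N -> tact f (tact (u ^+ j) b') = tact (u ^+ (3 * a - j)) b'.
  move=> /andP[aj jJ]; have -> : j = (a + (j - a))%N by lia.
  have -> : (3 * a - (a + (j - a)) = a + (a - (j - a)))%N by rewrite aE; lia.
  rewrite !ub; apply: (reverse_start db bt hu fm a0).
    by move: jJ; rewrite aE; lia.
  move: D2; rewrite D -/p -/l.
  have : ((j - a) * l).*2 <= a * l by rewrite -mul2n mulnA leq_mul2r; apply/orP; right; move: jJ; rewrite aE; lia.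
  by lia.
have Hf : H f by apply: HX.
have all3 j : (j <= 3 * a)%N -> tact f (tact (u ^+ j) b') = tact (u ^+ (3 * a - j)) b'.
  have aJ : (a + J <= 3 * a)%N by rewrite aE; lia.
  exact: (axis_flip hB ncd Hsub HS edge_complete Hu b'S l0 ax' Hf (leqnn _) aJ flip).
have hub n : tact (h ^+ a) (tact (u ^+ (a + n)) b') = tact (u ^+ n) b'.
  by rewrite expgnDr tactM// -uE tactVK.
have eb j : (j <= 2 * a)%N -> tact e (tact (u ^+ j) b') = tact (u ^+ (2 * a - j)) b'.
  move=> ja; rewrite eE tactM// all3; last by lia.
  have -> : (3 * a - j = a + (2 * a - j))%N by lia.
  exact: hub.
have efix j : (j <= 2 * a)%N -> tact (e ^+ k') (tact (u ^+ j) b') = tact (u ^+ j) b'.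
  move=> ja; have -> : k' = (2 * k'./2)%N by lia.
  rewrite expgnA tactX//; elim: (_./2) => //= n ->.
  rewrite expg2 tactM// eb// eb; last by lia.
  by congr (tact (u ^+ _) b'); lia.
have za : tact z (tact (u ^+ (2 * a)) b') = tact (u ^+ a) b'.
  rewrite zE tactM// efix//; have -> : (2 * a = a + a)%N by lia.
  exact: hub.
have z0 : tact z (tact (u ^+ a) b') = b'.
  by rewrite zE tactM// efix; [have := hub 0; rewrite addn0 expg0 tact1|lia].
move=> x zx; have := @elliptic_disp T (tact z) (iso z) x (tact (u ^+ (2 * a)) b') zx.
rewrite za z0 distC ax'.
have -> : dist (tact (u ^+ (2 * a)) b') (tact (u ^+ a) b') = (a * l)%N.
  have -> : (2 * a = a + a)%N by lia.
  by rewrite expgnDr tactM// tact_iso distC ax'.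
nia.
Qed.

End Equations.

(** By [power_hyperbolic] and [elliptic_power_hyperbolic] all y_n are hyperbolic.
    Since y_(n+1) ^ k_n displaces the base vertex by at most C more than y_n
    does, and by at least k_n - 1 more than y_(n+1) does, displacements decrease. *)
Lemma solvable_elliptic : power_solvable H -> forall h, H h -> exists x, tact h x = x.
Proof.
move=> Hpow h Hh; apply: contrapT => nell.
have hyph : hyperbolic h by move=> x e; apply: nell; exists x.
pose x0 : T := bv false.
pose C := dist x0 (tact (h ^+ a)^-1 x0).
(* k_n is even, divisible by n!, and large enough both for the reversal and for the descent. *)
pose N := (a * tl h^-1 x0 + J.*2 + C + 2)%N.
pose k n := (2 * N * n`!)%N.
have [||y yP] := Hpow (fun _ => h ^+ a) k.
- by move=> _; apply: HX.
- move=> n; split; last by rewrite /k dvdn_mull.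
  by rewrite /k !muln_gt0 fact_gt0 /N; lia.
have kN n : (N <= k n)%N by rewrite /k; have := fact_gt0 n; nia.
have ke n : ~~ odd (k n) by rewrite /k !oddM.
have Hy n : H (y n) by have [] := yP n.
have yE n : y n = h ^+ a * y n.+1 ^+ k n by have [] := yP n.
have step n : hyperbolic (y n.+1) -> hyperbolic (y n).
  apply: (power_hyperbolic Hh hyph (Hy _) (Hy _) (yE n) (x0 := x0)) => //.
  by apply: leq_trans (kN n); rewrite /N; lia.
have ally n : hyperbolic (y n).
  have [h1|/existsNP [x1 /contrapT e1]] := pselect (hyperbolic (y n.+1)); first exact: step.
  have [h2|/existsNP [x2 /contrapT e2]] := pselect (hyperbolic (y n.+2)).
    exact: step (step _ h2).
  exact: (elliptic_power_hyperbolic Hh hyph (Hy _) (Hy _) (yE n.+1) (yE n) (ke _) (ex_intro _ _ e2) (ex_intro _ _ e1)).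
pose D n := dist x0 (tact (y n) x0).
have dec n : (D n.+1 < D n)%N.
  have k0 : (0 < k n)%N by have := kN n; rewrite /N; lia.
  have e1 := hyp_dist x0 (ally n.+1) k0.
  have e2 := @hyp_dist _ x0 1 (ally n.+1) isT; rewrite expg1 mul1n in e2.
  have l0 := translation_gt0 (iso (y n.+1)) (even (y n.+1)) (ally n.+1) x0.
  have tri := dist_triangle x0 (tact (h ^+ a)^-1 x0) (tact (y n.+1 ^+ k n) x0).
  have e3 : dist (tact (h ^+ a)^-1 x0) (tact (y n.+1 ^+ k n) x0) = D n.
    by rewrite /D (yE n) -[in RHS](tact_iso cd (h ^+ a)^-1) tactM// tactK.
  move: tri; rewrite e3 e1 -/C /D e2 => tri.
  have : (C + 2 <= k n)%N by apply: leq_trans (kN n); rewrite /N; lia.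
  move: tri l0; rewrite /D; nia.
have all_dec n : (D n + n <= D 0)%N.
  by elim: n => [|n IHn]; [rewrite addn0|have := dec n; lia].
by have := all_dec (D 0).+1; lia.
Qed.

End Elliptic.

(** By induction on S: edge stabilizers are controlled by the images of H under the
    retractions to smaller standard parabolic subgroups, which are again pure
    and power solvable.  So no element of H is hyperbolic. *)
Theorem power_solvable_complete (Gamma : artin_graph) (hB : class_B Gamma)
    (S : {set Gamma}) (H : set (artin_group Gamma)) :
  subgroup H -> H `<=` @pure Gamma -> H `<=` std_parabolic S -> power_solvable H ->
  exists2 P, complete_parabolic P & H `<=` P.
Proof.
have [n] := ubnP #|S|; elim: n S H => // n IHn S H Sn Hsub Hpure HS Hpow.
apply: elliptic_complete => // c d cd ncd.
have [cS|cS] := boolP (c \in S); last first.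
  move=> g /HS gS; exists (bvertex c d false); apply/(tact_bvertex cd ncd).
  by apply: std_vstab gS.
have [dS|dS] := boolP (d \in S); last first.
  move=> g /HS gS; exists (bvertex c d true); apply/(tact_bvertex cd ncd).
  by apply: std_vstab gS.
apply: (solvable_elliptic hB ncd Hsub HS _ erefl) => // z z' [g [i [gS -> ->]]].
pose X := S :\ removed c d i :\ removed c d (~~ i).
have [|||||P cP HP] := IHn X (local_image H X g).
- rewrite -ltnS; apply: leq_trans Sn; rewrite ltnS.
  apply: (@leq_ltn_trans #|S :\ removed c d i|); first by apply/subset_leq_card/subsetDl.
  by rewrite [X in (_ < X)%N](cardsD1 (removed c d i) S) (_ : removed c d i \in S)// /removed; case: (i).
- exact: local_image_subgroup.
- exact: local_image_pure.
- exact: local_image_std.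
- exact: local_image_power.
exists (conj_set g P); first exact: complete_conj.
move=> f Hf /(tact_fix cd ncd)/conj_setE fi /(tact_fix cd ncd)/conj_setE fj.
apply/conj_setE/HP; exists f => //; apply: retr_id.
apply: (@in_std_vstab _ c d (S :\ removed c d i) (~~ i)) => //.
apply: (@in_std_vstab _ c d S i) => //.
by apply: stdM => //; apply: stdM; [apply: stdV|apply: HS].
Qed.

(** * Torsion modulo pure elements *)

Section Congruences.
Context (Gamma : artin_graph).
Notation V := (vertex Gamma).
Notation G := (artin_group Gamma).
Notation C := (@congruence Gamma).
Implicit Types (g h v w : G).

Lemma congruenceJ r g h : C r h -> C r (g^-1 * h * g).
Proof.
move=> ch v iv; rewrite !actM; have := small_act g (ch _ (integral_act g^-1 iv)).
by rewrite GRing.linearB /= -[act g (act g^-1 v)]actM mulVg act1.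
Qed.

Lemma congruence0 g : C 0 g.
Proof.
move=> x ix; exists (act g x + (- x))%R; last by rewrite GRing.expr0 GRing.scale1r.
apply: integralD; first exact: integral_act.
by move=> t; rewrite ffunE; apply: inON.
Qed.

Lemma pure_congruence r g : pure g -> C r g.
Proof.
move=> pg; have [C1 _ _] := congruence_subgroup Gamma r.
by move=> v iv; rewrite pg; have := C1 v iv; rewrite act1.
Qed.

(** Congruence modulo the principal congruence subgroup of level 2^r. *)
Definition eqc r g h := C r (g^-1 * h).

Lemma eqcM r g g' h h' : eqc r g h -> eqc r g' h' -> eqc r (g * g') (h * h').
Proof.
rewrite /eqc => e e'; have [_ CM _] := congruence_subgroup Gamma r.
have -> : (g * g')^-1 * (h * h') = (g'^-1 * (g^-1 * h) * g') * (g'^-1 * h').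
  by rewrite invgM !mulgA mulgK.
by apply: (CM) => //; apply: congruenceJ.
Qed.

Lemma eqc_refl r g : eqc r g g.
Proof. by rewrite /eqc mulVg; have [] := congruence_subgroup Gamma r. Qed.

Lemma eqcX r g h n : eqc r g h -> eqc r (g ^+ n) (h ^+ n).
Proof.
by move=> e; elim: n => [|n IHn]; rewrite ?expg0 ?expgS; [exact: eqc_refl|exact: eqcM].
Qed.

Lemma eqc_trans r g h w : eqc r g h -> eqc r h w -> eqc r g w.
Proof.
move=> e1 e2; have [_ CM _] := congruence_subgroup Gamma r.
by have := CM _ _ e1 e2; rewrite !mulgA mulgK.
Qed.

Lemma eqc_sym r g h : eqc r g h -> eqc r h g.
Proof.
move=> e; have [_ _ CV] := congruence_subgroup Gamma r.
by have := CV _ e; rewrite invgM invgK.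
Qed.

Lemma congruence_pow2 r v : C 1 v -> C r.+1 (v ^+ (2 ^ r)).
Proof.
move=> cv; elim: r => [|r IHr]; first by rewrite expg1.
by rewrite expnSr expgnA; apply: congruence_sqr.
Qed.

(** Modulo 2^r the order of v divides a power of 2 by [congruence_pow2], while a
    difference of exponents, which is odd, annihilates v. *)
Lemma eqc_odd_even r v m n : C 1 v -> odd m -> ~~ odd n -> eqc r (v ^+ m) (v ^+ n) -> C r v.
Proof.
case: r => [|r] cv om en e.
  exact: congruence0.
have [C1 CM CV] := congruence_subgroup Gamma r.+1.
have [q oq cq] : exists2 q, odd q & C r.+1 (v ^+ q).
  have [mn|nm] := leqP m n.
    exists (n - m)%N; first by rewrite oddB// om (negbTE en).
    by move: e; rewrite /eqc -{1}(subnKC mn) expgnDr mulKg.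
  exists (m - n)%N; first by rewrite oddB ?(ltnW nm)// om (negbTE en).
  by move: (eqc_sym e); rewrite /eqc -{1}(subnKC (ltnW nm)) expgnDr mulKg.
have q0 : (0 < q)%N by case: q oq {cq}.
have cop : coprime q (2 ^ r) by rewrite coprimeXr// coprimen2.
have [a b ab _] := egcdnP (2 ^ r) q0.
have := congruence_pow2 r cv => c2.
have : v ^+ (a * q) = v ^+ (b * 2 ^ r) * v by rewrite ab (eqP cop) addn1 expgSr.
rewrite [(a * q)%N]mulnC [(b * _)%N]mulnC !expgnA => e1.
have -> : v = ((v ^+ (2 ^ r)) ^+ b)^-1 * (v ^+ q) ^+ a by rewrite e1 mulKg.
have Hs := congruence_subgroup Gamma r.+1.
by apply: (CM); [apply: (CV)|]; apply: (@subgroupX _ (C r.+1)).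
Qed.

End Congruences.

Lemma no_cantor_injection (f : (nat -> bool) -> nat) : ~ injective f.
Proof.
move=> fi; pose D n := ~~ `[< exists2 e, f e = n & e n >].
have [|] := boolP (D (f D)) => h.
  by case/negP: (h); apply/asboolP; exists D.
by move: (h); rewrite /D negbK => /asboolP [e /fi -> ]; apply/negP.
Qed.

Lemma power_elliptic (Gamma : artin_graph) (P : set (artin_group Gamma)) c d (cd : c != d)
    (g : artin_group Gamma) n : [set c; d]%SET \notin edges Gamma ->
  complete_parabolic P -> (0 < n)%N -> P (g ^+ n) -> exists x : bs_point c d, tact cd g x = x.
Proof.
move=> ncd [h [X [Xf ->]]] n0 Pn; apply: contrapT => nell.
have hyp x : tact cd g x <> x by move=> e; apply: nell; exists x.
have [i Xi] : exists i, removed c d i \notin X.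
  have [cX|] := boolP (c \in X); last by exists false.
  by exists true; apply/negP => dX; move: ncd; rewrite (Xf _ _ cX dX cd).
have sub : std_parabolic X `<=` vstab c d i by move=> x; apply: std_vstab.
have /(conj_setS sub) /(tact_fix cd ncd) := Pn; rewrite tactX//.
exact: (hyperbolic_iter (tact_iso cd g) (tact_even cd ncd g) hyp n0).
Qed.

Section PowerSolvable.
Context (Gamma : artin_graph) (hB : class_B Gamma).
Notation V := (vertex Gamma).
Notation G := (artin_group Gamma).
Notation C := (@congruence Gamma).
Context (M : set G).
Hypotheses (Msub : subgroup M) (Mpow : power_solvable M).

Lemma exponent_dvd r : exists N, forall n k (g : G), (N <= n)%N -> (n`! %| k)%N -> C r (g ^+ k).
Proof.
have [B B0 BP] := congruence_exponent Gamma r; exists B => n k g Bn /dvdnP [q ->].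
have /dvdnP [p ->] : (B %| n`!)%N by apply: dvdn_fact; rewrite B0.
by rewrite mulnA mulnC expgnA; exact: (@subgroupX _ (C r) _ _ (congruence_subgroup Gamma r) (BP g)).
Qed.

(** A solution in M is automatically pure: modulo 2^r the powers y_(n+1) ^ k_n vanish
    for n large, and then one descends. *)
Lemma pure_part_power : power_solvable (M `&` @pure Gamma).
Proof.
move=> h k Mh kP; have [|y yP] := Mpow _ kP (h := h); first by move=> n; case: (Mh n).
exists y => n; have [My yE] := yP n; split=> //; split=> //.
apply: congruence_pure => r; have [N NP] := exponent_dvd r.
have [_ CM _] := congruence_subgroup Gamma r.
have big m : (N <= m)%N -> C r (y m).
  move=> Nm; have [_ ->] := yP m; apply: (CM); first by apply: pure_congruence; case: (Mh m).
  by apply: NP Nm _; have [] := kP m.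
suff down j m : C r (y (m + j)%N) -> C r (y m) by apply: (down N); apply: big; lia.
elim: j m => [|j IHj] m; first by rewrite addn0.
rewrite addnS -addSn => /IHj c1; have [_ ->] := yP m; apply: (CM).
  by apply: pure_congruence; case: (Mh m).
exact: (@subgroupX _ (C r) _ _ (congruence_subgroup Gamma r) c1).
Qed.

Let k n := (2 * n`!)%N.
Let k_ok n : (0 < k n)%N /\ (n`! %| k n)%N.
Proof. by split; [rewrite muln_gt0 fact_gt0|apply: dvdn_mull]. Qed.

(** The exponent e_n + k_n (e_(n+1) + k_(n+1) (...)) truncated after m terms. *)
Fixpoint horner_exp (e : nat -> bool) n m : nat :=
  if m is m'.+1 then (e n + k n * horner_exp e n.+1 m')%N else 0%N.

Lemma horner_expS e n m : horner_exp e n m.+1 = (e n + k n * horner_exp e n.+1 m)%N.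
Proof. by []. Qed.

Lemma horner_agree e e' j n m : (forall i, (i < j)%N -> e (n + i)%N = e' (n + i)%N) -> 
  exists s u, horner_exp e n (j + m) = (s + u * horner_exp e (n + j) m)%N /\
    horner_exp e' n (j + m) = (s + u * horner_exp e' (n + j) m)%N /\ (0 < u)%N /\
    u = (\prod_(i < j) k (n + i))%N.
Proof.
elim: j n => [|j IHj] n agree.
  by exists 0%N, 1%N; rewrite !mul1n !addn0 big_ord0.
have [|s [u [e1 [e2 [u0 uE]]]]] := IHj n.+1; first by move=> i ij; rewrite addSnnS; apply: agree.
exists (e n + k n * s)%N, (k n * u)%N; rewrite !addSn /= e1 e2 -[n.+1 + j]/(n + j).+1 -addnS.
have e0 : e n = e' n by have := agree 0%N isT; rewrite addn0.
split; first by rewrite mulnDr mulnA addnA.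
split; first by rewrite e0 mulnDr mulnA addnA.
split.
- by rewrite muln_gt0 u0 andbT; have [] := k_ok n.
- by rewrite big_ord_recl addn0 uE; congr (_ * _)%N; apply: eq_bigr => i _; rewrite /= addSnnS.
Qed.

(** Modulo 2^r the solution y_0 is the power of w with exponent [horner_exp e 0 m], m large.
    Two sequences e with the same y_0, which first differ at j, give
    congruent powers of w ^ (k_0 ... k_(j-1)), one with an odd and one with an
    even exponent. *)
Lemma power_pure w : M w -> exists2 n, (0 < n)%N & pure (w ^+ n).
Proof.
move=> Mw.
have ex (e : nat -> bool) : exists y, forall n, M (y n) /\ y n = w ^+ e n * y n.+1 ^+ k n.
  by apply: Mpow => // n; apply: subgroupX.
have [Y YP] := boolp.choice ex.
have [e [e' [ne E]]] : exists e e', e <> e' /\ Y e 0%N = Y e' 0%N.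
  apply: contrapT => h; apply: (@no_cantor_injection (fun e => code (Y e 0%N))).
  move=> e e' /code_inj E; apply: contrapT => ne; apply: h; by exists e, e'.
have [j [dj aj]] : exists j, e j <> e' j /\ forall i, (i < j)%N -> e i = e' i.
  have exj : exists j, e j != e' j.
    apply: contrapT => h; apply: ne; apply/funext => i; apply/eqP.
    by apply: contrapT => /negP ei; apply: h; exists i.
  case: (ex_minnP exj) => j /eqP dj min; exists j; split=> // i ij.
  by apply/eqP; apply: contrapT => /negP /min; rewrite leqNgt ij.
wlog ej : e e' ne E dj aj / e j.
  move=> th; case ej: (e j); first exact: (th e e').
  apply: (th e' e) => //; [by move=> /esym|by move=> /esym|by move=> i /aj ->|].
  by case: (e' j) dj ej => // ->.
have e'j : e' j = false by case: (e' j) dj => //; rewrite ej.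
have [B1 B10 B1P] := congruence_exponent Gamma 1.
pose u := (\prod_(i < j) k (0 + i))%N.
have u0 : (0 < u)%N by rewrite /u prodn_gt0// => i; have [] := k_ok (0 + i).
(* The factor B1 brings w into the congruence subgroup of level 2, as [eqc_odd_even] demands. *)
exists (u * B1)%N; first by rewrite muln_gt0 u0.
apply: congruence_pure => r; have [N NP] := exponent_dvd r.
have approx (e0 : nat -> bool) m n : (N <= n + m)%N -> eqc r (Y e0 n) (w ^+ horner_exp e0 n m.+1).
  elim: m n => [|m IHm] n Nn.
    have [_ ->] := YP e0 n; rewrite /= muln0 addn0 -[X in eqc _ _ X]mulg1; apply: eqcM; first exact: eqc_refl.
    apply: eqc_sym; rewrite /eqc invg1 mul1g; apply: NP (_ : (N <= n)%N) _; last by have [] := k_ok n.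
    by rewrite addn0 in Nn.
  have [_ ->] := YP e0 n; rewrite horner_expS (expgnDr w (e0 n)); apply: eqcM; first exact: eqc_refl.
  rewrite [(k n * _)%N]mulnC expgnA; apply: eqcX.
  by have := IHm n.+1; rewrite addSnnS => /(_ Nn).
have c0 := approx e (j + N)%N 0%N (leq_addl _ _).
have c1 := approx e' (j + N)%N 0%N (leq_addl _ _).
rewrite -E in c1; have {c0 c1} := eqc_trans (eqc_sym c0) c1.
have [|s [u' [e1 [e2 [_ u'E]]]]] := @horner_agree e e' j 0 N.+1; first by move=> i; rewrite add0n; apply: aj.
rewrite -addnS e1 e2 !expgnDr => ec.
have {}ec : eqc r (w ^+ (u * horner_exp e (0 + j) N.+1)) (w ^+ (u * horner_exp e' (0 + j) N.+1)).
  have := eqcM (eqc_refl r (w ^+ s)^-1) ec; rewrite !mulKg; by rewrite /u -u'E.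
apply: (@eqc_odd_even _ r _ (horner_exp e (0 + j) N.+1) (horner_exp e' (0 + j) N.+1)).
- by rewrite expgnA; apply: B1P.
- by rewrite /= add0n ej oddD oddM /k oddM.
- by rewrite /= add0n e'j oddD oddM /k oddM.
- rewrite mulnC !expgnA -!(expgnA (w ^+ B1)) -!(expgnA w) ![(B1 * _)%N]mulnC !(expgnA w _ B1).
  exact: eqcX.
Qed.

(** The pure part of M lies in a complete parabolic subgroup, so all its elements
    are elliptic on all trees; elements of M have powers there, and a power of a
    hyperbolic isometry is hyperbolic. *)
Theorem power_solvable_parabolic : exists2 P, complete_parabolic P & M `<=` P.
Proof.
have Hsub : subgroup (M `&` @pure Gamma) by apply: subgroupI => //; apply: pure_subgroup.
have [||P cP HP] := @power_solvable_complete Gamma hB [set: V]%SET _ Hsub _ _ pure_part_power.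
- exact: subIsetr.
- by move=> x _; apply: std_setT.
apply: elliptic_complete => // c d cd ncd g Mg; have [n n0 pn] := power_pure Mg.
apply: (power_elliptic cd ncd cP n0); apply: HP; split=> //; exact: subgroupX.
Qed.

End PowerSolvable.

(** * Topological groups *)

Section TopologicalGroups.
Local Open Scope quotient_scope.
Local Open Scope group_scope.
Context (L : topologicalGroupType).
Implicit Types (a x y z : L) (A B N U : set L).

Lemma mulg_cvg {I} (F : set_system I) {FF : Filter F} (f g : I -> L) a b :
  f @ F --> a -> g @ F --> b -> (fun i => f i * g i) @ F --> a * b.
Proof.
move=> fa gb; apply: (@cvg_comp _ _ _ (fun i => (f i, g i)) (fun p : L * L => p.1 * p.2) F (nbhs (a, b)));
  first exact: cvg_pair.
exact: (@mulg_continuous L (a, b)).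
Qed.

Lemma expg_cvg {I} (F : set_system I) {FF : Filter F} (f : I -> L) a k :
  f @ F --> a -> (fun i => f i ^+ k) @ F --> a ^+ k.
Proof.
move=> fa; elim: k => [|k IHk].
  rewrite expg0 (_ : (fun i => _) = fun=> 1); first exact: cvg_cst.
  by apply/funext => i; rewrite expg0.
rewrite expgS (_ : (fun i => _) = fun i => f i * f i ^+ k); first exact: mulg_cvg.
by apply/funext => i; rewrite expgS.
Qed.

Lemma nbhs_mulgl a x B : nbhs (a * x) B -> nbhs x [set y | B (a * y)].
Proof. by move=> h; exact: (@mulgl_continuous L a x _ h). Qed.

Lemma subgroup_open H x : subgroup H -> nbhs x H -> open H.
Proof.
move=> [H1 HM HV] Hx; rewrite openE => h Hh.
have Hx' := nbhs_singleton Hx.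
have e : x = (x * h^-1) * h by rewrite mulgVK.
rewrite e in Hx; apply: filterS (nbhs_mulgl Hx) => y /= Hy.
rewrite -[y](mulKg (x * h^-1)); apply: (HM) => //; apply: (HV); apply: (HM) => //.
exact: HV.
Qed.

Lemma closure_subgroup N : subgroup N -> subgroup (closure N).
Proof.
move=> [N1 NM NV]; split; first exact: subset_closure.
- move=> x y Nx Ny B Bxy.
  have [[U W] [/= Ux Wy] UW] := @mulg_continuous L (x, y) B Bxy.
  have [a [Na Ua]] := Nx _ Ux; have [b [Nb Wb]] := Ny _ Wy.
  by exists (a * b); split; [apply: (NM)|apply: (UW (a, b))].
- move=> x Nx B Bx; have [a [Na Ba]] := Nx _ (@invg_continuous L x B Bx).
  by exists a^-1; split; [apply: (NV)|].
Qed.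

Hypothesis lch : locally_compact_hausdorff L.

Lemma compact_nbhs x : exists2 K : set L, nbhs x K & compact K.
Proof.
have [K] := lch.1 x I; rewrite withinET => xK [cK _].
by exists K.
Qed.

Lemma regular x B : nbhs x B -> exists2 U, nbhs x U & closure U `<=` B.
Proof.
have [K xK cK] := compact_nbhs x => xB.
by have [U xU UB] := compact_regular lch.2 cK xK xB; exists U.
Qed.

(** The usual proof: nested open sets avoiding the C_n one after the other, within
    a compact set, which has a cluster point. *)
Lemma baire (C : nat -> set L) : (forall n, closed (C n)) -> \bigcup_n C n = setT ->
  exists n, (C n)^° !=set0.
Proof.
move=> cC cov; apply: contrapT => hC.
have emp n x : ~ nbhs x (C n) by move=> xC; apply: hC; exists n, x.
have step n (O : set L) : exists O', open O /\ O !=set0 ->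
    [/\ open O', O' !=set0 & closure O' `<=` O `\` C n].
  have [[oO [x Ox]]|h] := pselect (open O /\ O !=set0); last by exists O => /h.
  have [y [Oy nCy]] : exists y, O y /\ ~ C n y.
    apply: contrapT => h; apply: (emp n x).
    apply: filterS (open_nbhs_nbhs (conj oO Ox)) => y Oy.
    by apply: contrapT => nC; apply: h; exists y.
  have oOC : open (O `\` C n) by rewrite setDE; apply: openI => //; exact: closed_openC.
  have [U yU UO] := regular (open_nbhs_nbhs (conj oOC (conj Oy nCy))).
  exists (U^°) => _; split; first exact: open_interior.
    by exists y.
  by apply: subset_trans UO; apply: closureS; apply: interior_subset.
have [f fP] := boolp.choice (fun nO : nat * set L => step nO.1 nO.2).
have [K xK cK] := compact_nbhs 1.
pose O := fix O n := if n is m.+1 then f (m, O m) else K^°.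
have OP n : open (O n) /\ O n !=set0.
  elim: n => [|n IHn] /=; first by split; [exact: open_interior|exists 1].
  by have [] := fP (n, O n) IHn.
have clO n : closure (O n.+1) `<=` O n `\` C n by have [] := fP (n, O n) (OP n).
have decO n m : (n <= m)%N -> O m `<=` O n.
  move=> /subnKC <-; elim: (m - n)%N => [|k IHk]; first by rewrite addn0.
  by rewrite addnS => x /subset_closure /clO [/IHk].
pose F := [set A | exists n, O n `<=` A].
have FP : ProperFilter F.
  apply: Build_ProperFilter_ex.
    by move=> A [n OA]; have [_ [x Ox]] := OP n; exists x; apply: OA.
  split; first by exists 0%N.
  - move=> A B [n nA] [m mB]; exists (maxn n m) => x Ox; split.
      by apply/nA/(decO _ _ (leq_maxl n m)).
    by apply/mB/(decO _ _ (leq_maxr n m)).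
  - by move=> A B AB [n nA]; exists n; apply: subset_trans AB.
have FK : F K by exists 0%N; apply: interior_subset.
have [p [_ pF]] := cK F FP FK.
have clp n : closure (O n) p by move=> B pB; apply: pF => //; exists n.
have : [set: L] p by []; rewrite -cov => -[n _ Cp].
by have [_] := clO n p (clp n.+1).
Qed.

Section Equations.
Local Open Scope quotient_scope.
Local Open Scope group_scope.
Context (k : nat -> nat).

(** The product x_n (x_(n+1) (x_(n+2) ...)^k_(n+1))^k_n, ended by t after m steps. *)
Fixpoint nested (x : nat -> L) n m t : L :=
  if m is m'.+1 then x n * nested x n.+1 m' t ^+ k n else t.

Lemma nested_last (x : nat -> L) n m t :
  nested x n m.+1 t = nested x n m (x (n + m)%N * t ^+ k (n + m)).
Proof.
elim: m n => [|m IHm] n; first by rewrite /= addn0.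
by rewrite -[LHS]/(x n * nested x n.+1 m.+1 t ^+ k n) IHm addSnnS.
Qed.

Lemma nested_ext (x x' : nat -> L) n m t : (forall i, (n <= i < n + m)%N -> x i = x' i) ->
  nested x n m t = nested x' n m t.
Proof.
elim: m n => //= m IHm n e; rewrite e; last by rewrite leqnn addnS leq_addr.
by rewrite IHm// => i /andP[ni im]; apply: e; lia.
Qed.

Lemma nested_continuous (x : nat -> L) n m : continuous (nested x n m).
Proof.
elim: m n => [|m IHm] n t /=; first exact: cvg_id.
by apply: mulg_cvg; [exact: cvg_cst|apply: expg_cvg; apply: IHm].
Qed.

Lemma nbhs_forall_le (x : L) (P : nat -> set L) m :
  (forall n, (n <= m)%N -> nbhs x (P n)) -> nbhs x [set t | forall n, (n <= m)%N -> P n t].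
Proof.
elim: m => [|m IHm] h.
  by apply: filterS (h 0%N isT) => t P0 [].
have h1 : nbhs x [set t | forall n, (n <= m)%N -> P n t] by apply: IHm => n nm; apply: h; lia.
apply: filterS (filterI h1 (h m.+1 (leqnn _))) => t [Pt Pm] n.
by rewrite leq_eqVlt => /orP[/eqP ->|]; [|rewrite ltnS; apply: Pt].
Qed.

Lemma ultra_fmap {I J : Type} (F : set_system I) (f : I -> J) :
  UltraFilter F -> UltraFilter (f @ F).
Proof.
move=> FU; split=> [|G PG sub]; first exact: fmap_proper_filter.
apply/seteqP; split=> // A GA.
have [//|FnA] := in_ultra_setVsetC (f @^-1` A) FU.
have /sub GnA : (f @ F) (~` A) by [].
exfalso; apply: (@filter_not_empty _ G PG).
by rewrite -(setICr A); apply: filterI.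
Qed.

(** Choose the x_n one after the other, so close to 1 that all the finitely many
    nested products considered so far stay in the interior of K; this is possible
    as the products depend continuously on their last entry.  Along an
    ultrafilter the products converge in K, and the limits solve the system. *)
Lemma solve_nested (X : nat -> set L) (K : set L) : compact K -> nbhs 1 K ->
  (forall n, closure (X n) 1) ->
  exists x y : nat -> L, forall n, [/\ X n (x n), K (y n) & y n = x n * y n.+1 ^+ k n].
Proof.
move=> cK K1 X1.
pose inv (s : seq L) := (forall n, (n <= size s)%N -> K^° (nested (nth 1 s) n (size s - n) 1)) /\
  (forall n, (n < size s)%N -> X n (nth 1 s n)).
have step (s : seq L) : exists a, inv s -> inv (rcons s a).
  have [ivs|] := pselect (inv s); last by exists 1.
  have [is1 is2] := ivs; set m := size s.
  have nb : nbhs 1 [set t | forall n, (n <= m)%N -> K^° (nested (nth 1 s) n (m - n) t)].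
    apply: nbhs_forall_le => n nm; apply: (nested_continuous (x := nth 1 s)).
    by apply: nbhs_interior; apply: is1.
  have [a [Xa Ka]] := X1 m _ nb; exists a => _; split=> n; rewrite size_rcons -/m.
    rewrite leq_eqVlt => /orP[/eqP ->|nm].
      by rewrite subnn /=; apply: nbhs_singleton; apply: nbhs_interior.
    have -> : (m.+1 - n = (m - n).+1)%N by lia.
    rewrite nested_last; have -> : (n + (m - n) = m)%N by lia.
    rewrite nth_rcons ltnn eqxx expg1n mulg1.
    rewrite (@nested_ext _ (nth 1 s)); first by apply: Ka.
    by move=> i /andP[_ im]; rewrite nth_rcons (_ : (i < size s)%N)//; lia.
  rewrite ltnS leq_eqVlt => /orP[/eqP ->|nm]; first by rewrite nth_rcons ltnn eqxx.
  by rewrite nth_rcons nm; apply: is2.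
have [f fP] := boolp.choice step.
pose S := fix S n := if n is m.+1 then rcons (S m) (f (S m)) else [::].
have szS n : size (S n) = n by elim: n => //= n IHn; rewrite size_rcons IHn.
have invS n : inv (S n).
  elim: n => [|n IHn]; last exact: fP.
  by split=> [[|n] // _|n //]; exact: K1.
pose x n := f (S n).
have nthS n i : (i < n)%N -> nth 1 (S n) i = x i.
  elim: n => // n IHn; rewrite ltnS leq_eqVlt => /orP[/eqP ->|ni] /=.
    by rewrite nth_rcons szS ltnn eqxx.
  by rewrite nth_rcons szS ni IHn.
have Xx n : X n (x n).
  by have [_ h] := invS n.+1; have := h n; rewrite szS nthS//; apply.
pose Y n m := nested x n (m - n) 1.
have KY n m : (n <= m)%N -> K (Y n m).
  move=> nm; have [h _] := invS m; have := h n; rewrite szS => /(_ nm) /interior_subset.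
  rewrite (@nested_ext _ x)// => i /andP[_ im]; apply: nthS; lia.
have [U [UU ooU]] := ultraFilterLemma eventually_filter.
have lim n : exists y, K y /\ Y n @ U --> y.
  have UK : (Y n @ U) K by apply: ooU; exists n => // m /= /KY.
  move: cK; rewrite compact_ultra => /(_ _ (ultra_fmap (Y n) UU) UK) [y [Ky cy]].
  by exists y.
have [y yP] := boolp.choice lim.
exists x, y => n; split=> //; first by have [] := yP n.
have [_ cy] := yP n; have [_ cy1] := yP n.+1.
have PU : ProperFilter U by exact: ultra_proper.
have c2 : (fun m => x n * Y n.+1 m ^+ k n) @ U --> x n * y n.+1 ^+ k n.
  by apply: mulg_cvg; [exact: cvg_cst|exact: expg_cvg].
apply: (cvg_unique lch.2 cy (F := Y n @ U)); apply: cvg_trans c2.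
apply: near_eq_cvg; apply: ooU; exists n.+1 => // m /= nm.
by rewrite /Y; have -> : (m - n = (m - n.+1).+1)%N by lia.
Qed.

End Equations.

Section CountableImage.
Local Open Scope quotient_scope.
Local Open Scope group_scope.
Context (G : groupType) (code : G -> nat) (psi : UMagmaMorphism.type L G).
Hypothesis code_inj : injective code.

Definition kernel : set L := [set x | psi x = 1].
Definition kernel_closure : set L := closure kernel.

Lemma psiV x : psi x^-1 = (psi x)^-1.
Proof. by apply: (mulgI (psi x)); rewrite -gmulfM !mulgV gmulf1. Qed.

Lemma kernel_subgroup : subgroup kernel.
Proof.
rewrite /kernel; split=> /=; first exact: gmulf1.
- by move=> x y ex ey; rewrite gmulfM ex ey mulg1.
- by move=> x ex; rewrite psiV ex invg1.
Qed.

Lemma kernel_closure_subgroup : subgroup kernel_closure.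
Proof. exact/closure_subgroup/kernel_subgroup. Qed.

(** Countably many translates of the closure of the kernel cover L. *)
Lemma kernel_closure_open : open kernel_closure.
Proof.
pose D n : set L := [set x | code (psi x) = n].
have [||n [x xD]] := @baire (fun n => closure (D n)).
- by move=> n; apply: closed_closure.
- by apply/seteqP; split=> // x _; exists (code (psi x)) => //; apply: subset_closure.
have [a [Da _]] := nbhs_singleton xD _ (filterT : nbhs x setT).
have e : x = a * (a^-1 * x) by rewrite mulVKg.
apply: (@subgroup_open _ (a^-1 * x)); first exact: kernel_closure_subgroup.
rewrite /interior e in xD; apply: filterS (nbhs_mulgl xD) => y /= Dy B yB.
have aB : nbhs (a * y) [set w | B (a^-1 * w)] by apply: nbhs_mulgl; rewrite mulKg.
have [z [Dz Bz]] := Dy _ aB.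
exists (a^-1 * z); split=> //=; rewrite /kernel /= gmulfM psiV.
have -> : psi z = psi a by apply: code_inj; rewrite Dz Da.
by rewrite mulVg.
Qed.

(** An element h of M is the image of elements of L arbitrarily close to 1, since
    the kernel is dense in its closure. *)
Lemma image_power_solvable : power_solvable (psi @` kernel_closure).
Proof.
move=> h k Mh kP; have [H1 HM HV] := kernel_closure_subgroup.
have [K K1 cK] := compact_nbhs 1.
have cK' : compact (K `&` kernel_closure).
  by apply: compact_closedI => //; apply: closed_closure.
have K1' : nbhs 1 (K `&` kernel_closure).
  by apply: filterI => //; apply: open_nbhs_nbhs; split=> //; apply: kernel_closure_open.
have [|x [y xyP]] := @solve_nested k (fun n => [set x | psi x = h n]) _ cK' K1'.
  move=> n B B1; have [a La ea] := Mh n.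
  have e : 1 = a * a^-1 by rewrite mulgV.
  rewrite e in B1; have [b [Nb Bb]] := HV _ La _ (nbhs_mulgl B1).
  by exists (a * b); split=> //=; rewrite gmulfM Nb mulg1.
exists (fun n => psi (y n)) => n; have [Xn [_ Ky] yE] := xyP n.
by split; [exists (y n)|rewrite {1}yE gmulfM gmulfXn Xn].
Qed.

Lemma image_subgroup H : subgroup H -> subgroup (psi @` H).
Proof.
move=> [H1 HM HV]; split; first by exists 1 => //; apply: gmulf1.
- by move=> _ _ [x Hx <-] [y Hy <-]; exists (x * y); [apply: (HM)|apply: gmulfM].
- by move=> _ [x Hx <-]; exists x^-1; [apply: (HV)|apply: psiV].
Qed.

End CountableImage.

(** H is closed as well as open, hence contains the identity component.  The images of
    the powers of g in the compact quotient cluster at some coset, so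
    two of them lie in the same coset of H. *)
Lemma almost_connected_power (H : set L) : almost_connected L -> subgroup H -> open H ->
  forall g, exists2 n, (0 < n)%N & H (g ^+ n).
Proof.
move=> ac [H1 HM HV] oH g.
have cH : closed H.
  rewrite -[H]setCK; apply: open_closedC; rewrite openE => x nHx.
  have e : x = x * 1 by rewrite mulg1.
  have xH : nbhs x [set y | H (x^-1 * y)].
    by apply: nbhs_mulgl; rewrite mulVg; apply: open_nbhs_nbhs.
  apply: filterS xH => y /= Hxy Hy; apply: nHx.
  by rewrite -[x]invgK -[x^-1](mulgK y); apply: (HV); apply: (HM) => //; apply: (HV).
have cpH : @id_component L `<=` H.
  move=> x [C [C1 _ cC] Cx].
  have sep : separated H (~` H) by apply/clopen_separatedP.
  have CU : C `<=` H `|` ~` H by move=> y _; have [|] := pselect (H y); [left|right].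
  by have [CH|CH] := connected_subset sep CU cC; [exact: CH|have := CH _ C1].
pose Q := quotient_topology {eq_quot (id_component_equiv L)}.
have piH x y : \pi_Q x = \pi_Q y -> H (x^-1 * y).
  move=> /(@eqmodP _ (id_component_equiv L)); rewrite /= /id_component_rel.
  by move=> /set_mem /cpH.
pose F := (fun n => \pi_Q (g ^+ n)) @ \oo.
have PF : ProperFilter F by exact: fmap_proper_filter.
have [p [_ pF]] := ac F PF filterT.
pose x := repr p; pose U : set Q := [set q | H (x^-1 * repr q)].
have HU y : U (\pi_Q y) <-> H (x^-1 * y).
  have e : H ((repr (\pi_Q y))^-1 * y) by apply: piH; rewrite reprK.
  split=> h; first by have := HM _ _ h e; rewrite !mulgA mulgK.
  by have := HM _ _ h (HV _ e); rewrite invgM invgK !mulgA mulgK.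
have pU : nbhs (p : Q) U.
  apply: open_nbhs_nbhs; split; last by rewrite /U /= mulVg.
  rewrite /open /= /quotient_open openE => y /HU hy.
  have e : x^-1 * y = x^-1 * y * 1 by rewrite mulg1.
  have yH : nbhs y [set z | H (x^-1 * z)].
    by apply: nbhs_mulgl; apply: open_nbhs_nbhs.
  by apply: filterS yH => z hz; apply/HU.
have hit n : exists2 m, (n <= m)%N & H (x^-1 * g ^+ m).
  have Fn : F [set q | exists2 m, (n <= m)%N & q = \pi_Q (g ^+ m)].
    by exists n => // m /= nm; exists m.
  by have [_ [[m nm ->] /HU hm]] := pF _ _ Fn pU; exists m.
have [n _ hn] := hit 0%N; have [m nm hm] := hit n.+1.
exists (m - n)%N; first by lia.
have := HM _ _ (HV _ hn) hm; rewrite invgM invgK -mulgA mulVKg.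
by rewrite -{1}(subnKC (ltnW nm)) expgnDr mulKg.
Qed.

End TopologicalGroups.

(** * Homomorphisms from locally compact groups *)

Section SubgroupTopology.
Context (L : topologicalGroupType) (A : set L) (Agc : group_closed (mem A)).

(** The proof that A is a subgroup is kept as an argument, for it determines the
    group structure on this type. *)
Definition topological_subgroup : Type := let _ := Agc in {x : L | x \in A}.
HB.instance Definition _ := SubChoice.on topological_subgroup.
HB.instance Definition _ := SubChoice_isSubGroup.Build L _ topological_subgroup Agc.
HB.instance Definition _ :=
  Topological.copy topological_subgroup (initial_topology (val : topological_subgroup -> L)).

Lemma val_continuous : continuous (val : topological_subgroup -> L).
Proof. exact: (@initial_continuous topological_subgroup L val). Qed.

Lemma topsub_cvg (I : Type) (F : set_system I) (f : I -> topological_subgroup) (a : topological_subgroup) : Filter F ->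
  (val \o f) @ F --> val a -> f @ F --> a.
Proof.
move=> FF vf B [_ [[O oO <-] Oa] OB].
have : nbhs (val a) O by apply: open_nbhs_nbhs.
by move=> /vf FO; apply: (@filterS _ F FF _ _ _ FO) => i Oi; apply: OB.
Qed.

Lemma topsub_mulg : continuous (fun p : topological_subgroup * topological_subgroup => p.1 * p.2).
Proof.
move=> [x y]; apply: topsub_cvg; apply: mulg_cvg => /=.
- apply: (@cvg_comp _ _ _ fst val _ (nbhs x)); [exact: cvg_fst|exact: val_continuous].
- apply: (@cvg_comp _ _ _ snd val _ (nbhs y)); [exact: cvg_snd|exact: val_continuous].
Qed.

Lemma topsub_invg : continuous (fun x : topological_subgroup => x^-1).
Proof.
move=> x; apply: (@topsub_cvg _ (nbhs x) _ _ (nbhs_filter x)).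
apply: (@cvg_comp _ _ _ val (fun z : L => z^-1) _ (nbhs (val x))); first exact: val_continuous.
exact: (@invg_continuous L (val x)).
Qed.

HB.instance Definition _ :=
  PreTopologicalGroup_isTopologicalGroup.Build topological_subgroup topsub_mulg topsub_invg.

Hypotheses (lch : locally_compact_hausdorff L) (clA : closed A).

Lemma topsub_locally_compact_hausdorff : locally_compact_hausdorff topological_subgroup.
Proof.
split; last first.
  move=> p q pq; apply/val_inj/lch.2 => B C pB qC.
  have [z [Bz Cz]] := pq _ _ (val_continuous pB) (val_continuous qC).
  by exists (val z).
move=> x _; have [K] := lch.1 (val x) I; rewrite withinET => xK [cK clK].
exists (val @^-1` K); first by rewrite withinET; apply: val_continuous xK.
split; last by apply: (continuous_closedP _).1 clK; apply: val_continuous.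
rewrite compact_ultra => F FU FK.
have cKA : compact (K `&` A) by apply: compact_closedI.
have FKA : (val @ F) (K `&` A).
  by apply: (@filterS _ F _ _ _ _ FK) => z Kz; split=> //; apply/set_mem/(valP z).
move: cKA; rewrite compact_ultra => /(_ _ (ultra_fmap val FU) FKA) [p [[Kp Ap] cp]].
exists (Sub p (mem_set Ap)); split=> //=.
exact: (@topsub_cvg topological_subgroup F id (Sub p (mem_set Ap)) _ cp).
Qed.

End SubgroupTopology.

Section Restriction.
Context (Gamma : artin_graph) (L : topologicalGroupType).
Context (psi : UMagmaMorphism.type L (artin_group Gamma)).
Context (A : set L) (Agc : group_closed (mem A)).
Context (g : artin_group Gamma) (X : {set Gamma}).
Hypothesis psiA : forall x, A x -> conj_set g (std_parabolic X) (psi x).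

Lemma restriction_mem (x : topological_subgroup Agc) : g^-1 * psi (val x) * g \in std_parabolic X.
Proof. by apply/mem_set/conj_setE/psiA/set_mem/(valP x). Qed.

(** Conjugation by g takes the image from the parabolic subgroup to the standard one. *)
Definition restriction (x : topological_subgroup Agc) : std_parabolic_group X :=
  exist (fun a => a \in std_parabolic X) _ (restriction_mem x).

Lemma restriction_morphism : monoid_morphism restriction.
Proof.
split=> [|x y]; apply: val_inj => /=; first by rewrite gmulf1 mulg1 mulVg.
by rewrite gmulfM !mulgA mulgK.
Qed.

HB.instance Definition _ :=
  isUMagmaMorphism.Build (topological_subgroup Agc) (std_parabolic_group X) restriction restriction_morphism.

End Restriction.

Section Homomorphisms.
Context (Gamma : artin_graph) (hB : class_B Gamma) (L : topologicalGroupType).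
Context (psi : UMagmaMorphism.type L (artin_group Gamma)).
Hypothesis lch : locally_compact_hausdorff L.

(** The algebraic core of the argument applied to the closure of the kernel. *)
Lemma kernel_closure_parabolic : exists2 P, complete_parabolic P & psi @` kernel_closure psi `<=` P.
Proof.
apply: (power_solvable_parabolic hB).
  by apply: image_subgroup; apply: kernel_closure_subgroup.
by apply: (image_power_solvable lch); apply: (@code_inj Gamma).
Qed.

Lemma almost_connected_image : almost_connected L ->
  exists P, complete_parabolic P /\ range psi `<=` P.
Proof.
move=> ac; have [P cP LP] := kernel_closure_parabolic.
have opn := kernel_closure_open lch psi (@code_inj Gamma).
have sgp := kernel_closure_subgroup psi.
have [|c d cd ncd _ [x _ <-]|Q cQ RQ] := @elliptic_complete Gamma hB (range psi).
- by apply: image_subgroup; split.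
- have [n n0 xn] := almost_connected_power ac sgp opn x.
  by apply: (power_elliptic cd ncd cP n0); apply: LP; exists (x ^+ n) => //; apply: gmulfXn.
- by exists Q.
Qed.

(** Slenderness makes the kernel open in the closure of the kernel, which is open
    in L. *)
Lemma slender_continuous : 
  (forall X : {set Gamma}, free_of_infinity X -> lcH_slender (std_parabolic_group X)) ->
  continuous (psi : L -> discrete_topology (artin_group Gamma)).
Proof.
move=> sl; have [P [g [X [Xf PE]]] LP] := kernel_closure_parabolic.
have opn := kernel_closure_open lch psi (@code_inj Gamma).
have sgp := kernel_closure_subgroup psi.
have gc := subgroup_group_closed sgp.
have psiA x : kernel_closure psi x -> conj_set g (std_parabolic X) (psi x).
  by move=> Lx; rewrite -PE; apply: LP; exists x.
have cA : closed (kernel_closure psi) by apply: closed_closure.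
have cont := sl X Xf (topological_subgroup gc) (topsub_locally_compact_hausdorff gc lch cA)
  (@restriction Gamma L psi _ gc g X psiA : UMagmaMorphism.type _ _).
have ker1 : nbhs (1 : L) [set x | psi x = 1].
  have r1 : @restriction Gamma L psi _ gc g X psiA 1 = 1 by apply: gmulf1.
  have : nbhs (1 : topological_subgroup gc) [set x | @restriction Gamma L psi _ gc g X psiA x = 1].
    by apply: (cont 1 [set y | y = 1]); apply/principal_filterP; exact: r1.
  move=> [_ [[O oO <-] O1 OK]].
  have nb : nbhs (1 : L) (O `&` kernel_closure psi).
    apply: filterI; first by apply: open_nbhs_nbhs; split.
    by apply: open_nbhs_nbhs; split=> //; have [] := sgp.
  apply: filterS nb => x [Ox Lx].
  have := OK (Sub x (mem_set Lx)) Ox => /(congr1 val) /= e.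
  by apply: (mulgI g^-1); apply: (mulIg g); rewrite e mulg1 mulVg.
move=> x B /principal_filterP Bx.
have e : 1 = x^-1 * x by rewrite mulVg.
rewrite e in ker1; apply: filterS (nbhs_mulgl ker1) => y /=.
rewrite gmulfM psiV => exy; suff -> : psi y = psi x by [].
by rewrite -[psi y](mulVKg (psi x)) exy mulg1.
Qed.

End Homomorphisms.

Theorem theorem1p9 (Gamma : artin_graph) (hB : class_B Gamma) :
  (forall (L : topologicalGroupType)
          (psi : UMagmaMorphism.type L (artin_group Gamma)),
     locally_compact_hausdorff L -> almost_connected L ->
     exists P : set (artin_group Gamma),
       complete_parabolic P /\ range psi `<=` P)
  /\
  ((forall X : {set Gamma}, free_of_infinity X ->
      lcH_slender (std_parabolic_group X)) ->
   lcH_slender (artin_group Gamma)).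
Proof.
split=> [L psi lch ac|sl L lch psi]; first exact: almost_connected_image.
exact: slender_continuous.
Qed.
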